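(* Fix $f\in\mathcal{T}(\mathbb{D})$, i.e. $f:\mathbb{D}\to\mathbb{C}$ is harmonic and $\lim_{\alpha\to0^+}\alpha^2\int_{\mathbb{D}}|f(w)|^2(1-|w|^2)^\alpha dA(w)=0$. Let $(s_n)_{n\ge1}$ be a fixed sequence in $(1,\infty)$ converging to $1$ and satisfying $$\sum_{n=1}^\infty(s_n-1)^2\int_{\mathbb{D}}|f(w)|^2(1-|w|^2)^{2s_n-2}\,dA(w)<\infty.$$ Then for $\mathbb{P}_{K_{\mathbb{D}}}$-almost every $X\in\mathrm{Conf}(\mathbb{D})$, the equality $$\int_D\limsup_{n\to\infty}\Big|\frac{g_X(s_n,z;f)}{\mathbb{E}_{\mathbb{P}_{K_{\mathbb{D}}}}(g_X(s_n,z))}-f(z)\Big|^2dA(z)=0$$ holds for any relatively compact subset $D\subset\mathbb{D}$, and moreover $$f(z)=\lim_{n\to\infty}\frac{g_X(s_n,z;f)}{g_X(s_n,z)}\quad\text{for Lebesgue almost every }z\in\mathbb{D}.$$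
   Context: $\mathbb{D}$ is the open unit disk in $\mathbb{C}$, $dA$ is Lebesgue measure on $\mathbb{D}$ normalized so that $A(\mathbb{D})=1$, and $K_{\mathbb{D}}(z,w)=(1-z\bar w)^{-2}$ is the Bergman kernel. $\mathrm{Conf}(\mathbb{D})$ is the space of (locally finite) configurations $X$ on $\mathbb{D}$, and $\mathbb{P}_{K_{\mathbb{D}}}$ is the determinantal point process induced by $K_{\mathbb{D}}$: the unique simple point process (Borel probability measure on $\mathrm{Conf}(\mathbb{D})$) whose $n$-th correlation function with respect to $dA$ is $\det(K_{\mathbb{D}}(x_i,x_j))_{1\le i,j\le n}$ for all $n\ge1$. The Poincaré metric is $d_{\mathbb{D}}(x,z)=\log\frac{1+|\varphi_x(z)|}{1-|\varphi_x(z)|}$ with $\varphi_x(z)=\frac{z-x}{1-\bar x z}$. For $k\in\mathbb{N}=\{0,1,2,\dots\}$, $z\in\mathbb{D}$: $\mathbb{A}_k(z)=\{x\in\mathbb{D}:k\le d_{\mathbb{D}}(z,x)<k+1\}$. For $s>1$: $g_X(s,z)=\sum_{x\in X}e^{-s d_{\mathbb{D}}(x,z)}$ and $g_X(s,z;f)=\sum_{k=0}^\infty\ \sum_{x\in X\cap\mathbb{A}_k(z)}e^{-s d_{\mathbb{D}}(z,x)}f(x)$. For fixed $f\in\mathcal{T}(\mathbb{D})$ and $s>1$, for $\mathbb{P}_{K_{\mathbb{D}}}$-almost every $X$ the outer series over $k$ converges absolutely for Lebesgue almost every $z\in\mathbb{D}$. *)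

(* Defs.v *)
From HB Require Import structures.
From mathcomp Require Import all_boot all_order all_algebra.
From mathcomp Require Import complex.
From mathcomp Require Import all_classical all_reals all_analysis.
From mathcomp Require Import measurable_realfun.

Set Implicit Arguments.
Unset Strict Implicit.
Unset Printing Implicit Defensive.

Import Order.TTheory GRing.Theory Num.Theory.
Import numFieldNormedType.Exports.

Local Open Scope classical_set_scope.
Local Open Scope ring_scope.
Local Open Scope complex_scope.

(* Points of the complex plane are pairs of reals, so that the topology, the
   sigma-algebra, the Lebesgue measure and the directional derivatives are those
   of the product R * R; complex arithmetic takes place in R[i], through [cplx].
   Pitfall: [`|z|] on R * R is the maximum norm; the modulus is [modulus z]. *)
Notation plane R := (measurableTypeR R * measurableTypeR R)%type.

Section Disk.
Variable R : realType.
Implicit Types x z w : plane R.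

Definition cplx z : R[i] := z.1 +i* z.2.

Definition modulus z : R := Normc.normc (cplx z).

Definition disk : set (plane R) := [set z | modulus z < 1].

Definition relatively_compact_in_disk (D : set (plane R)) : Prop :=
  compact (closure D) /\ closure D `<=` disk.

Lemma invr_pi_ge0 : 0 <= (pi : R)^-1.
Proof. by rewrite invr_ge0 pi_ge0. Qed.

(* The area measure, normalized so that the disk has mass 1; it is defined on
   the whole plane and every integral below is restricted to the disk. *)
Definition dA : {measure set (plane R) -> \bar R} :=
  mscale (NngNum invr_pi_ge0)
    (@lebesgue_measure R \x @lebesgue_measure R)%E.

Definition mobius x z : R[i] :=
  (cplx z - cplx x) / (1 - conjc (cplx x) * cplx z).

Definition poincare_dist x z : R :=
  ln ((1 + Normc.normc (mobius x z)) /
      (1 - Normc.normc (mobius x z))).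

Definition annulus (k : nat) z : set (plane R) :=
  [set x | disk x /\ k%:R <= poincare_dist z x < k.+1%:R].

Definition bergman_kernel z w : R[i] := ((1 - cplx z * conjc (cplx w)) ^+ 2)^-1.

End Disk.

Section Harmonic.
Variable R : realType.

Definition C1_on (U : set (plane R)) (u : plane R -> R) : Prop :=
  forall z e : plane R, U z -> e = (1, 0) \/ e = (0, 1) ->
    derivable u z e /\ {for z, continuous ('D_e u)}.

Definition C2_on (U : set (plane R)) (u : plane R -> R) : Prop :=
  [/\ C1_on U u, C1_on U ('D_(1, 0) u) & C1_on U ('D_(0, 1) u)].

Definition real_harmonic_on (U : set (plane R)) (u : plane R -> R) : Prop :=
  C2_on U u /\
  forall z, U z -> 'D_(1, 0) ('D_(1, 0) u) z + 'D_(0, 1) ('D_(0, 1) u) z = 0.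

Definition harmonic_on (U : set (plane R)) (f : plane R -> R[i]) : Prop :=
  real_harmonic_on U (fun z => complex.Re (f z)) /\
  real_harmonic_on U (fun z => complex.Im (f z)).

Definition weighted_sq_norm (f : plane R -> R[i]) (a : R) : \bar R :=
  (\int[@dA R]_(w in @disk R)
     (Normc.normc (f w) ^+ 2 * (1 - modulus w ^+ 2) `^ a)%:E)%E.

Definition class_T (f : plane R -> R[i]) : Prop :=
  harmonic_on (@disk R) f /\
  ((a ^+ 2)%:E * weighted_sq_norm f a)%E @[a --> 0^'+] --> 0%E.

End Harmonic.

Section Configurations.
Variable R : realType.

(* A configuration is given by its multiplicity function: [X x] is the number of
   particles of [X] at [x]. *)
Record configuration := Configuration {
  mult :> plane R -> nat ;
  mult_in_disk : forall x, mult x <> 0%N -> disk x ;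
  mult_locally_finite : forall B, compact B -> B `<=` @disk R ->
    finite_set (B `&` [set x | mult x <> 0%N]) }.

Lemma empty_configuration_locally_finite (B : set (plane R)) :
  compact B -> B `<=` @disk R -> finite_set (B `&` [set _ | 0%N <> 0%N]).
Proof.
move=> _ _; rewrite (_ : _ `&` _ = set0) ?finite_set0//.
by rewrite -subset0 => x [].
Qed.

Definition empty_configuration : configuration :=
  @Configuration (fun=> 0%N) (fun x h => False_ind _ (h erefl))
    empty_configuration_locally_finite.

HB.instance Definition _ := gen_eqMixin configuration.
HB.instance Definition _ := gen_choiceMixin configuration.
HB.instance Definition _ := isPointed.Build configuration empty_configuration.

Definition particle_count (X : configuration) (B : set (plane R)) : nat :=
  (\big[addn/0%N]_(x \in B) X x)%N.

(* The Borel sets of the vague topology are those generated by the particle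
   counts. *)
Definition count_events : set (set configuration) :=
  [set E | exists B : set (plane R), exists n : nat,
    [/\ measurable B, relatively_compact_in_disk B &
        E = [set X | particle_count X B = n]]].

Definition Conf := g_sigma_algebraType count_events.

Implicit Type P : probability Conf R.

Definition simple_process P : Prop :=
  {ae P, forall X : Conf, forall x, ((X : configuration) x <= 1)%N}.

(* A particle of [X] is a pair [(x, i)] with [i < X x]; the sum is over the
   ordered n-tuples of distinct particles of [X]. *)
Definition factorial_sum n (X : configuration)
    (phi : n.-tuple (plane R) -> \bar R) : \bar R :=
  \esum_(t in [set t : n.-tuple (plane R * nat) |
                 uniq t /\ forall i, ((tnth t i).2 < X (tnth t i).1)%N])
    phi [tuple of map fst t].

(* The integral over the n-th power of the disk with respect to the n-fold
   product of [dA], as an iterated integral; it is only applied to nonnegative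
   functions. *)
Fixpoint disk_integral n : (n.-tuple (plane R) -> \bar R) -> \bar R :=
  match n with
  | 0%N => fun h => h [tuple]
  | n'.+1 => fun h =>
      (\int[@dA R]_(x in @disk R)
         disk_integral (fun t : n'.-tuple (plane R) => h [tuple of x :: t]))%E
  end.

Definition correlation_function P n (rho : n.-tuple (plane R) -> R) : Prop :=
  forall phi : n.-tuple (plane R) -> \bar R,
    measurable_fun setT phi -> (forall t, 0 <= phi t)%E ->
    (\int[P]_X factorial_sum X phi =
     disk_integral (fun t => phi t * (rho t)%:E))%E.

(* [K] is meant to be Hermitian, so that the determinants are real. *)
Definition determinantal_process P (K : plane R -> plane R -> R[i]) : Prop :=
  simple_process P /\
  forall n, (0 < n)%N ->
    correlation_function P (fun t : n.-tuple (plane R) =>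
      complex.Re (\det (\matrix_(i < n, j < n) K (tnth t i) (tnth t j)))).

Definition g (X : configuration) (s : R) (z : plane R) : \bar R :=
  \esum_(x in @disk R) ((X x)%:R * expR (- s * poincare_dist x z))%:E.

Definition expected_g P (s : R) (z : plane R) : \bar R :=
  (\int[P]_X g X s z)%E.

Definition g_annulus (f : plane R -> R[i]) (X : configuration)
    (s : R) (z : plane R) (k : nat) : R[i] :=
  \sum_(x \in annulus k z)
    (X x)%:R * (expR (- s * poincare_dist z x))%:C * f x.

(* [R[i]^o] carries the topology of the complex plane; where the series
   diverges the value is arbitrary. *)
Definition g_weighted (f : plane R -> R[i]) (X : configuration)
    (s : R) (z : plane R) : R[i] :=
  limn (fun n => \sum_(0 <= k < n) g_annulus f X s z k : R[i]^o).

End Configurations.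

(* Main.v *)
Require Import Defs.
From HB Require Import structures.
From mathcomp Require Import all_boot all_order all_algebra.
From mathcomp Require Import complex ring lra.
From mathcomp Require Import all_classical all_reals all_analysis.
From mathcomp Require Import measurable_realfun.

(** The sum of exp (- s d) over the particles has mean of order 1 / (s - 1), and
the same sum weighted by a harmonic function f has f z times that mean: the
weight is radial about z in the hyperbolic geometry of the disk, and so is the
intensity (1 - |x|^2)^-2 of the point process, which is the hyperbolic area
density.  The fluctuation around the mean is of smaller order, because the
particles repel each other.  Dividing by the mean leaves f z.

Mean.  Write t for the squared pseudohyperbolic distance |phi_z(x)|^2, phi_z
being the disk automorphism that sends z to 0.  Pulled back by phi_z, harmonic
functions obey the mean value property.  It is obtained here without conformal
invariance of the Laplacian: Green's identity, applied to a harmonic h and to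
the cube of the truncation b = (c - t)^+, yields one linear relation between the
integrals of h b and h b^2 against |phi_z'|^2 ([moment_relation]); since the
derivative in c of the second is twice the first, it is a multiple of c^3
([moment2E]), the factor being found by letting c tend to 0
([moment_const_mean]).  Differentiating twice in c gives the mass of h on each
disk t < c ([integral_pball]), hence all radial integrals ([radial_formula],
[mass_radial], [annular_mean_value]).

Variance.  The two-point correlation of a determinantal process is at most the
product of the intensities ([det2_bergman_bounds]), so that the variance of
the sum of phi over the particles is at most twice the mean of the sum of phi^2
([variance_lsum]).  For the sum over an annulus about z, that mean is bounded by
a weighted norm of h at exponent 2 s - 2 ([mass_sq_annular_le]); a weight
exp (de k) on the k-th annulus can be afforded at the price of lowering the
exponent by de ([sum_mass_sq_annular_le]).

Almost sure limits.  For each fixed z two kinds of random series have finite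
mean.  Those of the first kind, [series_energy], one for each n, force the sums
over annuli to converge absolutely.  The second, [limit_energy], is the sum over
n of (s n - 1)^2 times the squared fluctuation at s n; its mean is finite by the
summability hypothesis, and so (s n - 1) times the fluctuation tends to 0 while
(s n - 1) times the mean stays away from 0 ([total_mass_lb]).  Tonelli's theorem
exchanges the quantifiers on z and on the configuration ([ae_ae_finite]).

All this is done for real harmonic functions ([real_core]) and applied to the
real part of f, to its imaginary part, and to the constant 1; the last gives
that the sum of exp (- s d) itself is equivalent to its mean.  The summability
hypothesis passes from f to 1 because the weighted norms of a nonzero f are
bounded below ([sum_sq_wnorm1]); a zero f is trivial. *)

Set Implicit Arguments.
Unset Strict Implicit.
Unset Printing Implicit Defensive.

Import Order.TTheory GRing.Theory Num.Theory.
Import numFieldNormedType.Exports.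

Local Open Scope classical_set_scope.
Local Open Scope ring_scope.

(** * The plane as a product of two lines *)

Section PlaneTopology.
Variable R : realType.
Implicit Types (U : set (plane R)) (x z : plane R).

(** The sigma-algebra is that of the product, generated by measurable rectangles;
    an open set is a countable union of boxes with rational centers and radii. *)
Lemma open_plane_measurable U : open U -> measurable U.
Proof.
move=> oU.
pose box (q : rat * rat * rat) : set (plane R) :=
  ball (ratr q.1.1 : R) (ratr q.2) `*` ball (ratr q.1.2 : R) (ratr q.2).
have -> : U = \bigcup_q (if `[< box q `<=` U >] then box q else set0).
  apply/seteqP; split => [[x y] Uxy|z [q _]]; last first.
    by case: asboolP => // bU /bU.
  have := open_nbhs_nbhs (conj oU Uxy) => -[[A B] /= [nA nB] ABU].
  have /nbhs_ballP[e1 /= e10 be1] := nA.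
  have /nbhs_ballP[e2 /= e20 be2] := nB.
  pose e := Num.min e1 e2.
  have e0 : 0 < e by rewrite lt_min e10.
  have er : e / 4 < e / 2 by lra.
  have ex : x - e / 4 < x + e / 4 by lra.
  have ey : y - e / 4 < y + e / 4 by lra.
  have [r] := rat_in_itvoo er; rewrite in_itv/= => /andP[r1 r2].
  have [p] := rat_in_itvoo ex; rewrite in_itv/= => /andP[p1 p2].
  have [s] := rat_in_itvoo ey; rewrite in_itv/= => /andP[s1 s2].
  have e1e : e <= e1 by rewrite /e ge_min lexx.
  have e2e : e <= e2 by rewrite /e ge_min lexx orbT.
  exists (p, s, r) => //=; rewrite asboolT.
    by split; rewrite /ball/= ltr_norml; lra.
  move=> [a b] [/= ]; rewrite /ball/= => pa sb; apply: ABU; split => /=.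
    apply: be1; rewrite /ball/=; move: pa; rewrite !ltr_norml; lra.
  apply: be2; rewrite /ball/=; move: sb; rewrite !ltr_norml; lra.
apply: countable_bigcupT_measurable; first exact: countableP.
move=> q; case: ifPn => // _.
by apply: measurableX; exact: measurable_ball.
Qed.

Lemma continuous_plane_measurable U (f : plane R -> R) : open U ->
  (forall x, U x -> {for x, continuous f}) -> measurable_fun U f.
Proof.
move=> oU cf; apply: (measurability _ (RGenOpens.measurableE R)).
move=> _ [_ [a [b ->]] <-]; apply: open_plane_measurable.
rewrite openE => x [Ux fx]; apply: filterI; first exact: open_nbhs_nbhs.
by apply: cf => //; apply: open_nbhs_nbhs; split => //; exact: interval_open.
Qed.

End PlaneTopology.

Section Directional.
Variable R : realType.
Implicit Types (x v : plane R).

(** Directional derivatives reduce to one-variable ones along lines. *)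
Lemma is_derive_line (F : plane R -> R) x v (t d : R) :
  is_derive (t *: v + x) v F d <->
  is_derive t 1 (fun s : R => F (s *: v + x)) d.
Proof.
have E : (fun h : R => h^-1 *: ((F \o shift (t *: v + x)) (h *: v) - F (t *: v + x)))
  = (fun h : R => h^-1 *: (((fun s : R => F (s *: v + x)) \o shift t) (h *: 1)
       - F (t *: v + x))).
  by apply/funext => h /=; rewrite addrA -scalerDl /GRing.scale/= mulr1.
by split => -[d1 d2]; split; move: d1 d2; rewrite /derivable /derive E.
Qed.

Lemma is_derive_chain (f : R -> R) (F : plane R -> R) x v a b :
  is_derive (F x) 1 f a -> is_derive x v F b ->
  is_derive x v (f \o F) (a * b).
Proof.
move=> fa Fb; rewrite -[x]add0r -(scale0r v); apply/is_derive_line.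
apply: (is_derive1_comp (f := f) (g := fun s => F (s *: v + x))).
  by rewrite scale0r add0r.
by apply/is_derive_line; rewrite scale0r add0r.
Qed.

Lemma is_derive_fst x v : is_derive x v (fun p : plane R => p.1) v.1.
Proof.
rewrite -[x]add0r -(scale0r v); apply/is_derive_line => /=.
have -> : (fun s : R => s *: v.1 + x.1) = (id \* cst v.1) + cst x.1 by [].
by apply: is_derive_eq; rewrite /GRing.scale/= mulr0 add0r addr0 mulr1.
Qed.

Lemma is_derive_snd x v : is_derive x v (fun p : plane R => p.2) v.2.
Proof.
rewrite -[x]add0r -(scale0r v); apply/is_derive_line => /=.
have -> : (fun s : R => s *: v.2 + x.2) = (id \* cst v.2) + cst x.2 by [].
by apply: is_derive_eq; rewrite /GRing.scale/= mulr0 add0r addr0 mulr1.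
Qed.

End Directional.

(** * Moebius geometry of the disk *)

Section PositivePart.
Variable R : realType.

Definition ppart (t : R) : R := Num.max t 0.

Lemma ppart_ge0 t : 0 <= ppart t.
Proof. by rewrite /ppart le_max lexx orbT. Qed.

(** From the square on, powers of the positive part have no kink at 0. *)
Lemma is_derive_ppart_exp (n : nat) (t : R) :
  is_derive t 1 (fun s => ppart s ^+ n.+2) (n.+2%:R * ppart t ^+ n.+1).
Proof.
have [t0|t0|t0] := ltgtP t 0.
- apply: (@near_eq_is_derive _ _ _ (cst 0)).
    by near=> s; rewrite /ppart max_r ?expr0n//; near: s; apply: filterS (lt_nbhsl t0) => ? /ltW.
  by apply: is_derive_eq; rewrite /ppart max_r ?ltW// expr0n mulr0.
- apply: (@near_eq_is_derive R R R (fun s : R => s ^+ n.+2)).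
    near=> s; rewrite /ppart max_l// ltW//; near: s; exact: lt_nbhsr.
  rewrite /ppart max_l ?ltW//.
  rewrite (_ : (fun s => s ^+ n.+2) = id ^+ n.+2); last first.
    by apply/funext => s; rewrite fctE.
  by apply: is_derive_eq; rewrite /GRing.scale/= mulr1.
rewrite t0 /ppart maxxx expr0n mulr0.
have H : (fun h : R => h^-1 *: (((fun s => ppart s ^+ n.+2) \o shift 0) (h *: 1)
   - ppart 0 ^+ n.+2)) @ 0^' --> (0 : R).
  apply/cvgrPdist_le => /= e e0.
  near=> h.
  rewrite sub0r normrN /GRing.scale/= mulr1 addr0 /ppart maxxx expr0n subr0.
  have [h0|h0] := leP h 0.
    by rewrite expr0n mulr0 normr0 ltW.
  rewrite exprS mulrA mulVf ?gt_eqF// mul1r ger0_norm; last by rewrite exprn_ge0 ?ltW.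
  have h1 : `|h| <= 1 by near: h; exact: dnbhs0_le.
  have he : `|h| <= e by near: h; exact: dnbhs0_le.
  rewrite gtr0_norm// in h1 he.
  by apply: le_trans he; rewrite exprS ler_piMr ?exprn_ile1// ltW//.
split; first by apply/cvg_ex; exists 0.
exact: cvg_lim H.
Unshelve. all: by end_near. Qed.

End PositivePart.

Section DiskGeometry.
Variable R : realType.
Implicit Types (x z v : plane R).

Definition sqmod x : R := x.1 ^+ 2 + x.2 ^+ 2.

(** This is |1 - conj(z) x|^2. *)
Definition moebius_den z x : R :=
  (1 - (z.1 * x.1 + z.2 * x.2)) ^+ 2 + (z.1 * x.2 - z.2 * x.1) ^+ 2.

(** This is 1 - |phi_z(x)|^2, where phi_z is the disk automorphism sending z to 0. *)
Definition defect z x : R := (1 - sqmod z) * (1 - sqmod x) / moebius_den z x.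

(** This is |phi_z'(x)|^2, the Jacobian of phi_z. *)
Definition moebius_jac z x : R := (1 - sqmod z) ^+ 2 / moebius_den z x ^+ 2.

Lemma diskE x : disk x <-> sqmod x < 1.
Proof.
rewrite /disk/= /modulus /cplx /= /sqmod.
by rewrite -[X in _ < X](@sqrtr1 R) ltr_sqrt.
Qed.

Lemma sqmod_ge0 x : 0 <= sqmod x.
Proof. by rewrite addr_ge0 ?sqr_ge0. Qed.

Lemma moebius_den_ge0 z x : 0 <= moebius_den z x.
Proof. by rewrite addr_ge0 ?sqr_ge0. Qed.

Lemma moebius_denE z x :
  moebius_den z x = (1 - sqmod z) * (1 - sqmod x)
    + ((x.1 - z.1) ^+ 2 + (x.2 - z.2) ^+ 2).
Proof. by rewrite /moebius_den /sqmod; ring. Qed.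

Lemma moebius_den_gt0 z x : sqmod z < 1 -> sqmod x < 1 -> 0 < moebius_den z x.
Proof.
move=> z1 x1; rewrite moebius_denE ltr_pwDl ?mulr_gt0 ?subr_gt0//.
by rewrite addr_ge0 ?sqr_ge0.
Qed.

Lemma moebius_den_le z x : sqmod z < 1 -> sqmod x < 1 -> moebius_den z x <= 4.
Proof.
move=> z1 x1.
have -> : moebius_den z x = 2 + 2 * (sqmod z * sqmod x) -
    ((1 + z.1 * x.1 + z.2 * x.2)^+2 + (z.1 * x.2 - z.2 * x.1)^+2).
  by rewrite /moebius_den /sqmod; ring.
have := sqmod_ge0 z; have := sqmod_ge0 x => ? ?.
have := sqr_ge0 (1 + z.1 * x.1 + z.2 * x.2).
have := sqr_ge0 (z.1 * x.2 - z.2 * x.1).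
have : sqmod z * sqmod x <= 1 by rewrite mulr_ile1// ltW.
lra.
Qed.

(** Uniformity in x confines each pseudohyperbolic disk about z to a compact
    Euclidean subdisk. *)
Lemma moebius_den_lb z x : sqmod z < 1 -> sqmod x < 1 ->
  (1 - sqmod z) ^+ 2 / 4 <= moebius_den z x.
Proof.
move=> z1 x1.
set p := z.1 * x.1 + z.2 * x.2; set q := z.1 * x.2 - z.2 * x.1.
have E : p ^+ 2 + q ^+ 2 = sqmod z * sqmod x by rewrite /sqmod /p /q; ring.
have h0 := sqmod_ge0 z.
have p2 : p ^+ 2 <= sqmod z.
  have : sqmod z * sqmod x <= sqmod z by rewrite ler_piMr// ltW.
  have := sqr_ge0 q; lra.
have p1 : 2 * p <= 1 + sqmod z by have := sqr_ge0 (p - 1); nra.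
rewrite /moebius_den -/p -/q.
have := sqr_ge0 q.
suff : (1 - sqmod z) ^+ 2 / 4 <= (1 - p) ^+ 2 by lra.
have -> : (1 - sqmod z) ^+ 2 / 4 = ((1 - sqmod z) / 2) ^+ 2 by field.
rewrite ler_sqr ?nnegrE; lra.
Qed.

Lemma defectE z x : sqmod z < 1 -> sqmod x < 1 ->
  1 - defect z x = ((x.1 - z.1) ^+ 2 + (x.2 - z.2) ^+ 2) / moebius_den z x.
Proof.
move=> z1 x1; have d0 : moebius_den z x != 0 by rewrite gt_eqF ?moebius_den_gt0.
apply: (mulIf d0); rewrite mulrBl /defect !divfK// {1}moebius_denE; ring.
Qed.

Lemma defect_gt0 z x : sqmod z < 1 -> sqmod x < 1 -> 0 < defect z x.
Proof.
by move=> ? ?; rewrite divr_gt0 ?moebius_den_gt0// mulr_gt0// subr_gt0.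
Qed.

Lemma defect_le1 z x : sqmod z < 1 -> sqmod x < 1 -> defect z x <= 1.
Proof.
move=> ? ?; rewrite -subr_ge0 defectE//.
by rewrite divr_ge0 ?moebius_den_ge0// addr_ge0 ?sqr_ge0.
Qed.

Lemma defect_le0 z x : sqmod z < 1 -> 1 <= sqmod x -> defect z x <= 0.
Proof.
move=> z1 x1; rewrite /defect -mulrA pmulr_rle0 ?subr_gt0//.
by rewrite mulr_le0_ge0 ?subr_le0// invr_ge0 moebius_den_ge0.
Qed.

Lemma is_derive_add (a b : plane R -> R) x v da db :
  is_derive x v a da -> is_derive x v b db ->
  is_derive x v (fun p => a p + b p) (da + db).
Proof. by move=> ? ?; exact: is_deriveD. Qed.

Lemma is_derive_opp (a : plane R -> R) x v da :
  is_derive x v a da -> is_derive x v (fun p => - a p) (- da).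
Proof. by move=> ?; exact: is_deriveN. Qed.

Lemma is_derive_mul (a b : plane R -> R) x v da db :
  is_derive x v a da -> is_derive x v b db ->
  is_derive x v (fun p => a p * b p) (a x * db + b x * da).
Proof. by move=> ? ?; exact: is_deriveM. Qed.

Lemma is_derive_inv (a : plane R -> R) x v da :
  a x != 0 -> is_derive x v a da ->
  is_derive x v (fun p => (a p)^-1) (- (a x) ^- 2 * da).
Proof.
move=> ax ad; apply: (@is_derive_chain R (fun t => t^-1) a x v _ _ _ ad).
have := @is_deriveV R id (a x) 1 1 ax (is_derive_id _ _).
by rewrite /GRing.scale/= mulr1.
Qed.

Lemma is_derive_const (c : R) x v : is_derive x v (fun=> c : R) 0.
Proof. exact: is_derive_cst. Qed.

(** The directional derivatives along v are written in closed form, so that the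
    differential identities below become identities of rational functions. *)
Definition den1 z v x : R :=
  - 2 * (z.1 * v.1 + z.2 * v.2) * (1 - (z.1 * x.1 + z.2 * x.2))
  + 2 * (z.1 * v.2 - z.2 * v.1) * (z.1 * x.2 - z.2 * x.1).

Definition den2 z v : R :=
  2 * ((z.1 * v.1 + z.2 * v.2) ^+ 2 + (z.1 * v.2 - z.2 * v.1) ^+ 2).

Definition defect1 z v x : R :=
  (1 - sqmod z) * (- 2 * (x.1 * v.1 + x.2 * v.2) * moebius_den z x
    - (1 - sqmod x) * den1 z v x) / moebius_den z x ^+ 2.

Definition defect2 z v x : R :=
  (1 - sqmod z) * ((- 2 * sqmod v * moebius_den z x - (1 - sqmod x) * den2 z v)
     * moebius_den z x
   - 2 * den1 z v x * (- 2 * (x.1 * v.1 + x.2 * v.2) * moebius_den z x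
    - (1 - sqmod x) * den1 z v x)) / moebius_den z x ^+ 3.

Ltac derive_plane := repeat first
  [ apply: is_derive_fst | apply: is_derive_snd | apply: is_derive_const
  | apply: is_derive_opp | apply: is_derive_add | apply: is_derive_mul
  | apply: is_derive_inv ].

Lemma is_derive_defect z v x : moebius_den z x != 0 ->
  is_derive x v (defect z) (defect1 z v x).
Proof.
move=> d0; apply: is_derive_eq.
  apply: is_derive_mul; last apply: is_derive_inv => //;
  by rewrite /moebius_den /sqmod ?expr2; derive_plane.
rewrite /= /defect1 /den1; move: d0; rewrite /moebius_den /sqmod ?expr2 => d0.
by field.
Qed.

Lemma is_derive_defect1 z v x : moebius_den z x != 0 ->
  is_derive x v (defect1 z v) (defect2 z v x).
Proof.
move=> d0; apply: is_derive_eq.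
  apply: is_derive_mul; last (apply: is_derive_inv; first by rewrite expf_neq0//);
  by rewrite /moebius_den /den1 /sqmod ?expr2; derive_plane.
rewrite /= /defect2 /den1 /den2; move: d0; rewrite /moebius_den /sqmod ?expr2 => d0.
by field.
Qed.

(** For holomorphic phi, the gradient of |phi|^2 has squared norm 4 |phi|^2 |phi'|^2. *)
Lemma defect_gradient z x : moebius_den z x != 0 ->
  defect1 z (1, 0) x ^+ 2 + defect1 z (0, 1) x ^+ 2
  = 4 * (1 - defect z x) * moebius_jac z x.
Proof.
move=> d0; rewrite /defect1 /den1 /moebius_jac /defect /=.
by move: d0; rewrite /moebius_den /sqmod ?expr2 => d0; field.
Qed.

(** For holomorphic phi, the Laplacian of |phi|^2 is 4 |phi'|^2. *)
Lemma defect_laplacian z x : moebius_den z x != 0 ->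
  defect2 z (1, 0) x + defect2 z (0, 1) x = - 4 * moebius_jac z x.
Proof.
move=> d0; rewrite /defect2 /den1 /den2 /moebius_jac /defect /=.
by move: d0; rewrite /moebius_den /sqmod ?expr2 /= => d0; field.
Qed.

End DiskGeometry.

(** * A divergence theorem *)

Section Divergence.
Variable R : realType.
Implicit Types (x z v : plane R).

Local Notation lam := (@lebesgue_measure R).
Local Notation lam2 := (lam \x lam)%E.

Definition square : set (plane R) := `[(-1:R), 1] `*` `[(-1:R), 1].

Lemma notin_square x : ~ square x -> 1 <= sqmod x.
Proof.
move=> h; rewrite leNgt; apply/negP => x1; apply: h.
have := sqr_ge0 x.1; have := sqr_ge0 x.2; rewrite /sqmod in x1 => ? ?.
by split; rewrite /= in_itv/= -ler_norml; rewrite -[leRHS]normr1 -ler_sqr ?nnegrE//;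
  rewrite normr1 expr1n real_normK ?num_real//; lra.
Qed.

Lemma square_measurable : measurable square.
Proof. exact: measurableX. Qed.

Lemma square_finite : (lam2 square < +oo)%E.
Proof.
have mI : measurable (`[(-1)%R, 1%R]%classic : set (measurableTypeR R)) by [].
rewrite /square (product_measure1E _ _ mI mI) /= !lebesgue_measure_itv/=.
by case: ifP => _; rewrite -?EFinB -?EFinM ?mule0 ltry.
Qed.

Lemma bounded_integrable_disk (f : plane R -> R) (M : R) :
  measurable_fun setT f -> (forall x, `|f x| <= M) ->
  (forall x, 1 <= sqmod x -> f x = 0) ->
  lam2.-integrable setT (EFin \o f).
Proof.
move=> mf fM f0.
have -> : EFin \o f = (EFin \o f) \_ square.
  apply/funext => x; rewrite patchE; case: ifPn => // /negP; rewrite inE => h.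
  by rewrite /= f0//; exact: notin_square.
apply/integrable_restrict => //; first exact: square_measurable.
rewrite setTI; apply: measurable_bounded_integrable.
- exact: square_measurable.
- exact: square_finite.
- exact: measurable_funS mf.
- exists M; split; first exact: num_real.
  by move=> ? /ltW ? x _; exact: le_trans (fM x) _.
Qed.

Lemma continuous_integrable_disk (f : plane R -> R) :
  (forall x, {for x, continuous f}) ->
  (forall x, 1 <= sqmod x -> f x = 0) ->
  lam2.-integrable setT (EFin \o f).
Proof.
move=> cf f0.
have csq : compact square by apply: compact_setX; exact: segment_compact.
have cfs : {within square, continuous f}.
  by apply: continuous_subspaceT => x; exact: cf.
have [M [_ Mf]] := compact_bounded (continuous_compact cfs csq).
apply: (@bounded_integrable_disk _ (`|M| + 1)) => //.
  by apply: continuous_plane_measurable => //; exact: openT.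
move=> x; have [sx|sx] := pselect (square x).
  by apply: (Mf (`|M| + 1)); [rewrite ltr_pwDr// ler_norm|exists x].
by rewrite f0 ?normr0 ?addr_ge0//; exact: notin_square.
Qed.

(** The fundamental theorem of calculus, between two zeros of q. *)
Lemma integral_derive_compact (q d : R -> R) :
  (forall t : R, is_derive t 1 q (d t)) -> continuous d ->
  (forall t, 1 <= `|t| -> q t = 0 /\ d t = 0) ->
  (\int[lam]_t (d t)%:E = 0)%E.
Proof.
move=> qd cd q0.
have cq : continuous q.
  by move=> t; apply/differentiable_continuous/derivable1_diffP; case: (qd t).
have -> : (\int[lam]_t (d t)%:E = \int[lam]_(t in `[(-1)%R, 1%R]) (d t)%:E)%E.
  rewrite [RHS]integral_mkcond; apply: eq_integral => t _.
  rewrite patchE; case: ifPn => // /negP; rewrite inE/= in_itv/= => h.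
  rewrite (q0 t _).2//; rewrite leNgt ltr_norml; apply/negP => /andP[a b].
  by apply: h; rewrite !ltW.
rewrite (continuous_FTC2 (F := q)) //.
- by rewrite (q0 1 _).1 ?normr1// (q0 (-1) _).1 ?normrN1// subee.
- exact: continuous_subspaceT.
- split; first by move=> t _; case: (qd t).
  + by apply: cvg_at_right_filter; exact: cq.
  + by apply: cvg_at_left_filter; exact: cq.
- by move=> t _; rewrite derive1E; case: (qd t).
Qed.

Lemma continuous_hline (y t : R) :
  {for t, continuous (fun t : R => (t, y) : plane R)}.
Proof.
move=> A [[B C] [/= nB nC] BC]; rewrite /nbhs/=.
by apply: filterS nB => s Bs; apply: BC; split => //=; exact: nbhs_singleton.
Qed.

Lemma continuous_vline (y t : R) :
  {for t, continuous (fun t : R => (y, t) : plane R)}.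
Proof.
move=> A [[B C] [/= nB nC] BC]; rewrite /nbhs/=.
by apply: filterS nC => s Bs; apply: BC; split => //=; exact: nbhs_singleton.
Qed.

(** By Fubini's theorem, it is enough to integrate along the lines parallel to
    the axis. *)
Lemma integral_directional_derive (q d : plane R -> R) v :
  v = (1, 0) \/ v = (0, 1) ->
  (forall x, is_derive x v q (d x)) -> (forall x, {for x, continuous d}) ->
  (forall x, 1 <= sqmod x -> q x = 0 /\ d x = 0) ->
  (\int[lam2]_x (d x)%:E = 0)%E.
Proof.
move=> hv qd cd q0.
have dI : lam2.-integrable setT (EFin \o d).
  by apply: continuous_integrable_disk => // x /q0[].
have big1 (a b : R) : 1 <= `|a| -> 1 <= sqmod (a, b) /\ 1 <= sqmod (b, a).
  move=> a1; have : 1 <= a ^+ 2 by rewrite -[leRHS]real_normK ?num_real// exprn_ege1.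
  by rewrite /sqmod/=; have := sqr_ge0 b; lra.
case: hv => hv; subst v.
- rewrite -(integral21_prod_meas1 dI) /fubini_G/=; apply: integral0_eq => y _.
  have E (F : plane R -> R) : (fun s : R => F (s *: (1, 0) + (0, y))) =
      (fun s => F (s, y)).
    apply/funext => s; congr F.
    by apply: injective_projections => /=;
      rewrite /GRing.scale/= ?mulr1 ?mulr0 ?addr0 ?add0r.
  apply: (@integral_derive_compact (fun t => q (t, y))) => [t|t|t t1].
  + have /is_derive_line := qd (t *: ((1, 0) : plane R) + (0, y)).
    by rewrite E (congr1 (fun g => g t) (E d)).
  + apply: (@continuous_comp _ _ _ (fun t => (t, y)) d); last exact: cd.
    exact: continuous_hline.
  + by apply: q0; have [] := big1 t y t1.
- rewrite -(integral12_prod_meas1 dI) /fubini_F/=; apply: integral0_eq => y _.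
  have E (F : plane R -> R) : (fun s : R => F (s *: (0, 1) + (y, 0))) =
      (fun s => F (y, s)).
    apply/funext => s; congr F.
    by apply: injective_projections => /=;
      rewrite /GRing.scale/= ?mulr1 ?mulr0 ?addr0 ?add0r.
  apply: (@integral_derive_compact (fun t => q (y, t))) => [t|t|t t1].
  + have /is_derive_line := qd (t *: ((0, 1) : plane R) + (y, 0)).
    by rewrite E (congr1 (fun g => g t) (E d)).
  + apply: (@continuous_comp _ _ _ (fun t => (y, t)) d); last exact: cd.
    exact: continuous_vline.
  + by apply: q0; have [] := big1 t y t1.
Qed.

End Divergence.

(** * Continuity *)

Section Continuity.
Variable R : realType.
Implicit Types (x z v : plane R).

Lemma continuous_fst_at x : {for x, continuous (fun p : plane R => p.1)}.
Proof. by case: x => a b; exact: cvg_fst. Qed.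

Lemma continuous_snd_at x : {for x, continuous (fun p : plane R => p.2)}.
Proof. by case: x => a b; exact: cvg_snd. Qed.

Lemma continuous_const_at (c : R) x : {for x, continuous (fun=> c : R)}.
Proof. exact: cvg_cst. Qed.

Lemma continuous_add_at (a b : plane R -> R) x :
  {for x, continuous a} -> {for x, continuous b} ->
  {for x, continuous (fun p => a p + b p)}.
Proof. by move=> ? ?; exact: cvgD. Qed.

Lemma continuous_opp_at (a : plane R -> R) x :
  {for x, continuous a} -> {for x, continuous (fun p => - a p)}.
Proof. by move=> ?; exact: cvgN. Qed.

Lemma continuous_mul_at (a b : plane R -> R) x :
  {for x, continuous a} -> {for x, continuous b} ->
  {for x, continuous (fun p => a p * b p)}.
Proof. by move=> ? ?; exact: cvgM. Qed.

Lemma continuous_inv_at (a : plane R -> R) x :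
  a x != 0 -> {for x, continuous a} -> {for x, continuous (fun p => (a p)^-1)}.
Proof. by move=> ? ?; exact: cvgV. Qed.

Lemma continuous_exp_at (a : plane R -> R) n x :
  {for x, continuous a} -> {for x, continuous (fun p => a p ^+ n)}.
Proof.
move=> ca; elim: n => [|n IH]; first exact: cvg_cst.
have -> : (fun p => a p ^+ n.+1) = (fun p => a p * a p ^+ n).
  by apply/funext => p; rewrite exprS.
exact: continuous_mul_at.
Qed.

Ltac continuous_plane := repeat lazymatch goal with
  | |- context [continuous (fun _ => ?c)] => exact: (@continuous_const_at c)
  | |- context [continuous (fun p => p.1)] => exact: continuous_fst_at
  | |- context [continuous (fun p => p.2)] => exact: continuous_snd_at
  | |- context [continuous (fun p => @?a p + @?b p)] =>
      apply: (@continuous_add_at a b)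
  | |- context [continuous (fun p => - @?a p)] => apply: (@continuous_opp_at a)
  | |- context [continuous (fun p => @?a p * @?b p)] =>
      apply: (@continuous_mul_at a b)
  | |- context [continuous (fun p => @?a p ^+ ?n)] =>
      apply: (@continuous_exp_at a n)
  | |- context [continuous (fun p => (@?a p)^-1)] =>
      apply: (@continuous_inv_at a)
  end.

Lemma continuous_sqmod x : {for x, continuous (@sqmod R)}.
Proof. by rewrite /sqmod; continuous_plane. Qed.

Lemma continuous_moebius_den z x : {for x, continuous (moebius_den z)}.
Proof. by rewrite /moebius_den; continuous_plane. Qed.

Lemma continuous_den1 z v x : {for x, continuous (den1 z v)}.
Proof. by rewrite /den1; continuous_plane. Qed.

Ltac continuous_moebius := continuous_plane; try lazymatch goal with
  | |- is_true _ => idtac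
  | |- context [@sqmod] => exact: continuous_sqmod
  | |- context [@moebius_den] => exact: continuous_moebius_den
  | |- context [@den1] => exact: continuous_den1
  end.

Lemma continuous_defect z x : moebius_den z x != 0 ->
  {for x, continuous (defect z)}.
Proof. by move=> d0; rewrite /defect; continuous_moebius. Qed.

Lemma continuous_moebius_jac z x : moebius_den z x != 0 ->
  {for x, continuous (moebius_jac z)}.
Proof.
by move=> d0; rewrite /moebius_jac; continuous_moebius; rewrite expf_neq0.
Qed.

Lemma continuous_defect1 z v x : moebius_den z x != 0 ->
  {for x, continuous (defect1 z v)}.
Proof.
by move=> d0; rewrite /defect1; continuous_moebius; rewrite expf_neq0.
Qed.

Lemma continuous_defect2 z v x : moebius_den z x != 0 ->
  {for x, continuous (defect2 z v)}.
Proof.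
by move=> d0; rewrite /defect2; continuous_moebius; rewrite expf_neq0.
Qed.

Lemma open_sqmod_lt (r : R) : open [set x : plane R | sqmod x < r].
Proof.
rewrite openE => x /= xr.
by have := continuous_sqmod (lt_nbhsl xr).
Qed.

Lemma open_sqmod_gt (r : R) : open [set x : plane R | r < sqmod x].
Proof.
rewrite openE => x /= xr.
by have := continuous_sqmod (lt_nbhsr xr).
Qed.

Lemma disk_sqmodE : @disk R = [set x | sqmod x < 1].
Proof. by apply/seteqP; split => x /diskE. Qed.

Lemma open_disk : open (@disk R).
Proof. by rewrite disk_sqmodE; exact: open_sqmod_lt. Qed.

Lemma measurable_disk : measurable (@disk R).
Proof. exact: open_plane_measurable open_disk. Qed.

(** The mean value inequality on the segment between s and t, in either order. *)
Lemma lipschitz_of_derive (q : R -> R) (M s t : R) :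
  (forall r, Num.min s t <= r <= Num.max s t ->
     derivable q r 1 /\ `|'D_1 q r| <= M) ->
  `|q s - q t| <= M * `|s - t|.
Proof.
wlog st : s t / t <= s.
  move=> H; have /orP[] := le_total t s; first exact: H.
  by move=> ts dq; rewrite distrC (distrC s); apply: H => // r; rewrite minC maxC; exact: dq.
rewrite min_r// max_l// => dq.
have [r||r /[!in_itv]/= /dq[_ qM] ->] := @MVT_segment R q ('D_1 q) t s st.
- rewrite in_itv/= => /andP[/ltW tr /ltW rs].
  by apply: derivableP; have [] := dq r; rewrite ?tr.
- apply: continuous_in_subspaceT => r0; rewrite inE/= in_itv/= => /dq[dr _].
  by apply/differentiable_continuous/derivable1_diffP.
by rewrite normrM ler_wpM2r.
Qed.

Lemma is_derive_hline (h : plane R -> R) (a b d : R) :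
  is_derive (a, b) (1, 0) h d -> is_derive a 1 (fun t => h (t, b)) d.
Proof.
have E (s : R) : s *: (1, 0) + (0, b) = (s, b) :> plane R.
  by apply: injective_projections => /=;
    rewrite /GRing.scale/= ?mulr1 ?mulr0 ?addr0 ?add0r.
rewrite -E => /is_derive_line.
by under eq_fun do rewrite E.
Qed.

Lemma is_derive_vline (h : plane R -> R) (a b d : R) :
  is_derive (a, b) (0, 1) h d -> is_derive b 1 (fun t => h (a, t)) d.
Proof.
have E (s : R) : s *: (0, 1) + (a, 0) = (a, s) :> plane R.
  by apply: injective_projections => /=;
    rewrite /GRing.scale/= ?mulr1 ?mulr0 ?addr0 ?add0r.
rewrite -E => /is_derive_line.
by under eq_fun do rewrite E.
Qed.

(** The partial derivatives are bounded near z, and two axis-parallel segments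
    join z to a nearby point. *)
Lemma C1_on_continuous (U : set (plane R)) (h : plane R -> R) z :
  open U -> C1_on U h -> U z -> {for z, continuous h}.
Proof.
move=> oU Ch Uz.
have [_ c1] := Ch z (1, 0) Uz (or_introl erefl).
have [_ c2] := Ch z (0, 1) Uz (or_intror erefl).
pose M := Num.max `|'D_(1, 0) h z| `|'D_(0, 1) h z| + 1.
have n1 : \forall p \near z, `|'D_(1, 0) h p| <= M.
  by apply: cvgr_norm_le c1 _ _; rewrite ltr_pwDr// le_max lexx.
have n2 : \forall p \near z, `|'D_(0, 1) h p| <= M.
  by apply: cvgr_norm_le c2 _ _; rewrite ltr_pwDr// le_max lexx orbT.
have nU := open_nbhs_nbhs (conj oU Uz).
have [[A B] /= [nA nB] AB] := filterI nU (filterI n1 n2).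
have /nbhs_ballP[e1 /= e10 be1] := nA.
have /nbhs_ballP[e2 /= e20 be2] := nB.
have M0 : 0 < M by rewrite ltr_pwDr// le_max normr_ge0.
have line (a b a0 b0 e r : R) : ball a0 e a -> ball a0 e b ->
    Num.min a b <= r <= Num.max a b -> ball a0 e r.
  rewrite /ball/= !ltr_norml => /andP[? ?] /andP[? ?] /andP[].
  by rewrite ge_min le_max => /orP[] ? /orP[] ?; apply/andP; split; lra.
have Lip p : ball z.1 e1 p.1 -> ball z.2 e2 p.2 ->
    `|h p - h z| <= M * (`|p.1 - z.1| + `|p.2 - z.2|).
  move=> b1 b2.
  have -> : h p - h z = (h (p.1, p.2) - h (z.1, p.2)) + (h (z.1, p.2) - h (z.1, z.2)).
    by rewrite addrA subrK -!surjective_pairing.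
  rewrite (le_trans (ler_normD _ _))// mulrDr lerD//.
  - apply: (@lipschitz_of_derive (fun t => h (t, p.2))) => r rb.
    have br : ball z.1 e1 r by apply: line rb => //; exact: ballxx.
    have [/= Ur [H1 _]] := AB (r, p.2) (conj (be1 _ br) (be2 _ b2)).
    have [/derivableP dh _] := Ch _ (1, 0) Ur (or_introl erefl).
    by have [d1 ->] := is_derive_hline dh.
  - apply: (@lipschitz_of_derive (fun t => h (z.1, t))) => r rb.
    have br : ball z.2 e2 r by apply: line rb => //; exact: ballxx.
    have [/= Ur [_ H2]] := AB (z.1, r) (conj (be1 _ (ballxx _ e10)) (be2 _ br)).
    have [/derivableP dh _] := Ch _ (0, 1) Ur (or_intror erefl).
    by have [d1 ->] := is_derive_vline dh.
apply/cvgrPdist_le => /= e e0.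
pose d := e / M / 2.
have d0 : 0 < d by rewrite !divr_gt0.
have : nbhs z ((ball z.1 e1 `&` ball z.1 d) `*` (ball z.2 e2 `&` ball z.2 d)).
  exists (ball z.1 e1 `&` ball z.1 d, ball z.2 e2 `&` ball z.2 d) => //=.
  by split; apply: filterI; exact: nbhsx_ballx.
apply: filterS => p [/= [b1 d1] [b2 d2]]; rewrite distrC (le_trans (Lip _ b1 b2))//.
rewrite mulrC -ler_pdivlMr//; move: d1 d2; rewrite /ball/= distrC (distrC z.2).
have -> : e / M = d + d by rewrite /d; field; rewrite gt_eqF.
by move=> /ltW ? /ltW ?; exact: lerD.
Qed.

End Continuity.

(** * Green's identity on pseudohyperbolic disks *)

Section Green.
Variable R : realType.
Implicit Types (x v : plane R).
Variable z : plane R.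
Hypothesis z1 : sqmod z < 1.

Local Notation lam := (@lebesgue_measure R).
Local Notation lam2 := (lam \x lam)%E.

(** With t = |phi_z(x)|^2 this is (c - t)^+. *)
Definition cutoff (c : R) x : R := ppart (defect z x - (1 - c)).

Lemma cutoff_ge0 c x : 0 <= cutoff c x.
Proof. exact: ppart_ge0. Qed.

Lemma cutoff_outside c : c < 1 ->
  exists2 rho, rho < 1 & forall x, rho < sqmod x -> cutoff c x = 0.
Proof.
(* from [moebius_den_lb]: there defect <= 4 (1 - sqmod x) / (1 - sqmod z) *)
move=> c1; exists (1 - (1 - c) * (1 - sqmod z) / 4).
  by rewrite ltrBlDr ltrDl divr_gt0// mulr_gt0 ?subr_gt0.
move=> x xr; rewrite /cutoff /ppart max_r// subr_le0.
have [x1|x1] := leP 1 (sqmod x).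
  by rewrite (le_trans (defect_le0 z1 x1))// subr_ge0 ltW.
have c0 : 0 <= 1 - c by lra.
have z0 : 0 <= 1 - sqmod z by rewrite subr_ge0 ltW.
rewrite /defect ler_pdivrMr ?moebius_den_gt0//.
apply: (@le_trans _ _ ((1 - c) * ((1 - sqmod z) ^+ 2 / 4))); last first.
  by rewrite ler_wpM2l// moebius_den_lb.
have -> : (1 - c) * ((1 - sqmod z) ^+ 2 / 4) =
  (1 - sqmod z) * ((1 - c) * (1 - sqmod z) / 4) by ring.
by rewrite ler_wpM2l//; lra.
Qed.

Lemma cutoff_eq0 c x : c < 1 -> 1 <= sqmod x -> cutoff c x = 0.
Proof.
by move=> c1 x1; have [rho r1 ->//] := cutoff_outside c1; exact: lt_le_trans x1.
Qed.

Lemma continuous_ppart (t : R) : {for t, continuous (@ppart R)}.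
Proof.
have -> : @ppart R = (fun t => (t + `|t|) / 2).
  apply/funext => s; rewrite /ppart; have [s0|s0] := leP s 0.
    by rewrite ler0_norm// subrr mul0r.
  by rewrite gtr0_norm//; field.
by apply: cvgM; [apply: cvgD; [exact: cvg_id|exact: norm_continuous]|exact: cvg_cst].
Qed.

Lemma den_neq0 x : sqmod x < 1 -> moebius_den z x != 0.
Proof. by move=> ?; rewrite gt_eqF ?moebius_den_gt0. Qed.

Lemma continuous_cutoff c x : sqmod x < 1 -> {for x, continuous (cutoff c)}.
Proof.
move=> x1; apply: (@continuous_comp _ _ _ (fun x => defect z x - (1 - c)) (@ppart R)).
  by apply: continuous_add_at; [exact/continuous_defect/den_neq0|exact: cvg_cst].
exact: continuous_ppart.
Qed.

Lemma near_cutoff_eq0 c x : c < 1 -> 1 <= sqmod x -> \forall y \near x, cutoff c y = 0.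
Proof.
move=> c1 x1; have [rho r1 H] := cutoff_outside c1.
have /= := open_nbhs_nbhs (conj (@open_sqmod_gt R rho) (lt_le_trans r1 x1)).
exact: filterS.
Qed.

(** The cutoff vanishes near the unit circle, so that only the behavior of F
    inside the disk matters. *)
Lemma continuous_cutoff_mul (F : plane R -> R) n c :
  c < 1 -> (forall x, sqmod x < 1 -> {for x, continuous F}) ->
  forall x, {for x, continuous (fun p => F p * cutoff c p ^+ n.+1)}.
Proof.
move=> c1 cF x; have [x1|x1] := leP 1 (sqmod x).
  have H : \forall y \near x, F y * cutoff c y ^+ n.+1 = 0.
    by apply: filterS (near_cutoff_eq0 c1 x1) => y ->; rewrite expr0n mulr0.
  rewrite /prop_for /continuous_at (nbhs_singleton H).
  exact: cvg_near_cst.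
apply: continuous_mul_at; first exact: cF.
exact/continuous_exp_at/continuous_cutoff.
Qed.

Lemma integrable_cutoff_mul (F : plane R -> R) n c :
  c < 1 -> (forall x, sqmod x < 1 -> {for x, continuous F}) ->
  lam2.-integrable setT (fun p => (F p * cutoff c p ^+ n.+1)%:E).
Proof.
move=> c1 cF; apply: continuous_integrable_disk.
  exact: continuous_cutoff_mul.
by move=> x /(cutoff_eq0 c1) ->; rewrite expr0n mulr0.
Qed.

Variable h : plane R -> R.
Hypothesis hh : real_harmonic_on (@disk R) h.

Lemma harmonic_continuous x : sqmod x < 1 -> {for x, continuous h}.
Proof.
move=> /diskE x1; have [[c1 _ _] _] := hh.
exact: C1_on_continuous (@open_disk R) c1 x1.
Qed.

Definition axis v := v = (1, 0) \/ v = (0, 1).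

Lemma harmonic_D v x : axis v -> sqmod x < 1 ->
  [/\ is_derive x v h ('D_v h x),
      is_derive x v ('D_v h) ('D_v ('D_v h) x),
      {for x, continuous ('D_v h)} & {for x, continuous ('D_v ('D_v h))}].
Proof.
move=> av /diskE x1; have [[c0 c1 c2] _] := hh.
have [d0 k0] := c0 x v x1 av.
have [d1 k1] : derivable ('D_v h) x v /\ {for x, continuous ('D_v ('D_v h))}.
  by case: (av) => e; rewrite e; [apply: c1|apply: c2] => //; [left|right].
by split => //; exact: derivableP.
Qed.

(** Component along v of h grad(b^3) - b^3 grad h, where b is the cutoff.  The cube
    makes b^3 twice differentiable across the boundary of its support. *)
Definition flux c v x : R :=
  h x * (3 * cutoff c x ^+ 2 * defect1 z v x) - cutoff c x ^+ 3 * 'D_v h x.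

Definition flux_derive c v x : R :=
  (h x * (6 * defect1 z v x ^+ 2 + 3 * cutoff c x * defect2 z v x)
   - cutoff c x ^+ 2 * 'D_v ('D_v h) x) * cutoff c x ^+ 1.

Lemma is_derive_cutoffX n c v x : sqmod x < 1 ->
  is_derive x v (fun p => cutoff c p ^+ n.+2)
    (n.+2%:R * cutoff c x ^+ n.+1 * defect1 z v x).
Proof.
move=> x1.
apply: (@is_derive_chain R (fun t => ppart t ^+ n.+2) (fun p => defect z p - (1 - c)) x v).
  exact: is_derive_ppart_exp.
rewrite -[X in is_derive _ _ _ X]addr0; apply: is_derive_add.
  exact/is_derive_defect/den_neq0.
Qed.

Lemma is_derive_flux c v x : c < 1 -> axis v ->
  is_derive x v (flux c v) (flux_derive c v x).
Proof.
move=> c1 av; have [x1|x1] := leP 1 (sqmod x).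
  apply: (@near_eq_is_derive R (plane R) R (cst 0)).
    apply: filterS (near_cutoff_eq0 c1 x1) => y b0.
    by rewrite /flux b0 !expr0n/= !mulr0 !mul0r mulr0 subrr.
  rewrite /flux_derive cutoff_eq0// expr1 mulr0; exact: is_derive_cst.
have [dh dDh _ _] := harmonic_D av x1.
have d1 := is_derive_defect1 v (den_neq0 x1).
have d2 := is_derive_cutoffX 0 c v x1.
have d3 := is_derive_cutoffX 1 c v x1.
have D := is_derive_add
  (is_derive_mul dh (is_derive_mul (is_derive_mul (is_derive_const 3 x v) d2) d1))
  (is_derive_opp (is_derive_mul d3 dDh)).
apply: (is_derive_eq D).
by rewrite /flux_derive /=; ring.
Qed.

Lemma continuous_flux_derive c v x : c < 1 -> axis v ->
  {for x, continuous (flux_derive c v)}.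
Proof.
move=> c1 av; apply: continuous_cutoff_mul => // {}x x1.
have [_ _ _ c4] := harmonic_D av x1.
have c5 := @continuous_cutoff c _ x1.
have c6 := harmonic_continuous x1.
have c7 := continuous_defect1 (v := v) (den_neq0 x1).
have c8 := continuous_defect2 (v := v) (den_neq0 x1).
apply: continuous_add_at.
  apply: continuous_mul_at => //; apply: continuous_add_at.
    by apply: continuous_mul_at; [exact: cvg_cst|exact: continuous_exp_at].
  apply: continuous_mul_at => //.
  by apply: continuous_mul_at; [exact: cvg_cst|].
apply: continuous_opp_at; apply: continuous_mul_at => //.
exact: continuous_exp_at.
Qed.

Lemma integral_flux_derive c v : c < 1 -> axis v ->
  (\int[lam2]_x (flux_derive c v x)%:E = 0)%E.
Proof.
move=> c1 av; apply: (integral_directional_derive av (q := flux c v)).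
- by move=> x; exact: is_derive_flux.
- by move=> x; exact: continuous_flux_derive.
- by move=> x x1; rewrite /flux /flux_derive cutoff_eq0// !expr0n/= !mulr0 !mul0r
    mulr0 subrr.
Qed.

Definition moment n c : R := \int[lam2]_x (h x * moebius_jac z x * cutoff c x ^+ n).

Lemma continuous_harmonic_jac x : sqmod x < 1 ->
  {for x, continuous (fun p => h p * moebius_jac z p)}.
Proof.
move=> x1; apply: continuous_mul_at; first exact: harmonic_continuous.
exact/continuous_moebius_jac/den_neq0.
Qed.

(** The divergence is h times the Laplacian of b^3.  On the support of b one has
    1 - defect = c - b, so that |grad b|^2 = 4 (c - b) J and the Laplacian of b is
    - 4 J, where J is the Jacobian. *)
Lemma flux_deriveE c x : c < 1 ->
  flux_derive c (1, 0) x + flux_derive c (0, 1) x =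
  24 * c * (h x * moebius_jac z x * cutoff c x ^+ 1)
  - 36 * (h x * moebius_jac z x * cutoff c x ^+ 2).
Proof.
move=> c1; have [x1|x1] := leP 1 (sqmod x).
  have b0 := cutoff_eq0 c1 x1.
  rewrite /flux_derive b0 !expr1.
  set A := (X in X * 0 + _); set B := (X in _ + X * 0).
  by move: A B (h x * moebius_jac z x) => A B C; ring.
have [_ /(_ x) lap] := hh.
have {}lap := lap ((diskE x).2 x1).
have g := defect_gradient (den_neq0 x1).
have l := defect_laplacian (den_neq0 x1).
(* this also holds off the support, where the cutoff vanishes *)
have bb : cutoff c x * cutoff c x = cutoff c x * (defect z x - (1 - c)).
  rewrite /cutoff /ppart; case: (leP (defect z x - (1 - c)) 0) => // _.
  by rewrite !mul0r.
rewrite /flux_derive.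
set b := cutoff c x in bb *; set J := moebius_jac z x in g l *.
set D1 := 'D_(1, 0) ('D_(1, 0) h) x in lap *.
set D2 := 'D_(0, 1) ('D_(0, 1) h) x in lap *.
transitivity ((h x * (6 * (defect1 z (1, 0) x ^+ 2 + defect1 z (0, 1) x ^+ 2)
  + 3 * b * (defect2 z (1, 0) x + defect2 z (0, 1) x))
  - b ^+ 2 * (D1 + D2)) * b); first by ring.
rewrite g l lap.
transitivity (h x * J * (24 * (b - b * defect z x) - 12 * (b * b))); first by ring.
have -> : b * defect z x = b * b + b * (1 - c) by rewrite bb; ring.
by ring.
Qed.

(** Green's identity: a compactly supported divergence has integral 0. *)
Lemma moment_relation c : c < 1 -> 2 * c * moment 1 c = 3 * moment 2 c.
Proof.
move=> c1.
have I n := integrable_cutoff_mul n c1 continuous_harmonic_jac.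
have E : \int[lam2]_x (24 * c * (h x * moebius_jac z x * cutoff c x ^+ 1)
  - 36 * (h x * moebius_jac z x * cutoff c x ^+ 2)) = 0.
  rewrite /Rintegral; under eq_integral do rewrite -flux_deriveE// EFinD.
  have F v : axis v -> lam2.-integrable setT (EFin \o flux_derive c v).
    move=> av; apply: continuous_integrable_disk.
      by move=> x; exact: continuous_flux_derive.
    by move=> x x1; rewrite /flux_derive cutoff_eq0// expr0n mulr0.
  have a1 : axis (1, 0) by left.
  have a2 : axis (0, 1) by right.
  have E := f_equal2 (@GRing.add (\bar R)) (integral_flux_derive c1 a1)
    (integral_flux_derive c1 a2).
  rewrite -[RHS]/(fine (0 : \bar R)) -[in RHS](adde0 0%E); congr fine.
  exact: eq_trans (integralD measurableT (F _ a1) (F _ a2)) E.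
move: E; rewrite RintegralB//; last 2 first.
- exact: (integrableZl measurableT (24 * c) (I 0%N)).
- exact: (integrableZl measurableT 36 (I 1%N)).
rewrite !RintegralZl//; [|exact: I|exact: I].
by rewrite -/(moment 1 c) -/(moment 2 c); lra.
Qed.

End Green.

(** * Moments of a harmonic function *)

Section HarmonicMoments.
Variable R : realType.
Implicit Types (x v : plane R).
Variable z : plane R.
Hypothesis z1 : sqmod z < 1.

Local Notation lam := (@lebesgue_measure R).
Local Notation lam2 := (lam \x lam)%E.
Local Notation cutoff := (cutoff z).
Local Notation J := (moebius_jac z).

Lemma ppart_taylor2 (t e : R) :
  0 <= ppart (t + e) ^+ 2 - ppart t ^+ 2 - 2 * e * ppart t <= e ^+ 2.
Proof.
rewrite /ppart; have := sqr_ge0 t; have := sqr_ge0 e; have := sqr_ge0 (t + e).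
by case: (leP (t + e) 0) => te; case: (leP t 0) => t0 *; apply/andP; split; nra.
Qed.

(** The Taylor remainder in c is bounded by a multiple of one fixed cutoff, which
    is positive wherever the remainder is nonzero. *)
Lemma cutoff_taylor2 (c c' c1 c2 : R) x : c <= c1 -> c' <= c1 -> c1 < c2 ->
  `|cutoff c' x ^+ 2 - cutoff c x ^+ 2 - 2 * (c' - c) * cutoff c x| <=
  (c' - c) ^+ 2 / (c2 - c1) * cutoff c2 x.
Proof.
move=> cc1 cc1' c12.
set t := defect z x - (1 - c).
have e1 : cutoff c' x = ppart (t + (c' - c)).
  by rewrite /cutoff /t; congr ppart; ring.
have e2 : cutoff c x = ppart t by [].
have [H|H] := leP (defect z x) (1 - c1).
  rewrite {1}e1 e2 /ppart !max_r; [|rewrite /t; lra|rewrite /t; lra].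
  rewrite expr0n mulr0 !subrr normr0 mulr_ge0 ?ppart_ge0// divr_ge0 ?sqr_ge0//.
  by rewrite subr_ge0 ltW.
have h2 : 1 <= cutoff c2 x / (c2 - c1).
  rewrite ler_pdivlMr ?subr_gt0// mul1r /cutoff /ppart le_max.
  by apply/orP; left; lra.
have /andP[l0 l1] := ppart_taylor2 t (c' - c).
rewrite e1 e2 ger0_norm// (le_trans l1)// -mulrA (mulrC _^-1).
by rewrite ler_peMr// sqr_ge0.
Qed.

Section OneHarmonicFunction.
Variable h : plane R -> R.
Hypothesis hh : real_harmonic_on (@disk R) h.
Local Notation M := (moment z h).

Lemma integrable_moment n c : c < 1 ->
  lam2.-integrable setT (fun p => (h p * J p * cutoff c p ^+ n.+1)%:E).
Proof.
move=> c1; apply: integrable_cutoff_mul => //.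
exact: continuous_harmonic_jac.
Qed.

Lemma moment_increment c c' c1 c2 : c <= c1 -> c' <= c1 -> c1 < c2 -> c2 < 1 ->
  `|M 2 c' - M 2 c - 2 * (c' - c) * M 1 c| <=
  (c' - c) ^+ 2 * ((c2 - c1)^-1 * \int[lam2]_x (`|h x * J x| * cutoff c2 x)).
Proof.
move=> cc1 cc1' c12 c21.
have c1' : c' < 1 by exact: le_lt_trans cc1' (lt_trans c12 c21).
have c1l : c < 1 by exact: le_lt_trans cc1 (lt_trans c12 c21).
have I0 := integrable_moment 0 c1l.
have I1 := integrable_moment 1 c1l.
have I2 := integrable_moment 1 c1'.
have I3 : lam2.-integrable setT (fun p => (`|h p * J p| * cutoff c2 p ^+ 1)%:E).
  apply: integrable_cutoff_mul => // x x1.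
  exact: (cvg_norm (@continuous_harmonic_jac R z z1 h hh x x1)).
have I4 := integrableZl measurableT (2 * (c' - c)) I0.
have I5 := integrableB measurableT I2 I1.
rewrite /moment -RintegralZl//.
rewrite -RintegralB// -RintegralB//.
apply: (le_trans (le_normr_Rintegral measurableT (integrableB measurableT I5 I4))).
rewrite mulrA -RintegralZl//.
apply: le_Rintegral => //.
- exact: integrable_norm (integrableB measurableT I5 I4).
- exact: (integrableZl measurableT _ I3).
move=> x _.
have -> : h x * J x * cutoff c' x ^+ 2 - h x * J x * cutoff c x ^+ 2 -
   2 * (c' - c) * (h x * J x * cutoff c x ^+ 1) =
  (h x * J x) * (cutoff c' x ^+ 2 - cutoff c x ^+ 2 - 2 * (c' - c) * cutoff c x).
  by rewrite expr1; ring.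
rewrite normrM [leRHS]mulrCA ler_wpM2l//.
exact: cutoff_taylor2.
Qed.

(** The derivative of (c - t)^+ ^ 2 in c is 2 (c - t)^+; the remainder is
    integrable by comparison with a larger cutoff. *)
Lemma is_derive_moment (c : R) : c < 1 -> is_derive c 1 (M 2) (2 * M 1 c).
Proof.
move=> c1.
(* any two numbers with c < c3 < c2 < 1 *)
pose c3 := (2 * c + 1) / 3; pose c2 := (c + 2) / 3.
have c13 : c < c3 by rewrite /c3; lra.
have c32 : c3 < c2 by rewrite /c3 /c2; lra.
have c21 : c2 < 1 by rewrite /c2; lra.
set K := (c2 - c3)^-1 * \int[lam2]_x (`|h x * J x| * cutoff c2 x).
have K0 : 0 <= K.
  rewrite mulr_ge0 ?invr_ge0 ?subr_ge0 ?(ltW c32)// Rintegral_ge0// => x _.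
  by rewrite mulr_ge0 ?ppart_ge0.
have H : (fun e : R => e^-1 *: ((M 2 \o shift c) (e *: 1) - M 2 c)) @ 0^'
    --> 2 * M 1 c.
  apply/cvgrPdist_le => /= e e0.
  near=> k.
  have k0 : k != 0 by near: k; exact: nbhs_dnbhs_neq.
  have kc : `|k| <= c3 - c by near: k; apply: dnbhs0_le; rewrite subr_gt0.
  have kK : `|k| <= e / (K + 1).
    by near: k; apply: dnbhs0_le; rewrite divr_gt0// ltr_pwDr.
  rewrite [_%:A]mulr1.
  have kc3 : k + c <= c3 by move: kc; rewrite ler_norml; lra.
  have := @moment_increment c (k + c) c3 c2 (ltW c13) kc3 c32 c21.
  rewrite addrK -/K => Hk.
  rewrite distrC -[X in `|_ - X|](mulKf k0) -[_ *: _]/(_ * _) -mulrBr normrM normfV.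
  rewrite ler_pdivrMl ?normr_gt0//.
  apply: (@le_trans _ _ (k ^+ 2 * K)); first by rewrite mulrA (mulrC k).
  rewrite -[k ^+ 2]real_normK ?num_real// expr2 -mulrA ler_wpM2l//.
  apply: le_trans (_ : `|k| * (K + 1) <= _).
    by rewrite ler_wpM2l// lerDl.
  by rewrite -ler_pdivlMr// ltr_pwDr.
split; first by apply/cvg_ex; exists (2 * M 1 c).
exact: cvg_lim H.
Unshelve. all: by end_near. Qed.

(** By [moment_relation], c M'(c) = 3 M(c) for the second moment M. *)
Lemma moment_cube (a b : R) : 0 < a -> a <= b -> b < 1 ->
  M 2 a / a ^+ 3 = M 2 b / b ^+ 3.
Proof.
move=> a0 ab b1.
pose q := fun t : R => M 2 t * (t ^+ 3)^-1.
have dq (t : R) : 0 < t -> t < 1 -> is_derive t 1 q 0.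
  move=> t0 t1; have t30 : t ^+ 3 != 0 by rewrite expf_neq0// gt_eqF.
  have D3 : is_derive t (1:R) (fun s : R => s ^+ 3) (3 * t ^+ 2).
    rewrite (_ : (fun s : R => s ^+ 3) = id ^+ 3); last first.
      by apply/funext => s; rewrite fctE.
    by apply: is_derive_eq; rewrite /GRing.scale/= mulr1.
  have D := is_deriveM (is_derive_moment t1) (@is_deriveV R (fun s => s ^+ 3) t _ 1 t30 D3).
  apply: (is_derive_eq D); rewrite /GRing.scale/=.
  have := moment_relation z1 hh t1 => E.
  have -> : M 2 t = 2 * t * M 1 t / 3 by rewrite E; field.
  by field; rewrite gt_eqF.
have [t||t /[!in_itv]/= /andP[ta tb]] := @MVT_segment R q (fun=> 0) a b ab.
- rewrite in_itv/= => /andP[ta tb]; apply: dq; first exact: lt_trans ta.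
  exact: lt_trans b1.
- apply: continuous_in_subspaceT => t; rewrite inE/= in_itv/= => /andP[ta tb].
  apply/differentiable_continuous/derivable1_diffP.
  by have [] := dq t (lt_le_trans a0 ta) (le_lt_trans tb b1).
by rewrite mul0r => /eqP; rewrite subr_eq0 => /eqP.
Qed.

(** The factor of c^3 in the second moment, read off at c = 1/2. *)
Definition moment_const : R := 8 * M 2 (1 / 2).

Lemma moment2E c : 0 < c -> c < 1 -> M 2 c = moment_const * c ^+ 3.
Proof.
move=> c0 c1; have c3 : c ^+ 3 != 0 by rewrite expf_neq0// gt_eqF.
apply: (canRL (divfK c3)).
transitivity (M 2 (1 / 2) / (1 / 2) ^+ 3); last by rewrite /moment_const; field.
have [h1|h1] := leP c (1 / 2); first by apply: moment_cube => //; lra.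
by apply/esym; apply: moment_cube => //; lra.
Qed.

Lemma moment1E c : 0 < c -> c < 1 -> M 1 c = 3 / 2 * moment_const * c ^+ 2.
Proof.
move=> c0 c1; have := moment_relation z1 hh c1; rewrite moment2E// => E.
apply: (@mulfI _ (2 * c)); first by rewrite mulf_neq0// gt_eqF.
by rewrite E; field.
Qed.

End OneHarmonicFunction.
End HarmonicMoments.

(** * The mean value property for moments *)

Section MeanValue.
Variable R : realType.
Implicit Types (x v : plane R).

Local Notation lam := (@lebesgue_measure R).
Local Notation lam2 := (lam \x lam)%E.

Lemma harmonic_cst (k : R) : real_harmonic_on (@disk R) (fun=> k).
Proof.
have D0 v : 'D_v (fun=> k : R) = (fun=> 0) :> (plane R -> R).
  by apply/funext => x; exact: derive_cst.
have D00 v : 'D_v (fun=> 0 : R) = (fun=> 0) :> (plane R -> R).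
  by apply/funext => x; exact: derive_cst.
have C1 (a : R) : ('D_(1,0) (fun=> a : R) = (fun=> 0) :> (plane R -> R)) ->
   ('D_(0,1) (fun=> a : R) = (fun=> 0) :> (plane R -> R)) ->
   C1_on (@disk R) (fun=> a).
  move=> E1 E2 x e _ [|] ->; (split; first exact: derivable_cst).
    by rewrite E1; exact: cvg_cst.
  by rewrite E2; exact: cvg_cst.
split; first by split; rewrite ?D0; exact: C1.
by move=> x _; rewrite !D0 !(derive_cst 0) addr0.
Qed.

Variable z : plane R.
Hypothesis z1 : sqmod z < 1.
Local Notation cutoff := (cutoff z).
Local Notation J := (moebius_jac z).

(** The pseudohyperbolic disk |phi_z(x)|^2 < c. *)
Definition pball (c : R) : set (plane R) := [set x | 1 - c < defect z x].

Lemma pball_disk c x : c <= 1 -> pball c x -> sqmod x < 1.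
Proof.
move=> c1; rewrite /pball/= => h; rewrite ltNge; apply/negP => /(defect_le0 z1).
lra.
Qed.

Lemma pball_sub c c' : c <= c' -> pball c `<=` pball c'.
Proof. by move=> cc x; rewrite /pball/=; lra. Qed.

Lemma cutoff_notin c x : ~ pball c x -> cutoff c x = 0.
Proof.
by rewrite /pball/= => /negP; rewrite -leNgt => h; rewrite /cutoff /ppart max_r//; lra.
Qed.

Lemma open_pball c : c <= 1 -> open (pball c).
Proof.
move=> c1; rewrite openE => x h; have x1 := pball_disk c1 h.
have := continuous_defect (den_neq0 z1 x1) => /(_ _ (lt_nbhsr h)).
by [].
Qed.

Lemma measurable_pball c : c <= 1 -> measurable (pball c).
Proof. by move=> c1; exact: open_plane_measurable (open_pball c1). Qed.

Lemma defect_center : defect z z = 1.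
Proof.
apply/eqP; rewrite eq_sym -subr_eq0 defectE// !subrr expr0n/= addr0 mul0r eqxx//.
Qed.

Lemma pball_small c x : c <= 1 -> pball c x ->
  (x.1 - z.1) ^+ 2 + (x.2 - z.2) ^+ 2 <= 4 * c.
Proof.
move=> c1 h; have x1 := pball_disk c1 h.
have := defectE z1 x1; have d0 := moebius_den_gt0 z1 x1.
have d4 := moebius_den_le z1 x1.
move/esym/(canRL (divfK (lt0r_neq0 d0))) => ->.
have w0 : 1 - defect z x <= c by move: h; rewrite /pball/=; lra.
have w1 : 0 <= 1 - defect z x by rewrite subr_ge0 defect_le1.
by rewrite mulrC ler_pM// ltW.
Qed.

Lemma moebius_jac_gt0 x : sqmod x < 1 -> 0 < J x.
Proof.
by move=> x1; rewrite divr_gt0// exprn_gt0// ?subr_gt0// moebius_den_gt0.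
Qed.

Lemma moebius_jac_ge0 x : 0 <= J x.
Proof. by rewrite divr_ge0// ?sqr_ge0//; exact: sqr_ge0. Qed.

Lemma pball_nbhs (P : plane R -> Prop) : (\forall x \near z, P x) ->
  exists2 c, 0 < c < 1 & forall x, pball c x -> P x.
Proof.
move=> [[A B] /= [nA nB] AB].
have /nbhs_ballP[e1 /= e10 be1] := nA.
have /nbhs_ballP[e2 /= e20 be2] := nB.
pose e := Num.min (Num.min e1 e2) 1.
have e0 : 0 < e by rewrite !lt_min e10 e20/=.
have e11 : e <= e1 by rewrite /e !ge_min lexx.
have e12 : e <= e2 by rewrite /e !ge_min lexx orbT.
have e1' : e <= 1 by rewrite /e !ge_min lexx orbT.
have ee : e ^+ 2 <= 1 by rewrite exprn_ile1// ltW.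
have ee0 : 0 < e ^+ 2 by rewrite exprn_gt0.
exists (e ^+ 2 / 8); first by apply/andP; split; lra.
move=> x /pball_small => /(_ ltac:(lra)) H.
have sq (a : R) : a ^+ 2 < e ^+ 2 -> `|a| < e.
  by move=> ae; rewrite -ltr_sqr ?nnegrE ?(ltW e0)// real_normK// num_real.
have s1 := sqr_ge0 (x.1 - z.1); have s2 := sqr_ge0 (x.2 - z.2).
apply: AB; split => /=.
  by apply: be1; rewrite /ball/= distrC (lt_le_trans (sq _ _) e11)//; lra.
by apply: be2; rewrite /ball/= distrC (lt_le_trans (sq _ _) e12)//; lra.
Qed.

Local Notation kappa := (moment_const z).

(** As c tends to 0 the moments concentrate at z, where h is close to h z, and
    the ratio between the moments of h and of 1 does not depend on c. *)
Lemma moment_const_mean h : real_harmonic_on (@disk R) h ->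
  kappa h = h z * kappa (fun=> 1).
Proof.
move=> hh; have h1 := harmonic_cst 1.
apply/eqP; rewrite -subr_eq0 -normr_le0; apply/ler_addgt0Pl => e e0; rewrite addr0.
pose K := kappa (fun=> 1).
have K0 : 0 <= K.
  rewrite /K /moment_const mulr_ge0// Rintegral_ge0// => x _.
  by rewrite mul1r mulr_ge0 ?moebius_jac_ge0 ?sqr_ge0//; exact: sqr_ge0.
have d0 : 0 < e / (K + 1) by rewrite divr_gt0// ltr_pwDr.
have ch := harmonic_continuous hh z1.
have /cvgrPdist_le/(_ _ d0) nh := ch.
have [c /andP[c0 c1] Hc] := pball_nbhs nh.
have c3 : 0 < c ^+ 3 by rewrite exprn_gt0.
suff : `|moment z h 2 c - h z * moment z (fun=> 1) 2 c| <= e / (K + 1) * moment z (fun=> 1) 2 c.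
  rewrite !moment2E// (mulrA (h z)) -mulrBl normrM (gtr0_norm c3).
  rewrite [leRHS]mulrA ler_pM2r//.
  move=> /le_trans; apply; rewrite -/K -mulrA ler_piMr ?(ltW e0)//.
  by rewrite ler_pdivrMl ?ltr_pwDr// mulr1 lerDl.
have Ih := integrable_moment z1 hh 1 c1.
have I1 := integrable_moment z1 h1 1 c1.
have Iz := integrableZl measurableT (h z) I1.
rewrite /moment -!RintegralZl//.
rewrite -RintegralB//.
apply: (le_trans (le_normr_Rintegral measurableT (integrableB measurableT Ih Iz))).
apply: le_Rintegral => //.
- exact: integrable_norm (integrableB measurableT Ih Iz).
- exact: (integrableZl measurableT _ I1).
move=> x _; rewrite mul1r.
have [px|px] := pselect (pball c x); last first.
  by rewrite cutoff_notin// !expr0n/= !mulr0 subrr normr0.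
have -> : h x * J x * cutoff c x ^+ 2 - h z * (J x * cutoff c x ^+ 2) =
  - (h z - h x) * (J x * cutoff c x ^+ 2) by ring.
have g0 : 0 <= J x * cutoff c x ^+ 2 by rewrite mulr_ge0 ?moebius_jac_ge0// sqr_ge0.
by rewrite normrM normrN (ger0_norm g0) ler_wpM2r// Hc.
Qed.

End MeanValue.

(** * Measures given by a density *)

Section Density.
Context d (T : measurableType d) (R : realType).
Variable mu : {measure set T -> \bar R}.
Variable f : T -> R.
Hypothesis f0 : forall x, 0 <= f x.
Hypothesis mf : measurable_fun setT f.

(** The two proofs are arguments so that a measure structure can be attached to
    the constant. *)
Definition density (_ : forall x, 0 <= f x) (_ : measurable_fun setT f)
  (A : set T) : \bar R := (\int[mu]_(x in A) (f x)%:E)%E.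

Local Notation m := (density f0 mf).

Let mfE D : measurable_fun D (fun x => (f x)%:E).
Proof. by apply/measurable_EFinP; exact: measurable_funS mf. Qed.

Let density0 : m set0 = 0%E. Proof. exact: integral_set0. Qed.
Let density_ge0 A : (0 <= m A)%E.
Proof. by apply: integral_ge0 => x _; rewrite lee_fin. Qed.
Let density_sigma : semi_sigma_additive m.
Proof.
move=> F mF tF mUF; rewrite /density ge0_integral_bigcup//.
- by apply: is_cvg_ereal_nneg_natsum_cond => n _ _; exact: density_ge0.
- by move=> x _; rewrite lee_fin.
Qed.

HB.instance Definition _ := isMeasure.Build _ _ _ m
  density0 density_ge0 density_sigma.

Import HBNNSimple.

Let integral_density_nnsfun (h : {nnsfun T >-> R}) :
  (\int[m]_x (h x)%:E = \int[mu]_x ((h x)%:E * (f x)%:E))%E.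
Proof.
under [LHS]eq_integral do rewrite fimfunE -fsumEFin//.
rewrite [LHS]ge0_integral_fsum//; last 2 first.
  - by move=> r; exact/measurable_EFinP/measurableT_comp.
  - by move=> n x _; rewrite EFinM nnfun_muleindic_ge0.
under [RHS]eq_integral.
  move=> x _; rewrite fimfunE -fsumEFin// ge0_mule_fsuml; last first.
    by move=> r; rewrite EFinM nnfun_muleindic_ge0.
  over.
rewrite [RHS]ge0_integral_fsum//; last 2 first.
  - by move=> r; apply: emeasurable_funM => //; apply/measurable_EFinP/measurableT_comp.
  - move=> n x _; apply: mule_ge0; last by rewrite lee_fin.
    by rewrite EFinM nnfun_muleindic_ge0.
apply: eq_fsbigr => r _.
rewrite integralZl_indic_nnsfun// integral_indic// setIT.
under eq_integral do rewrite EFinM -muleA.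
have [r0|r0] := ltP r 0.
  rewrite preimage_nnfun0// measure0 mule0 integral0_eq// => x _.
  by rewrite indic0 mul0e mule0.
rewrite ge0_integralZl//; last 2 first.
- by apply: emeasurable_funM => //; exact/measurable_EFinP.
- by move=> x _; rewrite mule_ge0// lee_fin.
congr (_ * _)%E.
transitivity (\int[mu]_(x in h @^-1` [set r]) (f x)%:E)%E => //.
rewrite [LHS]integral_mkcond; apply: eq_integral => x _.
by rewrite patchE indicE; case: ifPn; rewrite ?mul1e ?mul0e.
Qed.

Lemma integral_density (g : T -> \bar R) : (forall x, 0 <= g x)%E ->
  measurable_fun setT g -> (\int[m]_x g x = \int[mu]_x (g x * (f x)%:E))%E.
Proof.
move=> g0 mg.
pose g_ := nnsfun_approx measurableT mg.
have cvg_g x : (g_ n x)%:E @[n --> \oo] --> g x by exact: cvg_nnsfun_approx.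
have nd_g x : {homo (fun n => (g_ n x)%:E) : p n / (p <= n)%N >-> (p <= n)%E}.
  by move=> p n mn; rewrite lee_fin; exact/lefP/nd_nnsfun_approx.
transitivity (limn (fun n => \int[m]_x (g_ n x)%:E))%E.
  rewrite -monotone_convergence//; last 2 first.
  - by move=> n; exact/measurable_EFinP.
  - by move=> n x _; rewrite lee_fin.
  by apply: eq_integral => x _; apply/esym/cvg_lim => //; exact: cvg_g.
transitivity (limn (fun n => \int[mu]_x ((g_ n x)%:E * (f x)%:E)))%E; last first.
  rewrite -monotone_convergence//; last 3 first.
  - by move=> n; apply: emeasurable_funM => //; exact/measurable_EFinP.
  - by move=> n x _; rewrite mule_ge0// lee_fin.
  - by move=> x _ p n pn; rewrite lee_wpmul2r ?lee_fin//; exact: nd_g.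
  by apply: eq_integral => x _; apply/cvg_lim => //; apply: cvgeMr => //; exact: cvg_g.
by congr (limn _); apply/funext => n; exact: integral_density_nnsfun.
Qed.

End Density.

(** * Masses of pseudohyperbolic disks *)

Section RadialMean.
Variable R : realType.
Implicit Types (x v : plane R).

Local Notation lam := (@lebesgue_measure R).
Local Notation lam2 := (lam \x lam)%E.
Variable z : plane R.
Hypothesis z1 : sqmod z < 1.
Local Notation cutoff := (cutoff z).
Local Notation J := (moebius_jac z).
Local Notation kappa := (moment_const z).

(** The integrand is nonnegative, and positive near z. *)
Lemma moment_const1_gt0 : 0 < kappa (fun=> 1).
Proof.
rewrite /moment_const mulr_gt0//.
have h12 : 1 / 2 < 1 :> R by lra.
pose F x : R := 1 * J x * cutoff (1 / 2) x ^+ 2.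
have F0 x : 0 <= F x.
  by rewrite /F mul1r mulr_ge0 ?moebius_jac_ge0 ?sqr_ge0//; exact: sqr_ge0.
have Fz : 0 < F z.
  rewrite /F mul1r mulr_gt0 ?moebius_jac_gt0// exprn_gt0//.
  by rewrite /cutoff /ppart defect_center// lt_max; apply/orP; left; lra.
have IF : lam2.-integrable setT (EFin \o F).
  exact: (integrable_moment z1 (harmonic_cst 1) 1 h12).
have cF : {for z, continuous F}.
  apply: (@continuous_cutoff_mul R z z1 (fun p => 1 * J p) 1 _ h12 _ z) => x x1.
  exact: (@continuous_harmonic_jac R z z1 (fun=> 1) (harmonic_cst 1) x x1).
have /cvgrPdist_le/(_ (F z / 2)) := cF.
rewrite divr_gt0// => /(_ isT) [[A B] /= [nA nB] AB].
have /nbhs_ballP[e1 /= e10 be1] := nA.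
have /nbhs_ballP[e2 /= e20 be2] := nB.
pose D : set (plane R) := ball z.1 e1 `*` ball z.2 e2.
have mA : measurable (ball z.1 e1 : set (measurableTypeR R)) by exact: measurable_ball.
have mB : measurable (ball z.2 e2 : set (measurableTypeR R)) by exact: measurable_ball.
have mD : measurable D by exact: measurableX.
have posD : (0 < lam2 D)%E.
  rewrite /D (product_measure1E _ _ mA mB).
  have := lebesgue_measure_ball z.1 (ltW e10).
  have := lebesgue_measure_ball z.2 (ltW e20).
  rewrite /= => -> ->; rewrite -EFinM lte_fin mulr_gt0// mulrn_wgt0//.
have : ((F z / 2)%:E * lam2 D <= \int[lam2]_x (F x)%:E)%E.
  rewrite -integral_cst//.
  apply: le_trans (_ : \int[lam2]_(x in D) (F x)%:E <= _)%E.
    apply: ge0_le_integral => //.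
    - by move=> x _; rewrite lee_fin divr_ge0// ltW.
    - by apply: measurable_funTS; have /measurable_int := IF.
    - move=> x [/= xA xB]; rewrite lee_fin.
      have := AB x (conj (be1 _ xA) (be2 _ xB)).
      by rewrite /= ler_norml => /andP[_]; lra.
  apply: ge0_subset_integral => //; first exact: measurable_int IF.
  by move=> x _; rewrite lee_fin.
rewrite /moment -/(F _) -lte_fin /Rintegral fineK; last exact: integrable_fin_num.
apply: lt_le_trans.
by rewrite mule_gt0// lte_fin divr_gt0.
Qed.

Section OneFunction.
Variable h : plane R -> R.
Hypothesis hh : real_harmonic_on (@disk R) h.

Lemma measurable_harmonic_jac c : c <= 1 ->
  measurable_fun (pball z c) (fun x => h x * J x).
Proof.
move=> c1; apply: continuous_plane_measurable; first exact: open_pball.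
by move=> x px; apply: continuous_harmonic_jac => //; exact: pball_disk px.
Qed.

Lemma ppart_increment (t e : R) : 0 < e ->
  0 <= ppart (t + e) - ppart t <= e.
Proof.
by move=> e0; rewrite /ppart; case: (leP (t + e) 0) => te; case: (leP t 0) => t0;
  apply/andP; split; lra.
Qed.

Lemma moment_differenceE c c' : c < 1 -> c' < 1 ->
  ((moment z h 1 c' - moment z h 1 c)%:E =
   \int[lam2]_x (h x * J x * (cutoff c' x - cutoff c x))%:E)%E.
Proof.
move=> c1 c1'.
have I := integrable_moment z1 hh 0 c1.
have I' := integrable_moment z1 hh 0 c1'.
rewrite /moment -RintegralB// /Rintegral fineK; last first.
  exact: (integrable_fin_num measurableT (integrableB measurableT I' I)).
by apply: eq_integral => x _; rewrite !expr1 -mulrBr.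
Qed.

Lemma integrable_moment_difference c c' : c < 1 -> c' < 1 ->
  lam2.-integrable setT
    (fun x => (h x * J x * (cutoff c' x - cutoff c x))%:E).
Proof.
move=> c1 c1'.
have I := integrable_moment z1 hh 0 c1.
have I' := integrable_moment z1 hh 0 c1'.
apply: eq_integrable (integrableB measurableT I' I) => // x _.
by rewrite !expr1 mulrBr.
Qed.

(** The difference quotients of the first moment (3/2) kappa c^2 in c sandwich
    the mass of the disk, which is therefore the derivative 3 kappa c. *)
Lemma integral_pball c c0 : 0 < c -> c < c0 -> c0 <= 1 ->
  (forall x, pball z c0 x -> 0 <= h x) ->
  (\int[lam2]_(x in pball z c) (h x * J x)%:E = (3 * kappa h * c)%:E)%E.
Proof.
move=> cp cc0 c01 h0.
have c1 : c <= 1 by exact: le_trans (ltW cc0) c01.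
have c1' : c < 1 by exact: lt_le_trans c01.
set X := (\int[lam2]_(x in pball z c) (h x * J x)%:E)%E.
have hJ0 x : pball z c0 x -> 0 <= h x * J x.
  by move=> px; rewrite mulr_ge0 ?h0// moebius_jac_ge0.
have hJ0' x : pball z c x -> 0 <= h x * J x.
  by move=> px; apply: hJ0; apply: pball_sub px; exact: ltW.
have XE : X = (\int[lam2]_x ((fun x => (h x * J x)%:E) \_ (pball z c)) x)%E.
  by rewrite /X integral_mkcond.
have p0 x : (0 <= ((fun x => (h x * J x)%:E) \_ (pball z c)) x)%E.
  by rewrite patchE; case: ifPn => //; rewrite inE => px; rewrite lee_fin hJ0'.
have mp : measurable_fun setT ((fun x => (h x * J x)%:E) \_ (pball z c)).
  apply/(measurable_restrictT _ (measurable_pball z1 c1)).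
  by apply/measurable_EFinP; exact: measurable_harmonic_jac.
(* the increment of the cutoff from c to c + e equals e on the disk of c *)
have up e : 0 < e -> c + e < c0 ->
    (X <= (3 * kappa h * c + 3 / 2 * kappa h * e)%:E)%E.
  move=> e0 ce.
  have ce1 : c + e < 1 by exact: lt_le_trans c01.
  have E : 3 * kappa h * c + 3 / 2 * kappa h * e =
      e^-1 * (moment z h 1 (c + e) - moment z h 1 c).
    by rewrite !moment1E// ?addr_gt0//; field; rewrite gt_eqF.
  rewrite E EFinM moment_differenceE//.
  rewrite -lee_pdivrMl ?invr_gt0// invrK XE.
  rewrite -ge0_integralZl//; last exact: ltW.
  apply: ge0_le_integral => //.
  - by move=> x _; rewrite mule_ge0// lee_fin ltW.
  - exact: measurable_funeM.
  - exact: measurable_int (integrable_moment_difference c1' ce1).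
  move=> x _; rewrite patchE; case: ifPn => [|/negP]; rewrite inE => px.
    rewrite -EFinM lee_fin mulrC ler_wpM2l ?hJ0'//.
    by move: px; rewrite /pball/= /cutoff /ppart => px; rewrite !max_l; lra.
  rewrite mule0 lee_fin (cutoff_notin px) subr0.
  have [px'|px'] := pselect (pball z (c + e) x); last first.
    by rewrite (cutoff_notin px') mulr0.
  rewrite mulr_ge0 ?cutoff_ge0// hJ0//.
  by apply: pball_sub px'; exact: ltW.
(* the increment from c - e to c is at most e and vanishes off the disk of c *)
have lo e : 0 < e -> e < c ->
    ((3 * kappa h * c - 3 / 2 * kappa h * e)%:E <= X)%E.
  move=> e0 ec.
  have ce1 : c - e < 1 by lra.
  have E : 3 * kappa h * c - 3 / 2 * kappa h * e =
      e^-1 * (moment z h 1 c - moment z h 1 (c - e)).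
    by rewrite !moment1E// ?subr_gt0//; field; rewrite gt_eqF.
  rewrite E EFinM moment_differenceE//.
  rewrite -lee_pdivlMl ?invr_gt0// invrK XE.
  rewrite -ge0_integralZl//; last exact: ltW.
  apply: ge0_le_integral => //.
  - move=> x _; rewrite lee_fin.
    have [px'|px'] := pselect (pball z c x); last first.
      rewrite (cutoff_notin px') cutoff_notin ?subrr ?mulr0//.
      by apply: contra_not px'; apply: pball_sub; lra.
    rewrite mulr_ge0 ?hJ0'//.
    have := @ppart_increment (defect z x - (1 - (c - e))) e e0.
    rewrite (_ : _ + e = defect z x - (1 - c)); last by ring.
    by rewrite /cutoff => /andP[].
  - exact: measurable_int (integrable_moment_difference ce1 c1').
  - exact: measurable_funeM.
  move=> x _; rewrite patchE; case: ifPn => [|/negP]; rewrite inE => px.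
    rewrite -EFinM lee_fin (mulrC e) ler_wpM2l ?hJ0'//.
    have := @ppart_increment (defect z x - (1 - (c - e))) e e0.
    rewrite (_ : _ + e = defect z x - (1 - c)); last by ring.
    by rewrite /cutoff => /andP[].
  rewrite mule0 lee_fin (cutoff_notin px) cutoff_notin ?subrr ?mulr0//.
  by apply: contra_not px; apply: pball_sub; lra.
pose d := Num.min c (c0 - c).
have d0 : 0 < d by rewrite lt_min cp subr_gt0.
have dc : d <= c by rewrite ge_min lexx.
have dc0 : d <= c0 - c by rewrite ge_min lexx orbT.
have [r Ex] : exists r : R, X = r%:E.
  have : X \is a fin_num.
    rewrite ge0_fin_numE; last by rewrite XE integral_ge0.
    by apply: (@le_lt_trans _ _ _ _ _ (up (d / 2) _ _)); rewrite ?ltry//; lra.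
  by move=> /fineK <-; exists (fine X).
rewrite Ex; congr EFin; apply/eqP; rewrite -subr_eq0 -normr_le0.
apply/ler_addgt0Pl => e e0; rewrite addr0.
pose k := 3 / 2 * `|kappa h| + 1.
have k0 : 0 < k by rewrite ltr_pwDr// mulr_ge0.
pose t := Num.min (d / 2) (e / k).
have t0 : 0 < t by rewrite lt_min !divr_gt0.
have td : t <= d / 2 by rewrite ge_min lexx.
have te : t <= e / k by rewrite ge_min lexx orbT.
have := up t t0; rewrite Ex lee_fin => /(_ ltac:(lra)) u1.
have := lo t t0; rewrite Ex lee_fin => /(_ ltac:(lra)) l1.
have kt : `|3 / 2 * kappa h * t| <= e.
  rewrite normrM (ger0_norm (ltW t0)) normrM [`|3 / 2|]ger0_norm//.
  apply: (@le_trans _ _ (k * t)); first by rewrite ler_wpM2r ?(ltW t0)// lerDl.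
  by rewrite mulrC -ler_pdivlMr.
by move: kt; rewrite !ler_norml => /andP[? ?]; apply/andP; split; lra.
Qed.

End OneFunction.
End RadialMean.

(** * Radial integration *)

Section Radial.
Variable R : realType.
Implicit Types (x v : plane R).

Local Notation lam := (@lebesgue_measure R).
Local Notation lam2 := (lam \x lam)%E.
Variable z : plane R.
Hypothesis z1 : sqmod z < 1.
Local Notation J := (moebius_jac z).
Local Notation kappa := (moment_const z).

(** The squared pseudohyperbolic distance to z, extended by 0 so as to be
    measurable on the plane. *)
Definition pdist2 : plane R -> R := (fun x => 1 - defect z x) \_ (@disk R).

Lemma pdist2E x : sqmod x < 1 -> pdist2 x = 1 - defect z x.
Proof. by move=> /diskE dx; rewrite /pdist2 patchE mem_set. Qed.

Lemma measurable_pdist2 : measurable_fun setT pdist2.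
Proof.
apply/(measurable_restrictT _ (@measurable_disk R)).
apply: continuous_plane_measurable; first exact: open_disk.
move=> x /diskE x1; apply: continuous_add_at; first exact: cvg_cst.
by apply: continuous_opp_at; exact/continuous_defect/den_neq0.
Qed.

Variable h : plane R -> R.
Hypothesis hh : real_harmonic_on (@disk R) h.
Variable c0 : R.
Hypothesis c00 : 0 < c0.
Hypothesis c01 : c0 <= 1.
Hypothesis h0 : forall x, pball z c0 x -> 0 <= h x.

Let f : plane R -> R := (fun x => h x * J x) \_ (pball z c0).

Let f0 x : 0 <= f x.
Proof.
rewrite /f patchE; case: ifPn => //; rewrite inE => px.
by rewrite mulr_ge0 ?h0// moebius_jac_ge0.
Qed.

Let mf : measurable_fun setT f.
Proof.
apply/(measurable_restrictT _ (measurable_pball z1 c01)).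
exact: measurable_harmonic_jac.
Qed.

Let C : R := 3 * kappa (fun=> 1) * h z.

Let C0 : 0 <= C.
Proof.
apply: mulr_ge0; first by rewrite mulr_ge0 ?(ltW (moment_const1_gt0 z1)).
by apply: h0; rewrite /pball/= defect_center// ltrBlDr ltrDl.
Qed.

Let g : measurableTypeR R -> R := (cst C) \_ `[0, c0[.

Let g0 t : 0 <= g t.
Proof. by rewrite /g patchE; case: ifPn. Qed.

Let mg : measurable_fun setT g.
Proof.
have mI : measurable (`[0, c0[%classic : set (measurableTypeR R)) by [].
by apply/(measurable_restrictT _ mI); exact: measurable_cst.
Qed.

Let m := density lam2 f0 mf.
Let m2 := density lam g0 mg.

Let m_pball c : c <= c0 -> m (pball z c) = (\int[lam2]_(x in pball z c) (h x * J x)%:E)%E.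
Proof.
move=> cc; rewrite /m/= /density; apply: eq_integral => x; rewrite inE => px.
by rewrite /f patchE mem_set//; exact: pball_sub px.
Qed.

Let m_pball_lt c : 0 < c -> c < c0 -> m (pball z c) = (C * c)%:E.
Proof.
move=> cp cc; rewrite m_pball ?ltW// (integral_pball z1 hh cp cc c01 h0).
by rewrite moment_const_mean//; congr EFin; rewrite /C; ring.
Qed.

(** The disk of radius c0 may touch the unit circle, where [integral_pball] does
    not apply; it is the increasing union of smaller ones. *)
Let m_pball_c0 : m (pball z c0) = (C * c0)%:E.
Proof.
pose c n : R := c0 * (1 - n.+2%:R^-1).
have c_lt n : c n < c0.
  by rewrite /c -[ltRHS]mulr1 ltr_pM2l// ltrBlDr ltrDl invr_gt0.
have c_gt n : 0 < c n.
  by rewrite mulr_gt0// subr_gt0 invf_lt1// ltr1n.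
have cvgc' : c n @[n --> \oo] --> c0.
  rewrite -[X in _ --> X](mulr1 c0); apply: cvgMr.
  rewrite -[X in _ --> X]subr0; apply: cvgB; first exact: cvg_cst.
  by have := @cvg_harmonic R; rewrite -cvg_shiftS.
have cvgc : (C * c n)%:E @[n --> \oo] --> (C * c0)%:E.
  by apply: cvg_EFin; [near=> n|apply: cvgMr].
have mc n : measurable (pball z (c n)).
  by apply: measurable_pball => //; apply: le_trans c01; exact: ltW.
have cvgm : m (pball z (c n)) @[n --> \oo] --> m (\bigcup_n pball z (c n)).
  apply: nondecreasing_cvg_mu => //.
  - exact: bigcup_measurable.
  - move=> p q pq; apply/subsetPset; apply: pball_sub.
    by rewrite /c ler_pM2l// lerD2l lerN2 lef_pV2 ?posrE// ler_nat !ltnS.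
have bigE : \bigcup_n pball z (c n) = pball z c0.
  apply/seteqP; split => [x [n _]|x px].
    by apply: pball_sub; exact: ltW.
  have px' : 1 - defect z x < c0 by move: px; rewrite /pball/=; lra.
  have [n _ Hn] : \forall n \near \oo, 1 - defect z x < c n.
    by near=> n; near: n; move/cvgrPdist_lt : cvgc' => /(_ (c0 - (1 - defect z x)));
      rewrite subr_gt0 => /(_ px'); apply: filterS => n; rewrite ltr_norml; lra.
  by exists n => //; have := Hn n (leqnn n); rewrite /pball/=; lra.
rewrite bigE in cvgm.
have : (C * c n)%:E @[n --> \oo] --> m (pball z c0).
  by apply: cvg_trans cvgm; apply: near_eq_cvg; near=> n; rewrite m_pball_lt.
by move=> /cvg_lim <-//; exact: cvg_lim.
Unshelve. all: by end_near. Qed.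

Let mass_ray (c : R) : m (pdist2 @^-1` `]-oo, c[) = m (pball z (Num.min c c0)).
Proof.
have sub : pball z (Num.min c c0) `<=` pball z c0.
  by apply: pball_sub; rewrite ge_min lexx orbT.
rewrite /m/= /density [LHS]integral_mkcond [RHS]integral_mkcond.
apply: eq_integral => x _; rewrite !patchE.
have [px|px] := pselect (pball z c0 x); last first.
  have fx0 : f x = 0 by rewrite /f patchE; case: ifPn => //; rewrite inE.
  by rewrite fx0; do 2 case: ifPn.
have x1 := pball_disk z1 c01 px.
congr (if _ then _ else _); apply/idP/idP; rewrite !inE/= in_itv/= pdist2E//;
  move: px; rewrite /pball/=; case: (leP c c0); lra.
Qed.

Let image_mass : exists M : {measure set (measurableTypeR R) -> \bar R},
  forall A, M A = m (pdist2 @^-1` A).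
Proof.
unshelve eexists (@pushforward _ _ (plane R) (measurableTypeR R) R m pdist2
  : {measure set (measurableTypeR R) -> \bar R}).
  exact: measurable_pdist2.
by [].
Qed.

(** Both measures are proportional to the length on the rays, which form a
    generating pi-system. *)
Let masses_agree (A : set (measurableTypeR R)) : measurable A ->
  m (pdist2 @^-1` A) = m2 A.
Proof.
have [M ME] := image_mass; rewrite -ME.
move: A; apply: (@measure_unique _ R (measurableTypeR R)
  [set B | exists c : R, B = `]-oo, c[%classic] (fun n => `]-oo, n%:R[%classic)).
- by rewrite RGenInftyO.measurableE.
- move=> _ _ [a ->] [b ->]; exists (Num.min a b).
  by apply/seteqP; split => t/=; rewrite !in_itv/= lt_min => /andP.
- by move=> n; exists n%:R.
- apply/seteqP; split => // t _; exists (Num.truncn `|t|).+1 => //=.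
  by rewrite in_itv/= (le_lt_trans (ler_norm t))// truncnS_gt.
- move=> _ [c ->].
  have mI : measurable (`]-oo, c[%classic : set (measurableTypeR R)) by [].
  rewrite ME mass_ray /m2/= /density.
  have mI' (a : R) : measurable (`[0%R, a[%classic : set (measurableTypeR R)) by [].
  have -> : (\int[lam]_(t in `]-oo, c[) (g t)%:E =
      \int[lam]_(t in `[0%R, Num.min c c0[) C%:E)%E.
    rewrite [LHS]integral_mkcond [RHS]integral_mkcond; apply: eq_integral => t _.
    rewrite /g !patchE !mem_setE !in_itv/= lt_min.
    by case: (0 <= t); case: (t < c); case: (t < c0).
  rewrite (integral_cst lam (mI' _)) /= lebesgue_measure_itv/= lte_fin.
  case: ifPn => [cp|cn]; last first.
    rewrite mule0; apply: (eq_trans _ (measure0 m)); congr (m _).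
    rewrite -subset0 => x px.
    have mc0 : Num.min c c0 <= 0 by rewrite leNgt.
    have x1 : sqmod x < 1.
      by apply: (pball_disk z1 _ px); apply: le_trans c01; rewrite ge_min lexx orbT.
    by have := defect_le1 z1 x1; move: px; rewrite /pball/=; lra.
  rewrite sube0; move: cp; case: (leP c c0) => [cc|cc] cp; last exact: m_pball_c0.
  move: cc; rewrite le_eqVlt => /predU1P[->|cc]; first exact: m_pball_c0.
  exact: m_pball_lt.
- move=> n; rewrite ME mass_ray (@le_lt_trans _ _ (m (pball z c0)))//.
    apply: le_measure; rewrite ?inE; try exact: measurable_pball;
      last by apply: pball_sub; rewrite ge_min lexx orbT.
    by apply: measurable_pball => //; apply: le_trans c01; rewrite ge_min lexx orbT.
  by rewrite m_pball_c0 ltry.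
Qed.

(** The disks |phi_z|^2 < c have h J-mass C c, so that |phi_z|^2 maps the measure
    h J dx to C times the Lebesgue measure. *)
Lemma radial_formula (W : R -> \bar R) : (forall t, 0 <= W t)%E ->
  measurable_fun setT W ->
  (\int[lam2]_(x in pball z c0) (W (pdist2 x) * (h x * J x)%:E) =
   C%:E * \int[lam]_(t in `[0%R, c0[) W t)%E.
Proof.
move=> W0 mW.
transitivity (\int[m]_x W (pdist2 x))%E.
  rewrite integral_density//; last by apply: measurableT_comp => //; exact: measurable_pdist2.
  rewrite [LHS]integral_mkcond; apply: eq_integral => x _.
  by rewrite /f !patchE; case: ifPn => //; rewrite mule0.
transitivity (\int[m2]_t W t)%E.
  rewrite -[LHS](@ge0_integral_pushforward _ _ _ (measurableTypeR R) R pdist2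
    measurable_pdist2 m setT W)//.
  apply: eq_measure_integral => [|? A mA _]; first exact: measurable_pdist2.
  exact: masses_agree.
rewrite integral_density// -ge0_integralZl//; last first.
  exact: measurable_funTS.
rewrite [RHS]integral_mkcond; apply: eq_integral => t _.
by rewrite /g !patchE; case: ifPn => _; rewrite ?mule0// muleC.
Qed.

End Radial.

(** * Linear statistics of a configuration *)

Section ESumScale.
Context (R : realType) (T : choiceType).

(** The inequality for c and the one for c^-1 give the equality. *)
Lemma ge0_esumZl (I : set T) (a : T -> \bar R) (c : R) : 0 <= c ->
  (forall i, 0 <= a i)%E ->
  (\esum_(i in I) (c%:E * a i) = c%:E * \esum_(i in I) a i)%E.
Proof.
move=> c0 a0.
have le (b : T -> \bar R) (e : R) : 0 <= e -> (forall i, 0 <= b i)%E ->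
    (\esum_(i in I) (e%:E * b i) <= e%:E * \esum_(i in I) b i)%E.
  move=> e0 b0; apply: ge_ereal_sup => _ [F [finF FI] <-].
  rewrite -ge0_mule_fsumr// lee_wpmul2l//.
  by apply: ereal_sup_ubound; exists F.
apply/eqP; rewrite eq_le le//=.
have [->|cn] := eqVneq c 0.
  by rewrite mul0e; apply: esum_ge0 => i _; rewrite mul0e.
have {}c0 : 0 < c by rewrite lt_def cn.
rewrite -lee_pdivlMl//.
have := le (fun i => c%:E * a i)%E c^-1 (ltW _) _.
rewrite invr_gt0 => /(_ c0) H.
apply: le_trans (H _); last by move=> i; rewrite mule_ge0// lee_fin ltW.
by apply: le_esum => i _; rewrite muleA -EFinM mulVf ?mul1e ?gt_eqF.
Qed.

End ESumScale.

Section Particles.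
Variable R : realType.
Implicit Types (X : configuration R) (x : plane R).

Definition particles X : set (plane R * nat) := [set p | (p.2 < X p.1)%N].

Definition linstat X (phi : plane R -> \bar R) : \bar R :=
  \esum_(p in particles X) phi p.1.

Lemma linstatE X (phi : plane R -> \bar R) : (forall x, 0 <= phi x)%E ->
  linstat X phi = \esum_(x in @disk R) ((X x)%:R%:E * phi x)%E.
Proof.
move=> p0; rewrite /linstat.
have -> : particles X = setT `*`` (fun x => [set i | (i < X x)%N]).
  by apply/seteqP; split => [p pX|p []].
rewrite -(@esum_esum _ _ _ _ _ (fun x _ => phi x))//.
rewrite [RHS]esum_mkcond; apply: eq_esum => x _.
rewrite (esum_fset (finite_II _))//.
have -> : \sum_(i \in [set i | (i < X x)%N]) phi x = ((X x)%:R%:E * phi x)%E.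
  by rewrite -(fsbig_ord _ _ (fun=> phi x)) sumr_const card_ord mule_natl.
case: ifPn => // /negP; rewrite inE => nx.
suff -> : X x = 0%N by rewrite mul0e.
by apply/eqP; apply: contra_notT nx => /eqP; exact: mult_in_disk.
Qed.

Lemma factorial_sum1 X (phi : plane R -> \bar R) :
  factorial_sum X (fun t : 1.-tuple (plane R) => phi (tnth t ord0)) = linstat X phi.
Proof.
rewrite /factorial_sum /linstat.
rewrite (reindex_esum (particles X) _ (fun p => [tuple p])).
  by apply: eq_esum => p _.
split.
- by move=> p pX; split => // i; rewrite (ord1 i).
- by move=> p q _ _ [].
- move=> t [_ tX]; exists (tnth t ord0); first exact: tX.
  by rewrite [RHS]tuple_eta; apply/val_inj => /=; case: t {tX} => -[|a []].
Qed.

Lemma tuple2E (T : Type) (t : 2.-tuple T) :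
  t = [tuple tnth t ord0; tnth t ord_max].
Proof.
apply: eq_from_tnth => i; rewrite [RHS](tnth_nth (tnth t ord0)).
case: i => -[|[|//]] i2 /=; congr (tnth t _); exact: val_inj.
Qed.

(** Pairs of particles are either ordered pairs of distinct ones or diagonal. *)
Lemma linstat_sqr X (phi : plane R -> R) : (forall x, 0 <= phi x) ->
  linstat X (EFin \o phi) \is a fin_num ->
  (linstat X (EFin \o phi) * linstat X (EFin \o phi) =
   factorial_sum X (fun t : 2.-tuple (plane R) =>
     (phi (tnth t ord0) * phi (tnth t ord_max))%:E) +
   linstat X (fun x => (phi x ^+ 2)%:E))%E.
Proof.
move=> p0 fin.
have p0' x : (0 <= (EFin \o phi) x)%E by rewrite /= lee_fin.
have [r r0 E] : exists2 r : R, 0 <= r & linstat X (EFin \o phi) = r%:E.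
  exists (fine (linstat X (EFin \o phi))); rewrite ?fineK//.
  by rewrite fine_ge0// esum_ge0.
rewrite {1}E -ge0_esumZl//.
have Ephi (p : plane R * nat) : (r%:E * (EFin \o phi) p.1 =
    \esum_(q in particles X) (phi p.1 * phi q.1)%:E)%E.
  rewrite muleC -E /linstat /= -ge0_esumZl//.
  by move=> q; rewrite lee_fin.
under eq_esum do rewrite Ephi.
rewrite esum_esum; last by move=> p q _ _; rewrite lee_fin mulr_ge0.
rewrite (esumID [set pq | pq.1 != pq.2]); last first.
  by move=> p _; rewrite lee_fin mulr_ge0.
congr (_ + _)%E.
  rewrite /factorial_sum [RHS](reindex_esum
    ((particles X `*`` (fun=> particles X)) `&` [set pq | pq.1 != pq.2]) _
    (fun pq => [tuple pq.1; pq.2])).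
    by apply: eq_esum => p _.
  split.
  - move=> [p q] [[/= pX qX] pq]; split.
      by rewrite /= inE pq.
    by move=> i; rewrite /tnth/=; case: i => -[|[|]].
  - by move=> [p q] [p' q'] _ _ [] -> ->.
  - move=> t [ut tX]; exists (tnth t ord0, tnth t ord_max) => /=.
      split; first by split; exact: tX.
      by move: ut; rewrite {1}(tuple2E t) /= inE andbT.
    by rewrite -tuple2E.
rewrite /linstat [LHS](reindex_esum (particles X) _ (fun p => (p, p))).
  by apply: eq_esum => p _; rewrite /= expr2.
split.
- by move=> p pX; split => //=; apply/negP; rewrite eqxx.
- by move=> p q _ _ [].
- by move=> [p q] [[/= pX qX] /negP]; rewrite negbK => /eqP <-; exists p.
Qed.

End Particles.

(** * Moments of the point process *)

Section LeIntegral.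
Context d (T : measurableType d) (R : realType).
Variable mu : {measure set T -> \bar R}.
Import HBNNSimple.

(** The integral of a nonnegative function is a supremum over the simple functions
    below it. *)
Lemma le_integral_nomeas (D : set T) (f g : T -> \bar R) :
  (forall x, D x -> 0 <= f x)%E -> (forall x, D x -> f x <= g x)%E ->
  (\int[mu]_(x in D) f x <= \int[mu]_(x in D) g x)%E.
Proof.
move=> f0 fg; have g0 x : D x -> (0 <= g x)%E.
  by move=> Dx; exact: le_trans (f0 _ Dx) (fg _ Dx).
rewrite !ge0_integralE//.
apply: le_ereal_sup => _ [h hf <-]; exists h => // x; apply: le_trans (hf x) _.
by rewrite !patchE; case: ifPn => //; rewrite inE; exact: fg.
Qed.

End LeIntegral.

Section Moments.
Variable R : realType.
Implicit Types (X : configuration R) (x y : plane R).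

(** The Bergman kernel on the diagonal, and the density of the hyperbolic area. *)
Definition intensity x : R := ((1 - sqmod x) ^+ 2)^-1.

Lemma intensity_ge0 x : 0 <= intensity x.
Proof. by rewrite invr_ge0 sqr_ge0. Qed.

Lemma measurable_intensity : measurable_fun (@disk R) intensity.
Proof.
apply: continuous_plane_measurable; first exact: open_disk.
move=> x /diskE x1; rewrite /intensity.
apply: continuous_inv_at; first by rewrite expf_neq0// subr_eq0 gt_eqF.
apply: continuous_exp_at; apply: continuous_add_at; first exact: cvg_cst.
by apply: continuous_opp_at; exact: continuous_sqmod.
Qed.

Local Open Scope complex_scope.

Lemma bergman_kernelE x y : bergman_kernel x y =
  ((1 - (x.1 * y.1 + x.2 * y.2)) +i* (x.1 * y.2 - x.2 * y.1)) ^- 2.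
Proof.
rewrite /bergman_kernel; congr ((_ ^+ 2)^-1).
by rewrite /cplx/=; simpc; congr (_ +i* _); ring.
Qed.

Lemma bergman_kernel_diag x : bergman_kernel x x = (intensity x)%:C.
Proof.
rewrite bergman_kernelE /intensity.
have -> : 1 - (x.1 * x.1 + x.2 * x.2) = 1 - sqmod x by rewrite /sqmod !expr2.
have -> : x.1 * x.2 - x.2 * x.1 = 0 by ring.
rewrite -[_ +i* 0]/((1 - sqmod x)%:C).
by rewrite -rmorphXn/= -fmorphV.
Qed.

Lemma bergman_kernel_sym x y :
  bergman_kernel x y * bergman_kernel y x = ((moebius_den x y ^+ 2)^-1)%:C.
Proof.
rewrite !bergman_kernelE -invfM -exprMn.
have -> : ((1 - (x.1 * y.1 + x.2 * y.2)) +i* (x.1 * y.2 - x.2 * y.1)) *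
   ((1 - (y.1 * x.1 + y.2 * x.2)) +i* (y.1 * x.2 - y.2 * x.1)) = (moebius_den x y)%:C.
  by rewrite /moebius_den; simpc; congr (_ +i* _); ring.
by rewrite -rmorphXn/= -fmorphV.
Qed.

Lemma det1_bergman (t : 1.-tuple (plane R)) :
  complex.Re (\det (\matrix_(i < 1, j < 1) bergman_kernel (tnth t i) (tnth t j)))
  = intensity (tnth t ord0).
Proof. by rewrite det_mx11 mxE bergman_kernel_diag. Qed.

Lemma det_2x2 (A : comNzRingType) (M : 'M[A]_2) :
  \det M = M ord0 ord0 * M ord_max ord_max - M ord0 ord_max * M ord_max ord0.
Proof.
rewrite (expand_det_row _ ord0) !big_ord_recl big_ord0 /cofactor !det_mx11 !mxE/=.
rewrite addr0 expr0 expr1 mul1r mulN1r mulrN.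
rewrite (_ : lift ord0 ord0 = ord_max :> 'I_2); last exact: val_inj.
by rewrite (_ : lift ord_max ord0 = ord0 :> 'I_2); last exact: val_inj.
Qed.

Lemma det2_bergman (t : 2.-tuple (plane R)) :
  complex.Re (\det (\matrix_(i < 2, j < 2) bergman_kernel (tnth t i) (tnth t j)))
  = intensity (tnth t ord0) * intensity (tnth t ord_max)
    - (moebius_den (tnth t ord0) (tnth t ord_max) ^+ 2)^-1.
Proof.
rewrite det_2x2 !mxE !bergman_kernel_diag bergman_kernel_sym.
by rewrite -rmorphM -rmorphB.
Qed.

(** Cauchy-Schwarz for the kernel: |K(x, y)|^2 <= K(x, x) K(y, y).  The upper bound
    expresses that the particles repel each other. *)
Lemma det2_bergman_bounds x y : disk x -> disk y ->
  0 <= intensity x * intensity y - (moebius_den x y ^+ 2)^-1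
    <= intensity x * intensity y.
Proof.
move=> /diskE x1 /diskE y1.
have d0 := moebius_den_gt0 x1 y1.
apply/andP; split; last by rewrite gerBl invr_ge0 sqr_ge0.
rewrite subr_ge0 /intensity -invfM -exprMn lef_pV2 ?posrE ?exprn_gt0//; last first.
  by rewrite mulr_gt0 ?subr_gt0.
rewrite ler_sqr ?nnegrE ?(ltW d0)//; last by rewrite mulr_ge0// subr_ge0 ltW.
by rewrite moebius_denE lerDl addr_ge0 ?sqr_ge0.
Qed.

Local Close Scope complex_scope.

Variable P : probability (Conf R) R.
Hypothesis P_dpp : determinantal_process P (@bergman_kernel R).

Lemma mean_linstat (phi : plane R -> \bar R) : measurable_fun setT phi ->
  (forall x, 0 <= phi x)%E ->
  (\int[P]_X linstat X phi = \int[@dA R]_(x in @disk R) (phi x * (intensity x)%:E))%E.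
Proof.
move=> mphi p0; have [_ /(_ 1%N isT)] := P_dpp.
move=> /(_ (fun t => phi (tnth t ord0))) H.
have {}H := H (measurableT_comp mphi (measurable_tnth _)) (fun t => p0 _).
apply: (eq_trans _ (eq_trans H _)).
  by apply: eq_integral => X _; rewrite factorial_sum1.
by apply: eq_integral => x _ /=; rewrite det1_bergman.
Qed.

(** Integrating the upper bound of [det2_bergman_bounds] leaves a product. *)
Lemma mean_factorial_sum2 (phi : plane R -> R) : measurable_fun setT phi ->
  (forall x, 0 <= phi x) ->
  (\int[P]_X factorial_sum X (fun t : 2.-tuple (plane R) =>
     (phi (tnth t ord0) * phi (tnth t ord_max))%:E) <=
   (\int[@dA R]_(x in @disk R) (phi x * intensity x)%:E) *
   (\int[@dA R]_(x in @disk R) (phi x * intensity x)%:E))%E.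
Proof.
move=> mphi p0; have [_ /(_ 2%N isT)] := P_dpp.
move=> /(_ (fun t => (phi (tnth t ord0) * phi (tnth t ord_max))%:E)) H.
rewrite H; last 2 first.
- apply/measurable_EFinP; apply: measurable_funM;
    by apply: measurableT_comp => //; exact: measurable_tnth.
- by move=> t; rewrite lee_fin mulr_ge0.
set m := (\int[@dA R]_(x in @disk R) (phi x * intensity x)%:E)%E.
have m0 : (0 <= m)%E.
  by apply: integral_ge0 => x _; rewrite lee_fin mulr_ge0 ?intensity_ge0.
apply: (@le_trans _ _ (\int[@dA R]_(x in @disk R) \int[@dA R]_(y in @disk R)
   ((phi x * intensity x) * (phi y * intensity y))%:E)%E).
  apply: le_integral_nomeas => x dx.
    apply: integral_ge0 => y dy.
    rewrite mule_ge0 ?lee_fin ?mulr_ge0// det2_bergman.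
    by have /andP[] := det2_bergman_bounds dx dy.
  apply: le_integral_nomeas => y dy.
    rewrite mule_ge0 ?lee_fin ?mulr_ge0// det2_bergman.
    by have /andP[] := det2_bergman_bounds dx dy.
  rewrite -EFinM lee_fin det2_bergman.
  have -> : phi x * intensity x * (phi y * intensity y) =
    (phi x * phi y) * (intensity x * intensity y) by ring.
  rewrite ler_wpM2l ?mulr_ge0//.
  by have /andP[] := det2_bergman_bounds dx dy.
have mk : measurable_fun (@disk R) (fun x => (phi x * intensity x)%:E).
  apply/measurable_EFinP; apply: measurable_funM; first exact: measurable_funS mphi.
  exact: measurable_intensity.
have k0 x : (0 <= (phi x * intensity x)%:E)%E.
  by rewrite lee_fin mulr_ge0// intensity_ge0.
have md := @measurable_disk R.
under eq_integral => x _.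
  under eq_integral do rewrite EFinM.
  rewrite ge0_integralZl//.
  over.
by rewrite ge0_integralZr.
Qed.

End Moments.

(** * Particles in compact subdisks *)

Section LocallyFinite.
Variable R : realType.
Implicit Types (X : configuration R) (x : plane R).

Definition subdisk (rho : R) : set (plane R) := [set x | sqmod x <= rho].

Lemma closed_subdisk rho : closed (subdisk rho).
Proof.
rewrite -(setCK (subdisk rho)); apply: open_closedC.
have -> : ~` subdisk rho = [set x | rho < sqmod x].
  apply/seteqP; split => x; rewrite /subdisk/=; first by move/negP; rewrite -ltNge.
  by move=> h; apply/negP; rewrite -ltNge.
exact: open_sqmod_gt.
Qed.

Lemma compact_subdisk rho : rho < 1 -> compact (subdisk rho).
Proof.
move=> r1; apply: (@subclosed_compact _ _ (@square R)).
- exact: closed_subdisk.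
- by apply: compact_setX; exact: segment_compact.
- move=> x xr; apply: contrapT => /notin_square x1.
  by move: (le_lt_trans xr r1); rewrite ltNge x1.
Qed.

Lemma subdisk_disk rho : rho < 1 -> subdisk rho `<=` @disk R.
Proof. by move=> r1 x xr; apply/diskE; exact: le_lt_trans xr r1. Qed.

Lemma measurable_subdisk rho : measurable (subdisk rho).
Proof.
rewrite -(setCK (subdisk rho)); apply: measurableC.
by apply: open_plane_measurable; rewrite openC; exact: closed_subdisk.
Qed.

(** The generating events count particles in relatively compact sets only. *)
Lemma relatively_compact_subdisk rho (B : set (plane R)) :
  rho < 1 -> B `<=` subdisk rho -> relatively_compact_in_disk B.
Proof.
move=> r1 Br.
have cl : closure B `<=` subdisk rho.
  have E : subdisk rho = closure (subdisk rho) by exact/closure_id/closed_subdisk.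
  by rewrite E; exact: closure_subset.
split; last exact: subset_trans (subdisk_disk r1).
by apply: subclosed_compact (compact_subdisk r1) cl; exact: closed_closure.
Qed.

Lemma finite_points X rho : rho < 1 ->
  finite_set (subdisk rho `&` [set x | X x <> 0%N]).
Proof.
by move=> r1; apply: mult_locally_finite; [exact: compact_subdisk|exact: subdisk_disk].
Qed.

Definition local_particles X rho : set (plane R * nat) :=
  particles X `&` [set p | subdisk rho p.1].

Lemma finite_local_particles X rho : rho < 1 -> finite_set (local_particles X rho).
Proof.
move=> r1; apply: (@sub_finite_set _ _ (\bigcup_(x in subdisk rho `&` [set x | X x <> 0%N])
    ((fun i => (x, i)) @` `I_(X x)))).
  move=> [x i] [/= iX xr]; exists x; last by exists i.
  by split => //= X0; move: iX; rewrite /particles/= X0.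
apply: bigcup_finite; first exact: finite_points.
by move=> x _; apply: finite_image; exact: finite_II.
Qed.

Lemma linstat_local X rho (phi : plane R -> \bar R) : rho < 1 ->
  (forall x, 0 <= phi x)%E -> (forall x, ~ subdisk rho x -> phi x = 0%E) ->
  linstat X phi = (\sum_(p \in local_particles X rho) phi p.1)%E.
Proof.
move=> r1 p0 pr; rewrite -esum_fset//; last exact: finite_local_particles.
rewrite /linstat [RHS]esum_mkcondr; apply: eq_esum => p _.
by case: ifPn => // /negP; rewrite inE => /pr.
Qed.

Lemma particle_countE X rho (B : set (plane R)) : rho < 1 -> B `<=` subdisk rho ->
  linstat X (fun x => (\1_B x)%:E) = ((particle_count X B)%:R : R)%:E.
Proof.
move=> r1 Br.
have fB : finite_set (B `&` [set x | X x <> 0%N]).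
  by apply: sub_finite_set (finite_points X r1) => x [Bx ?]; split => //; exact: Br.
rewrite linstatE; last by move=> x; rewrite lee_fin.
rewrite /particle_count fsbig_supp.
have -> : B `&` X @^-1` [set~ 0%N] = B `&` [set x | X x <> 0%N] by [].
transitivity (\esum_(x in B `&` [set x | X x <> 0%N]) ((X x)%:R : R)%:E)%E.
  rewrite esum_mkcond [RHS]esum_mkcond; apply: eq_esum => x _.
  case: ifPn => [|/negP]; rewrite inE => dx; last first.
    by rewrite memNset// => -[/Br/(subdisk_disk r1)].
  rewrite indicE; have [Bx|nB] := pselect (B x); last first.
    by rewrite !memNset ?mule0// => -[].
  rewrite (mem_set Bx) mule1; case: ifPn => // /negP; rewrite inE => h.
  by have -> : X x = 0%N by apply: contrapT => ?; apply: h.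
rewrite esum_fset//; rewrite !fsbig_finite//.
by rewrite sumEFin natr_sum.
Qed.

Lemma measurable_particle_count rho (B : set (plane R)) :
  rho < 1 -> measurable B -> B `<=` subdisk rho ->
  measurable_fun setT (fun X : Conf R => particle_count X B).
Proof.
move=> r1 mB Br _ Y _; rewrite setTI.
have -> : (fun X : Conf R => particle_count X B) @^-1` Y =
    \bigcup_(n in Y) [set X : Conf R | particle_count X B = n].
  by apply/seteqP; split => [X YX|X [n Yn /= ->]]//; exists (particle_count X B).
apply: bigcup_measurable => n _; apply: sub_sigma_algebra.
by exists B, n; split => //; exact: relatively_compact_subdisk Br.
Qed.

End LocallyFinite.

(** * Joint measurability of linear statistics *)

Section ParticleKernel.
Variable R : realType.
Variables (rho : R) (m : nat).
Hypothesis rho1 : rho < 1.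

(** The particles in a compact subdisk as a finite list, with repetitions: a
    statistic supported in the subdisk is a sum over it. *)
Definition local_points (X : configuration R) : seq (plane R) :=
  [seq p.1 | p <- finmap.enum_fset (fset_set (local_particles X rho))].

Lemma sum_local_points (X : configuration R) (phi : plane R -> \bar R) :
  (forall x, 0 <= phi x)%E -> (forall x, ~ subdisk rho x -> phi x = 0%E) ->
  linstat X phi = (\sum_(x <- local_points X) phi x)%E.
Proof.
move=> p0 pr; rewrite (linstat_local _ rho1 p0 pr).
by rewrite fsbig_finite ?big_map//; exact: finite_local_particles.
Qed.

Lemma local_points_subdisk X x : x \in local_points X -> subdisk rho x.
Proof.
move=> /mapP[p + ->]; rewrite in_fset_set; last exact: finite_local_particles.
by rewrite inE => -[].
Qed.

Lemma sum_local_points_indic X (U : set (plane R)) :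
  (\sum_(x <- local_points X) (\1_U x)%:E =
   ((particle_count X (U `&` subdisk rho))%:R : R)%:E)%E.
Proof.
rewrite -(particle_countE X rho1 (@subIsetr _ U (subdisk rho))).
rewrite sum_local_points; last 2 first.
- by move=> x; rewrite lee_fin.
- by move=> x nx; rewrite indicE memNset// => -[].
rewrite big_seq [RHS]big_seq; apply: eq_bigr => x /local_points_subdisk xr.
by rewrite indicI [X in _ = (_ * X)%:E]indicE (mem_set xr) mulr1.
Qed.

Lemma size_local_points X :
  size (local_points X) = particle_count X (subdisk rho).
Proof.
have := sum_local_points_indic X setT; rewrite setTI => E.
apply/eqP; rewrite -(eqr_nat R) -(inj_eq (@EFin_inj R)) -E.
rewrite (eq_bigr (fun=> 1%:E)); last by move=> x _; rewrite indicT.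
by rewrite sumEFin big_const_seq count_predT iter_addr_0.
Qed.

(** The truncation bounds the total mass of [particle_kernel]. *)
Definition kept_points (X : configuration R) : nat :=
  if (size (local_points X) <= m)%N then size (local_points X) else 0%N.

(** The counting measure of the particles in the subdisk.  As a finite kernel it
    makes integrals measurable in the configuration and in a parameter jointly;
    the parameter is part of the source for that purpose. *)
Definition particle_kernel (Xz : Conf R * plane R) :
    {measure set (plane R) -> \bar R} :=
  msum (fun i => dirac (nth point (local_points Xz.1) i) : {measure set (plane R) -> \bar R})
    (kept_points Xz.1).

Lemma particle_kernelE Xz U : particle_kernel Xz U =
  if (particle_count Xz.1 (subdisk rho) <= m)%N then
    ((particle_count Xz.1 (U `&` subdisk rho))%:R : R)%:E else 0%E.
Proof.
rewrite /particle_kernel /= /msum /kept_points -size_local_points.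
case: ifPn => _; last by rewrite big_ord0.
by rewrite -sum_local_points_indic (big_nth point) big_mkord.
Qed.

Lemma measurable_particle_kernel (U : set (plane R)) : measurable U ->
  measurable_fun setT (particle_kernel ^~ U).
Proof.
move=> mU; under eq_fun do rewrite particle_kernelE.
have mc (B : set (plane R)) : measurable B -> B `<=` subdisk rho ->
    measurable_fun setT (fun Xz : Conf R * plane R => particle_count Xz.1 B).
  move=> mB Br; apply: (measurableT_comp (measurable_particle_count rho1 mB Br)).
  exact: measurable_fst.
apply: measurable_fun_ifT.
- apply: (measurable_fun_leq (g := cst m)); last exact: measurable_cst.
  by apply: mc; [exact: measurable_subdisk|].
- apply/measurable_EFinP.
  apply: (@measurableT_comp _ _ _ _ _ _ (fun n : nat => n%:R : R)) => //.
  apply: mc; last exact: subIsetr.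
  by apply: measurableI => //; exact: measurable_subdisk.
- exact: measurable_cst.
Qed.

HB.instance Definition _ :=
  isKernel.Build _ _ _ _ R particle_kernel measurable_particle_kernel.

Lemma particle_kernel_uub : measure_fam_uub particle_kernel.
Proof.
exists m.+1%:R => Xz; rewrite particle_kernelE setTI.
by case: ifPn => h; rewrite lte_fin ?ltr_nat ?ltnS.
Qed.

HB.instance Definition _ :=
  Kernel_isFinite.Build _ _ _ _ R particle_kernel particle_kernel_uub.

Lemma integral_particle_kernel Xz (phi : plane R -> \bar R) :
  measurable_fun setT phi -> (forall x, 0 <= phi x)%E ->
  (forall x, ~ subdisk rho x -> phi x = 0%E) ->
  (particle_count Xz.1 (subdisk rho) <= m)%N ->
  (\int[particle_kernel Xz]_x phi x = linstat Xz.1 phi)%E.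
Proof.
move=> mphi p0 pr cm.
rewrite ge0_integral_measure_sum//.
rewrite /kept_points size_local_points cm -size_local_points.
rewrite (sum_local_points _ p0 pr) (big_nth point) big_mkord.
by apply: eq_bigr => i _; rewrite integral_dirac// diracT mul1e.
Qed.

Lemma measurable_integral_particle_kernel (phi : plane R * plane R -> \bar R) :
  measurable_fun setT phi -> (forall x, 0 <= phi x)%E ->
  measurable_fun setT (fun Xz : Conf R * plane R =>
    \int[particle_kernel Xz]_x phi (Xz.2, x))%E.
Proof.
move=> mphi p0.
apply: (@measurable_fun_integral_finite_kernel _ _ _ _ R
  (fun p : (Conf R * plane R) * plane R => phi (p.1.2, p.2)) particle_kernel) => //.
apply: (measurableT_comp mphi); apply/measurable_fun_pairP; split => /=.
  exact: (measurableT_comp measurable_snd measurable_fst).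
exact: measurable_snd.
Qed.

End ParticleKernel.

Section JointMeasurability.
Variable R : realType.

Lemma cvg_radius : (1 - n.+1%:R^-1 : R) @[n --> \oo] --> (1 : R).
Proof.
rewrite -[X in _ --> X]subr0; apply: cvgB; first exact: cvg_cst.
exact: cvg_harmonic.
Qed.

(** Any such statistic is a limit of integrals against the finite kernels, as the
    truncation level and then the radius increase; each limit is eventually
    constant. *)
Lemma measurable_linstat (phi : plane R * plane R -> \bar R) :
  measurable_fun setT phi -> (forall p, 0 <= phi p)%E ->
  (forall z, exists2 rho : R, rho < 1 &
     forall x, ~ subdisk rho x -> phi (z, x) = 0%E) ->
  measurable_fun setT (fun Xz : Conf R * plane R =>
    linstat Xz.1 (fun x => phi (Xz.2, x))).
Proof.
move=> mphi p0 supp.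
pose rho n : R := 1 - n.+1%:R^-1.
have rho1 n : rho n < 1 by rewrite ltrBlDr ltrDl invr_gt0.
pose phin n (p : plane R * plane R) : \bar R :=
  (phi p * (\1_(subdisk (rho n)) p.2)%:E)%E.
have phin0 n p : (0 <= phin n p)%E by rewrite mule_ge0// lee_fin.
have mphin n : measurable_fun setT (phin n).
  apply: emeasurable_funM => //; apply/measurable_EFinP.
  apply: (measurableT_comp _ measurable_snd).
  exact: measurable_indic (@measurable_subdisk R _).
have phin_supp n z x : ~ subdisk (rho n) x -> phin n (z, x) = 0%E.
  by move=> nx; rewrite /phin indicE memNset// mule0.
apply: (emeasurable_fun_cvg (fun n (Xz : Conf R * plane R) =>
    linstat Xz.1 (fun x => phin n (Xz.2, x)))).
  move=> n.
  apply: (emeasurable_fun_cvg (fun m (Xz : Conf R * plane R) =>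
    \int[particle_kernel (rho n) m Xz]_x phin n (Xz.2, x))%E).
    by move=> m; apply: measurable_integral_particle_kernel.
  move=> Xz _; apply: cvg_near_cst; near=> m.
  apply: integral_particle_kernel.
  - exact: rho1.
  - apply: (measurableT_comp (mphin n)); apply/measurable_fun_pairP.
    by split; [exact: measurable_cst|exact: measurable_id].
  - by move=> x; exact: phin0.
  - by move=> x nx; rewrite phin_supp.
  - by near: m; exists (particle_count Xz.1 (subdisk (rho n))).
move=> [X z] _; apply: cvg_near_cst => /=.
have [r r1 Hr] := supp z.
have : \forall n \near \oo, r < rho n.
  move/cvgrPdist_lt : cvg_radius => /(_ (1 - r)); rewrite subr_gt0 => /(_ r1).
  by apply: filterS => n; rewrite /rho ltr_norml; move: (n.+1%:R^-1) => k; lra.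
apply: filterS => n rn; congr (linstat X _); apply/funext => x.
rewrite /phin; have [xr|xr] := pselect (subdisk r x).
  rewrite indicE mem_set ?mule1//.
  by rewrite /subdisk/=; exact: le_trans xr (ltW rn).
by rewrite Hr// mul0e.
Unshelve. all: by end_near. Qed.

End JointMeasurability.

(** * Variance of local statistics *)

Section SignedParts.
Variable R : realType.

Lemma ppartB (t : R) : ppart t - ppart (- t) = t.
Proof. by rewrite /ppart; case: (leP t 0); case: (leP (- t) 0); lra. Qed.

Lemma ppart_sqr (t : R) : ppart t ^+ 2 + ppart (- t) ^+ 2 = t ^+ 2.
Proof. by rewrite /ppart; case: (leP t 0); case: (leP (- t) 0) => *; rewrite ?expr0n/=; nra. Qed.

End SignedParts.

Section LocalSums.
Variable R : realType.
Variable rho : R.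
Hypothesis rho1 : rho < 1.
Implicit Types (X : configuration R) (phi : plane R -> R).

Definition lsum X (phi : plane R -> R) : R := \sum_(x <- local_points rho X) phi x.

Definition local phi := forall x, ~ subdisk rho x -> phi x = 0.

Lemma linstat_lsum X phi : (forall x, 0 <= phi x) -> local phi ->
  linstat X (fun x => (phi x)%:E) = (lsum X phi)%:E.
Proof.
move=> p0 pl; rewrite (sum_local_points rho1).
- by rewrite sumEFin.
- by move=> x; rewrite lee_fin.
- by move=> x nx; rewrite pl.
Qed.

Lemma lsum_ge0 X phi : (forall x, 0 <= phi x) -> 0 <= lsum X phi.
Proof. by move=> p0; apply: sumr_ge0. Qed.

Lemma lsumB X phi psi : lsum X (fun x => phi x - psi x) = lsum X phi - lsum X psi.
Proof. exact: sumrB. Qed.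

Lemma measurable_lsum phi : measurable_fun setT phi -> (forall x, 0 <= phi x) ->
  local phi -> measurable_fun setT (fun X : Conf R => lsum X phi).
Proof.
move=> mphi p0 pl.
have M := @measurable_linstat R (fun p => (phi p.2)%:E).
have {}M : measurable_fun setT (fun Xz : Conf R * plane R =>
    linstat Xz.1 (fun x => (phi x)%:E)).
  apply: M.
  - by apply/measurable_EFinP; exact: (measurableT_comp mphi measurable_snd).
  - by move=> p; rewrite lee_fin.
  - by move=> z; exists rho => // x nx /=; rewrite pl.
apply/measurable_EFinP.
have -> : EFin \o (fun X : Conf R => lsum X phi) =
    (fun Xz : Conf R * plane R => linstat Xz.1 (fun x => (phi x)%:E)) \o
    (fun X => (X, point)).
  by apply/funext => X /=; rewrite linstat_lsum.
apply: (measurableT_comp M); apply/measurable_fun_pairP.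
by split; [exact: measurable_id|exact: measurable_cst].
Qed.

Lemma count_local_points X x : subdisk rho x ->
  count_mem x (local_points rho X) = X x.
Proof.
move=> xr.
have E := sum_local_points_indic rho1 X [set x].
have cnt (s : seq (plane R)) :
    (\sum_(y <- s) (\1_[set x] y)%:E = ((count_mem x s)%:R : R)%:E)%E.
  elim: s => [|y s IH]; first by rewrite big_nil.
  rewrite big_cons IH /= natrD EFinD; congr (_ + _)%E.
  rewrite indicE; congr ((_ %:R)%:E); congr nat_of_bool.
  by apply/idP/eqP; rewrite inE.
have xE : [set x] `&` subdisk rho = [set x].
  by apply/seteqP; split => [y []|y ->].
move: E; rewrite cnt xE /particle_count fsbig_set1 => E.
by have := @EFin_inj R _ _ E; apply: (mulrIn (oner_neq0 R)).
Qed.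

(** A set may contain infinitely many points that carry no particle; the list of
    local points contains each particle as often as its multiplicity. *)
Lemma lsum_nmod (V : nmodType) X (F : plane R -> V) (A : set (plane R)) :
  A `<=` subdisk rho ->
  \sum_(x \in A) F x *+ X x =
  \sum_(x <- local_points rho X) (if x \in A then F x else 0).
Proof.
move=> Ar.
set s := local_points rho X.
rewrite -(big_undup_iterop_count _ s xpredT (fun x => if x \in A then F x else 0)).
rewrite [RHS]fsbig_seq ?undup_uniq//.
have widen (D : set (plane R)) (G : plane R -> V) :
    A `&` [set` undup s] `<=` D ->
    (forall x, D x -> ~ (A x /\ x \in undup s) -> G x = 0) ->
    \sum_(x \in D) G x = \sum_(x \in A `&` [set` undup s]) G x.
  by move=> sub G0; apply/esym/fsbig_widen => // x [Dx nx]; exact: G0.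
apply: (eq_trans (widen A (fun x => F x *+ X x) _ _)).
- exact: subIsetl.
- move=> x Ax nx; rewrite -(count_local_points X (Ar _ Ax)) -/s.
  rewrite (count_memPn _) ?mulr0n//; apply/negP => xs; apply: nx.
  by rewrite mem_undup.
apply/esym; apply: (eq_trans (widen [set` undup s] _ _ _)).
- exact: subIsetr.
- move=> x xs nx; rewrite memNset; last by move=> Ax; apply: nx.
  by rewrite -[iterop _ _ _ _]/(0 *+ _) mul0rn.
apply: eq_fsbigr => x; rewrite inE => -[Ax xs].
by rewrite mem_set// /s count_local_points//; exact: Ar.
Qed.

End LocalSums.

Section Variance.
Variable R : realType.
Variable P : probability (Conf R) R.
Hypothesis P_dpp : determinantal_process P (@bergman_kernel R).
Variable rho : R.
Hypothesis rho1 : rho < 1.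

Local Notation lsum := (lsum rho).
Local Notation local := (local rho).
Local Notation "'mass' phi" := (\int[@dA R]_(x in @disk R) (phi x * intensity x)%:E)%E
  (at level 10, phi at level 8).

Lemma mean_lsum (phi : plane R -> R) : measurable_fun setT phi ->
  (forall x, 0 <= phi x) -> local phi ->
  (\int[P]_X (lsum X phi)%:E = mass phi)%E.
Proof.
move=> mphi p0 pl.
have := mean_linstat P_dpp (phi := EFin \o phi).
rewrite /= => <-; last 2 first.
- exact/measurable_EFinP.
- by move=> x; rewrite lee_fin.
by apply: eq_integral => X _; rewrite (linstat_lsum rho1).
Qed.

Lemma second_moment_lsum (phi : plane R -> R) : measurable_fun setT phi ->
  (forall x, 0 <= phi x) -> local phi ->
  (\int[P]_X (lsum X phi ^+ 2)%:E <=
     mass phi * mass phi + mass (fun x => phi x ^+ 2)%R)%E.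
Proof.
move=> mphi p0 pl.
have msq : measurable_fun setT (fun x => phi x ^+ 2) by exact: measurable_funX.
have sq0 x : 0 <= phi x ^+ 2 by rewrite sqr_ge0.
have sql : local (fun x => phi x ^+ 2) by move=> x nx; rewrite pl// expr0n.
have E (X : configuration R) : factorial_sum X (fun t : 2.-tuple (plane R) =>
    (phi (tnth t ord0) * phi (tnth t ord_max))%:E) =
    (lsum X phi ^+ 2 - lsum X (fun x => phi x ^+ 2)%R)%:E.
  have := @linstat_sqr R X phi p0.
  rewrite (_ : linstat X (EFin \o phi) = (lsum X phi)%:E); last exact: linstat_lsum.
  move=> /(_ isT); rewrite (linstat_lsum rho1 X sq0 sql) => H.
  by rewrite EFinB expr2 EFinM H addeK.
have m1 := measurable_lsum rho1 mphi p0 pl.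
have m2 := measurable_lsum rho1 msq sq0 sql.
rewrite -(mean_lsum msq sq0 sql).
apply: le_trans (leeD2r _ (mean_factorial_sum2 P_dpp mphi p0)).
rewrite -ge0_integralD//; last 4 first.
- by move=> X _; apply: esum_ge0 => t _; rewrite lee_fin mulr_ge0.
- under eq_fun do rewrite E.
  apply/measurable_EFinP; apply: measurable_funB => //.
  exact: measurable_funX.
- by move=> X _; rewrite lee_fin lsum_ge0.
- exact/measurable_EFinP.
by under [leRHS]eq_integral do rewrite E -EFinD subrK.
Qed.

(** In the second moment, the off-diagonal part is at most the squared mean. *)
Lemma variance_nonneg (phi : plane R -> R) (m : R) : measurable_fun setT phi ->
  (forall x, 0 <= phi x) -> local phi -> mass phi = m%:E ->
  (\int[P]_X ((lsum X phi - m) ^+ 2)%:E <= mass (fun x => phi x ^+ 2)%R)%E.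
Proof.
move=> mphi p0 pl massE.
have mT := measurable_lsum rho1 mphi p0 pl.
have m0 : 0 <= m.
  rewrite -lee_fin -massE; apply: integral_ge0 => x _.
  by rewrite lee_fin mulr_ge0 ?intensity_ge0.
have := second_moment_lsum mphi p0 pl; rewrite massE => H.
(* adding 2 m^2 leaves only nonnegative terms in the expansion of the square *)
suff : (\int[P]_X ((lsum X phi - m) ^+ 2)%:E + (2 * m * m)%:E <=
     mass (fun x => phi x ^+ 2)%R + (2 * m * m)%:E)%E by rewrite leeD2rE.
have I2 : (\int[P]_X (2 * m * lsum X phi)%:E = (2 * m * m)%:E)%E.
  under eq_integral do rewrite EFinM.
  rewrite ge0_integralZl//; last 3 first.
  - exact/measurable_EFinP.
  - by move=> X _; rewrite lee_fin lsum_ge0.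
  - by rewrite lee_fin mulr_ge0.
  by rewrite mean_lsum// massE.
have ms1 : measurable_fun setT (fun X : Conf R => ((lsum X phi - m) ^+ 2)%:E).
  apply/measurable_EFinP; apply: measurable_funX.
  exact: (measurable_funB mT (measurable_cst m)).
have ms2 : measurable_fun setT (fun X : Conf R => (2 * m * lsum X phi)%:E).
  apply/measurable_EFinP; exact: (measurable_funM (measurable_cst (2 * m)) mT).
have ms3 : measurable_fun setT (fun X : Conf R => (lsum X phi ^+ 2)%:E).
  by apply/measurable_EFinP; exact: measurable_funX.
have s1 X : setT X -> (0 <= ((lsum X phi - m) ^+ 2)%:E)%E by rewrite lee_fin sqr_ge0.
have s2 X : setT X -> (0 <= (2 * m * lsum X phi)%:E)%E.
  by move=> _; rewrite lee_fin mulr_ge0// ?lsum_ge0// mulr_ge0.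
have s3 X : setT X -> (0 <= (lsum X phi ^+ 2)%:E)%E by rewrite lee_fin sqr_ge0.
have s4 (X : Conf R) : setT X -> (0 <= (m ^+ 2)%:E)%E by rewrite lee_fin sqr_ge0.
rewrite -[X in (_ + X <= _)%E]I2 -(ge0_integralD P measurableT s1 ms1 s2 ms2).
under eq_integral => X _.
  rewrite -EFinD (_ : _ + _ = lsum X phi ^+ 2 + m ^+ 2); last by ring.
  rewrite EFinD.
  over.
rewrite (ge0_integralD P measurableT s3 ms3 s4 (measurable_cst _)).
have I4 : (\int[P]_(X in setT) (m ^+ 2)%:E = (m ^+ 2)%:E)%E.
  by rewrite integral_cst//= probability_setT mule1.
rewrite I4.
apply: le_trans (leeD2r _ H) _.
rewrite addeAC addeC (_ : (2 * m * m)%:E = ((m * m)%:E + (m ^+ 2)%:E)%E); last first.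
  by rewrite -EFinD; congr EFin; ring.
by rewrite -EFinM -addeA.
Qed.

Lemma lsum_ppart X (phi : plane R -> R) : lsum X phi =
  lsum X (fun x => ppart (phi x)) - lsum X (fun x => ppart (- phi x)).
Proof. by rewrite -lsumB; apply: eq_bigr => x _; rewrite ppartB. Qed.

(** The positive and negative parts are treated separately, which costs a factor
    2 by (a - b)^2 <= 2 a^2 + 2 b^2. *)
Lemma variance_lsum (phi : plane R -> R) (mp mn : R) :
  measurable_fun setT phi -> local phi ->
  mass (fun x => ppart (phi x)) = mp%:E ->
  mass (fun x => ppart (- phi x)) = mn%:E ->
  (\int[P]_X ((lsum X phi - (mp - mn)) ^+ 2)%:E
     <= 2%:E * mass (fun x => phi x ^+ 2)%R)%E.
Proof.
move=> mphi pl Ep En.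
have mpp : measurable_fun setT (fun x => ppart (phi x)).
  exact: (measurable_maxr mphi (measurable_cst (0:R))).
have mpn : measurable_fun setT (fun x => ppart (- phi x)).
  exact: (measurable_maxr (measurable_funN mphi) (measurable_cst (0:R))).
have lp : local (fun x => ppart (phi x)).
  by move=> x nx; rewrite pl// /ppart maxxx.
have ln : local (fun x => ppart (- phi x)).
  by move=> x nx; rewrite pl// oppr0 /ppart maxxx.
have Vp := variance_nonneg mpp (fun x => ppart_ge0 _) lp Ep.
have Vn := variance_nonneg mpn (fun x => ppart_ge0 _) ln En.
have Mp := measurable_lsum rho1 mpp (fun x => ppart_ge0 _) lp.
have Mn := measurable_lsum rho1 mpn (fun x => ppart_ge0 _) ln.
pose a X := lsum X (fun x => ppart (phi x)) - mp.
pose b X := lsum X (fun x => ppart (- phi x)) - mn.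
have Ma : measurable_fun setT (fun X : Conf R => (a X ^+ 2)%:E).
  apply/measurable_EFinP; apply: measurable_funX.
  exact: (measurable_funB Mp (measurable_cst mp)).
have Mb : measurable_fun setT (fun X : Conf R => (b X ^+ 2)%:E).
  apply/measurable_EFinP; apply: measurable_funX.
  exact: (measurable_funB Mn (measurable_cst mn)).
apply: (@le_trans _ _ (\int[P]_X (2%:E * ((a X ^+ 2)%:E + (b X ^+ 2)%:E)))%E).
  apply: le_integral_nomeas => X _; first by rewrite lee_fin sqr_ge0.
  rewrite -EFinD -EFinM lee_fin lsum_ppart.
  have -> : lsum X (fun x => ppart (phi x)) - lsum X (fun x => ppart (- phi x)) - (mp - mn)
    = a X - b X by rewrite /a /b; ring.
  by rewrite -subr_ge0 (_ : _ - _ = (a X + b X) ^+ 2) ?sqr_ge0//; ring.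
rewrite ge0_integralZl//; last 2 first.
- exact: emeasurable_funD.
- by move=> X _; rewrite -EFinD lee_fin addr_ge0 ?sqr_ge0.
rewrite lee_wpmul2l// ge0_integralD//; last 2 first.
- by move=> X _; rewrite lee_fin sqr_ge0.
- by move=> X _; rewrite lee_fin sqr_ge0.
apply: le_trans (leeD Vp Vn) _.
have mint (psi : plane R -> R) : measurable_fun setT psi ->
    measurable_fun (@disk R) (fun x => (psi x * intensity x)%:E).
  move=> mpsi; apply/measurable_EFinP; apply: measurable_funM.
    exact: measurable_funS mpsi.
  exact: measurable_intensity.
rewrite -ge0_integralD//; last 5 first.
- exact: measurable_disk.
- by move=> x _; rewrite lee_fin mulr_ge0 ?sqr_ge0// intensity_ge0.
- by apply: mint; exact: measurable_funX.
- by move=> x _; rewrite lee_fin mulr_ge0 ?sqr_ge0// intensity_ge0.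
- by apply: mint; exact: measurable_funX.
apply: le_integral_nomeas => x _.
  by rewrite -EFinD lee_fin addr_ge0// mulr_ge0 ?sqr_ge0// intensity_ge0.
by rewrite -EFinD lee_fin -mulrDl ppart_sqr.
Qed.

End Variance.

(** * The Poincare distance *)

Section PoincareProfile.
Variable R : realType.
Implicit Types (x z : plane R).

(** The Poincare distance in terms of the squared pseudohyperbolic distance. *)
Definition pdist (t : R) : R := ln ((1 + Num.sqrt t) / (1 - Num.sqrt t)).

Lemma normc_sqr (w : R[i]) :
  Normc.normc w ^+ 2 = complex.Re w ^+ 2 + complex.Im w ^+ 2.
Proof. by case: w => a b /=; rewrite sqr_sqrtr// addr_ge0 ?sqr_ge0. Qed.

Lemma normc_nonneg (w : R[i]) : 0 <= Normc.normc w.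
Proof. by case: w => a b /=; exact: sqrtr_ge0. Qed.

Lemma normc_mobius z x : sqmod z < 1 -> sqmod x < 1 ->
  Normc.normc (mobius z x) = Num.sqrt (pdist2 z x).
Proof.
move=> z1 x1; rewrite pdist2E// defectE//.
have E : Normc.normc (mobius z x) ^+ 2 =
    ((x.1 - z.1) ^+ 2 + (x.2 - z.2) ^+ 2) / moebius_den z x.
  rewrite /mobius Normc.normcM exprMn Normc.normcV exprVn !normc_sqr /cplx/=.
  by congr (_ / _); rewrite /moebius_den; ring.
by rewrite -E sqrtr_sqr ger0_norm// normc_nonneg.
Qed.

Lemma poincare_distE z x : sqmod z < 1 -> sqmod x < 1 ->
  poincare_dist z x = pdist (pdist2 z x).
Proof. by move=> z1 x1; rewrite /poincare_dist normc_mobius. Qed.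

Lemma pdist2_sym z x : sqmod z < 1 -> sqmod x < 1 -> pdist2 z x = pdist2 x z.
Proof.
move=> z1 x1; rewrite !pdist2E// !defectE//; congr (_ / _); first by ring.
by rewrite /moebius_den; ring.
Qed.

Lemma poincare_dist_sym z x : sqmod z < 1 -> sqmod x < 1 ->
  poincare_dist z x = poincare_dist x z.
Proof. by move=> z1 x1; rewrite !poincare_distE// pdist2_sym. Qed.

Lemma pdist2_ge0 z x : sqmod z < 1 -> sqmod x < 1 -> 0 <= pdist2 z x.
Proof. by move=> z1 x1; rewrite pdist2E// subr_ge0 defect_le1. Qed.

Lemma pdist2_lt1 z x : sqmod z < 1 -> sqmod x < 1 -> pdist2 z x < 1.
Proof. by move=> z1 x1; rewrite pdist2E// ltrBlDr ltrDl defect_gt0. Qed.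

Lemma sqrt_pdist_bounds (t : R) : 0 <= t -> t < 1 ->
  (1 - t) / 4 <= (1 - Num.sqrt t) / (1 + Num.sqrt t) <= 1 - t.
Proof.
move=> t0 t1.
have r0 := sqrtr_ge0 t; have rr := sqr_sqrtr t0.
set r := Num.sqrt t in r0 rr *; rewrite -rr.
have r1 : r < 1 by rewrite -(@ltr_sqr _ r 1) ?nnegrE// expr1n rr.
have p : 0 < 1 + r by lra.
have -> : (1 - r) / (1 + r) = (1 - r ^+ 2) / (1 + r) ^+ 2 by field; rewrite gt_eqF.
have q : 0 < 1 - r ^+ 2 by rewrite rr; lra.
apply/andP; split.
  rewrite ler_pM2l// lef_pV2 ?posrE ?exprn_gt0//.
  have -> : 4 = 2 ^+ 2 :> R by ring.
  by rewrite ler_sqr ?nnegrE; lra.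
rewrite ler_pdivrMr ?exprn_gt0// ler_peMr ?(ltW q)// exprn_ege1//; lra.
Qed.

Lemma expR_pdist (t : R) : 0 <= t -> t < 1 ->
  expR (- pdist t) = (1 - Num.sqrt t) / (1 + Num.sqrt t).
Proof.
move=> t0 t1.
have r0 := sqrtr_ge0 t.
have r1 : Num.sqrt t < 1 by rewrite -[ltRHS]sqrtr1 ltr_sqrt.
rewrite expRN /pdist lnK; first by rewrite invf_div.
by rewrite posrE divr_gt0//; lra.
Qed.

(** With r^2 = t, exp (- d) = (1 - r) / (1 + r) = (1 - t) / (1 + r)^2. *)
Lemma expR_pdist_bounds (t : R) : 0 <= t -> t < 1 ->
  (1 - t) / 4 <= expR (- pdist t) <= 1 - t.
Proof. by move=> t0 t1; rewrite expR_pdist// sqrt_pdist_bounds. Qed.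

Lemma pdist_ge0 (t : R) : 0 <= t -> t < 1 -> 0 <= pdist t.
Proof.
move=> t0 t1; rewrite -oppr_le0 -expR_le1.
have /andP[_ h] := expR_pdist_bounds t0 t1.
by rewrite (le_trans h)// lerBlDr lerDl.
Qed.

(** A ball for the Poincare distance lies in a pseudohyperbolic disk of squared
    radius less than 1. *)
Lemma pdist_lt (t b : R) : 0 <= t -> t < 1 -> pdist t < b ->
  t < 1 - expR (- b).
Proof.
move=> t0 t1 tb; have /andP[_ h] := expR_pdist_bounds t0 t1.
have : expR (- b) < expR (- pdist t) by rewrite ltr_expR ltrN2.
lra.
Qed.

Lemma measurable_sqrt : measurable_fun setT (@Num.sqrt R).
Proof.
apply: continuous_measurable_fun; exact: sqrt_continuous.
Qed.

Lemma measurable_inv : measurable_fun setT (fun t : R => t^-1).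
Proof.
(* the identity also holds at 0, where both sides vanish *)
have -> : (fun t : R => t^-1) = (fun t => t * (t ^+ 2) `^ (-1)).
  apply/funext => t; rewrite powR_inv1 ?sqr_ge0//.
  have [->|t0] := eqVneq t 0; first by rewrite invr0 mul0r.
  by rewrite expr2 invfM mulrA divff// mul1r.
apply: measurable_funM => //.
by apply: (measurableT_comp (measurable_powR _)); exact: measurable_funX.
Qed.

Lemma measurable_pdist : measurable_fun setT pdist.
Proof.
apply: (measurableT_comp (@measurable_ln R)); apply: measurable_funM.
  by apply: measurable_funD => //; exact: measurable_sqrt.
apply: (measurableT_comp measurable_inv).
by apply: measurable_funB => //; exact: measurable_sqrt.
Qed.

Definition annular_weight (s a b t : R) : R :=
  if (a <= pdist t) && (pdist t < b) then expR (- s * pdist t) else 0.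

Lemma annular_weight_ge0 s a b t : 0 <= annular_weight s a b t.
Proof. by rewrite /annular_weight; case: ifPn => // _; exact: expR_ge0. Qed.

Lemma measurable_annular_weight s a b :
  measurable_fun setT (annular_weight s a b).
Proof.
apply: measurable_fun_ifT; last exact: measurable_cst.
- apply: measurable_and.
    by apply: measurable_fun_ler => //; exact: measurable_pdist.
  by apply: measurable_fun_ltr => //; exact: measurable_pdist.
- apply: (measurableT_comp (@measurable_expR R)).
  by apply: measurable_funM => //; exact: measurable_pdist.
Qed.

Lemma annular_weight_add s a b c t : a <= b -> b <= c ->
  annular_weight s a c t = annular_weight s a b t + annular_weight s b c t.
Proof.
move=> ab bc; rewrite /annular_weight.
have [ta|ta] /= := leP a (pdist t); last first.
  by rewrite leNgt (lt_le_trans ta ab)/= addr0.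
have [tb|tb] /= := leP b (pdist t); first by rewrite add0r.
by rewrite (lt_le_trans tb bc) addr0.
Qed.

Lemma annular_weight_eq0 s a b t : 0 <= t -> t < 1 -> 1 - expR (- b) <= t ->
  annular_weight s a b t = 0.
Proof.
move=> t0 t1 tb; rewrite /annular_weight; case: ifPn => // /andP[_ h].
by have := pdist_lt t0 t1 h; rewrite ltNge tb.
Qed.

End PoincareProfile.

(** * Radial weights and hyperbolic area *)

Section RadialMass.
Variable R : realType.
Implicit Types (x z : plane R).

Local Notation lam := (@lebesgue_measure R).
Local Notation lam2 := (lam \x lam)%E.

Lemma integral_dA (D : set (plane R)) (f : plane R -> \bar R) : measurable D ->
  measurable_fun D f -> (forall x, D x -> 0 <= f x)%E ->
  (\int[@dA R]_(x in D) f x = (pi : R)^-1%:E * \int[lam2]_(x in D) f x)%E.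
Proof. by move=> mD mf f0; rewrite /dA ge0_integral_mscale. Qed.

Variable z : plane R.
Hypothesis z1 : sqmod z < 1.

(** The density 3 kappa of [integral_pball] for h = 1, in the normalized area. *)
Definition mass_const : R := 3 * moment_const z (fun=> 1) / pi.

Lemma mass_const_gt0 : 0 < mass_const.
Proof.
by rewrite /mass_const divr_gt0 ?pi_gt0// mulr_gt0// moment_const1_gt0.
Qed.

(** In terms of t = |phi_z(x)|^2, the hyperbolic area density is the Jacobian
    divided by (1 - t)^2. *)
Lemma mass_radial (h : plane R -> R) (c0 : R) (V : R -> R) :
  real_harmonic_on (@disk R) h -> 0 < c0 -> c0 <= 1 ->
  (forall x, pball z c0 x -> 0 <= h x) ->
  (forall t, 0 <= V t) -> measurable_fun setT V ->
  (forall t, 0 <= t -> t < 1 -> c0 <= t -> V t = 0) ->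
  (\int[@dA R]_(x in @disk R) (h x * V (pdist2 z x) * intensity x)%:E =
   (mass_const * h z)%:E * \int[lam]_(t in `[0%R, c0[) (V t / (1 - t) ^+ 2)%:E)%E.
Proof.
move=> hh c00 c01 h0 V0 mV Vc.
pose W t := (V t / (1 - t) ^+ 2)%:E.
have W0 t : (0 <= W t)%E by rewrite lee_fin divr_ge0// sqr_ge0.
have mW : measurable_fun setT W.
  apply/measurable_EFinP; apply: measurable_funM => //.
  apply: (measurableT_comp (@measurable_inv R)); apply: measurable_funX.
  exact: measurable_funB.
have Voff x : disk x -> ~ pball z c0 x -> V (pdist2 z x) = 0.
  move=> /diskE x1 nx; apply: Vc; [exact: pdist2_ge0|exact: pdist2_lt1|].
  by move: nx; rewrite /pball/= pdist2E// => /negP; rewrite -leNgt; lra.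
have f0 x : disk x -> (0 <= (h x * V (pdist2 z x) * intensity x)%:E)%E.
  move=> dx; rewrite lee_fin; have [px|nx] := pselect (pball z c0 x); last first.
    by rewrite Voff// mulr0 mul0r.
  by rewrite mulr_ge0 ?intensity_ge0// mulr_ge0// h0.
have mh : measurable_fun (@disk R) h.
  apply: continuous_plane_measurable; first exact: open_disk.
  by move=> x /diskE; exact: harmonic_continuous.
have mp : measurable_fun setT (pdist2 z) by exact: measurable_pdist2.
rewrite integral_dA//; last 2 first.
- exact: measurable_disk.
- apply/measurable_EFinP; apply: measurable_funM; last exact: measurable_intensity.
  apply: measurable_funM => //; apply: measurable_funTS.
  exact: measurableT_comp.
have -> : (\int[lam2]_(x in @disk R) (h x * V (pdist2 z x) * intensity x)%:E =
    \int[lam2]_(x in pball z c0) (W (pdist2 z x) * (h x * moebius_jac z x)%:E))%E.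
  rewrite [LHS]integral_mkcond [RHS]integral_mkcond; apply: eq_integral => x _.
  rewrite !patchE; have [px|nx] := pselect (pball z c0 x); last first.
    rewrite [in RHS]memNset//; case: ifPn => //; rewrite inE => dx.
    by rewrite Voff// mulr0 mul0r.
  have x1 := pball_disk z1 c01 px.
  rewrite mem_set; last exact/diskE.
  rewrite mem_set// -EFinM; congr EFin.
  have E : intensity x = moebius_jac z x / (1 - pdist2 z x) ^+ 2.
    rewrite pdist2E// subKr /intensity /moebius_jac /defect.
    have d0 := den_neq0 z1 x1.
    have a0 : 1 - sqmod z != 0 by rewrite subr_eq0 gt_eqF.
    have b0 : 1 - sqmod x != 0 by rewrite subr_eq0 gt_eqF.
    by move: d0 a0 b0; move: (moebius_den z x) (1 - sqmod z) (1 - sqmod x)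
      => d a b d0 a0 b0; field; rewrite d0 a0 b0.
  by rewrite E; ring.
rewrite (radial_formula z1 hh c00 c01 h0 W0 mW) muleA -EFinM.
by congr (_%:E * _)%E; rewrite /mass_const; ring.
Qed.

Lemma harmonic_same_derive (h k : plane R -> R) :
  'D_(1, 0) k = 'D_(1, 0) h -> 'D_(0, 1) k = 'D_(0, 1) h ->
  (forall x v, derivable h x v -> derivable k x v) ->
  real_harmonic_on (@disk R) h -> real_harmonic_on (@disk R) k.
Proof.
move=> E1 E2 dk [[c0 c1 c2] lap]; split; last first.
  move=> x dx.
  have e1 := congr1 (fun u : plane R -> R => 'D_(1, 0) u x) E1.
  have e2 := congr1 (fun u : plane R -> R => 'D_(0, 1) u x) E2.
  exact: etrans (congr2 +%R e1 e2) (lap x dx).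
split; [|exact: (eq_ind_r (C1_on (@disk R)) c1 E1)
        |exact: (eq_ind_r (C1_on (@disk R)) c2 E2)].
move=> x e dx ae; have [d0 k0] := c0 x e dx ae; split; first exact: dk.
pose cont (u : plane R -> R) := {for x, continuous u}.
case: ae d0 k0 => -> d0 k0.
  exact: (eq_ind_r cont k0 E1).
exact: (eq_ind_r cont k0 E2).
Qed.

(** Adding a constant makes a locally bounded function nonnegative, as required by
    [mass_radial]. *)
Lemma harmonic_addc (h : plane R -> R) (B : R) : real_harmonic_on (@disk R) h ->
  real_harmonic_on (@disk R) (fun x => h x + B).
Proof.
have Q (x v : plane R) : (fun k : R => k^-1 *: (((fun x => h x + B) \o shift x) (k *: v)
     - (h x + B))) = (fun k : R => k^-1 *: ((h \o shift x) (k *: v) - h x)).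
  by apply/funext => k /=; congr (_ *: _); ring.
apply: harmonic_same_derive.
- by apply/funext => x; rewrite /derive Q.
- by apply/funext => x; rewrite /derive Q.
- by move=> x v; rewrite /derivable Q.
Qed.

Lemma pball_local c : c < 1 -> exists2 rho, rho < 1 & pball z c `<=` subdisk rho.
Proof.
move=> c1; have [rho r1 H] := cutoff_outside z1 c1.
exists rho => // x px; rewrite /subdisk/= leNgt; apply/negP => /H.
rewrite /cutoff /ppart => E; have : defect z x - (1 - c) <= 0.
  by rewrite -E le_max lexx.
by move: px; rewrite /pball/=; lra.
Qed.

Lemma harmonic_bounded (h : plane R -> R) rho : real_harmonic_on (@disk R) h ->
  rho < 1 -> exists2 B, 0 <= B & forall x, subdisk rho x -> `|h x| <= B.
Proof.
move=> hh r1.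
have cs : {within subdisk rho, continuous h}.
  apply: continuous_in_subspaceT => x; rewrite inE => xr.
  by apply: harmonic_continuous => //; exact: le_lt_trans r1.
have [M [_ Mf]] := compact_bounded (continuous_compact cs (compact_subdisk r1)).
exists (`|M| + 1); first by rewrite addr_ge0.
move=> x xr; apply: (Mf (`|M| + 1)); first by rewrite ltr_pwDr// ler_norm.
by exists x.
Qed.

End RadialMass.

(** * Means of annular sums *)

Section WeightedStatistic.
Variable R : realType.
Implicit Types (x z : plane R) (h : plane R -> R).

Local Notation "'mass' phi" := (\int[@dA R]_(x in @disk R) (phi x * intensity x)%:E)%E
  (at level 10, phi at level 8).

Definition annular_term h s a b z : plane R -> R :=
  (fun x => h x * annular_weight s a b (pdist2 z x)) \_ (@disk R).

Definition annular_mass s a b z : R := fine (mass (annular_term (fun=> 1) s a b z)).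

Lemma annular_termE h s a b z x : disk x ->
  annular_term h s a b z x = h x * annular_weight s a b (pdist2 z x).
Proof. by move=> dx; rewrite /annular_term patchE mem_set. Qed.

Lemma annular_term_out h s a b z x : ~ disk x -> annular_term h s a b z x = 0.
Proof. by move=> dx; rewrite /annular_term patchE memNset. Qed.

Lemma dA_square_finite : (@dA R (@square R) < +oo)%E.
Proof.
rewrite /dA/= /mscale/= lte_mul_pinfty//; first by rewrite lee_fin invr_ge0 pi_ge0.
exact: square_finite.
Qed.

(** The intensity is bounded on a compact subdisk. *)
Lemma mass_finite rho B (phi : plane R -> R) : rho < 1 -> measurable_fun setT phi ->
  (forall x, 0 <= phi x) -> local rho phi -> (forall x, disk x -> phi x <= B) ->
  (mass phi < +oo)%E.
Proof.
move=> r1 mphi p0 pl pB.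
have r10 : 0 < 1 - rho by rewrite subr_gt0.
apply: (@le_lt_trans _ _ (\int[@dA R]_(x in @square R) (`|B| * ((1 - rho) ^+ 2)^-1)%:E)%E).
  rewrite [X in (X <= _)%E]integral_mkcond [leRHS]integral_mkcond.
  apply: le_integral_nomeas => x _; rewrite !patchE.
    by case: ifPn => // _; rewrite lee_fin mulr_ge0 ?intensity_ge0.
  have rhs0 : 0 <= `|B| * ((1 - rho) ^+ 2)^-1 by rewrite mulr_ge0// invr_ge0 sqr_ge0.
  case: ifPn => [|_]; last by case: ifPn => // _; rewrite lee_fin.
  rewrite inE => dx; have [xr|nx] := pselect (subdisk rho x); last first.
    by rewrite pl// mul0r; case: ifPn => // _; rewrite lee_fin.
  have sx : square x.
    apply: contrapT => /notin_square; move/diskE: dx => x1.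
    by rewrite leNgt x1.
  rewrite mem_set// lee_fin ler_pM ?intensity_ge0//.
    exact: le_trans (pB _ dx) (ler_norm _).
  rewrite /intensity; move/diskE: dx => x1.
  rewrite lef_pV2 ?posrE ?exprn_gt0 ?subr_gt0//.
  rewrite ler_sqr ?nnegrE ?subr_ge0 ?(ltW r1) ?(ltW x1)//.
  by move: xr; rewrite /subdisk/=; lra.
rewrite integral_cst//=; last exact: square_measurable.
rewrite lte_mul_pinfty//; first by rewrite lee_fin mulr_ge0// invr_ge0 sqr_ge0.
exact: dA_square_finite.
Qed.

Section FixedCenter.
Variables (h : plane R -> R) (s a b : R) (z : plane R).
Hypothesis hh : real_harmonic_on (@disk R) h.
Hypothesis s0 : 0 <= s.
Hypothesis b0 : 0 < b.
Hypothesis z1 : sqmod z < 1.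

Let c0 := 1 - expR (- b).

Let c00 : 0 < c0.
Proof. by rewrite subr_gt0 expR_lt1 oppr_lt0. Qed.
Let c01 : c0 < 1.
Proof. by rewrite ltrBlDr ltrDl expR_gt0. Qed.

Local Notation phi := (annular_term h s a b z).
Local Notation w x := (annular_weight s a b (pdist2 z x)).

Lemma measurable_harmonic : measurable_fun (@disk R) h.
Proof.
apply: continuous_plane_measurable; first exact: open_disk.
by move=> x /diskE; exact: harmonic_continuous.
Qed.

Lemma measurable_radial_weight : measurable_fun setT (fun x => w x).
Proof.
exact: (measurableT_comp (measurable_annular_weight _ _ _) (measurable_pdist2 z1)).
Qed.

Lemma measurable_annular_term : measurable_fun setT phi.
Proof.
apply/(measurable_restrictT _ (@measurable_disk R)).
apply: measurable_funM; first exact: measurable_harmonic.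
by apply: measurable_funTS; exact: measurable_radial_weight.
Qed.

Lemma radial_weight_off x : disk x -> ~ pball z c0 x -> w x = 0.
Proof.
move=> /diskE x1 nx; apply: annular_weight_eq0; [exact: pdist2_ge0|exact: pdist2_lt1|].
by move: nx; rewrite /pball/= pdist2E// => /negP; rewrite -leNgt -/c0; lra.
Qed.

Lemma radial_weight_le1 x : disk x -> w x <= 1.
Proof.
move=> /diskE x1; rewrite /annular_weight; case: ifPn => // _.
rewrite expR_le1 mulNr oppr_le0 mulr_ge0// pdist_ge0//;
  [exact: pdist2_ge0|exact: pdist2_lt1].
Qed.

Lemma annular_term_local : exists2 rho, rho < 1 & local rho phi /\
  pball z c0 `<=` subdisk rho.
Proof.
have [rho r1 H] := pball_local z1 c01; exists rho => //; split => // x nx.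
have [dx|dx] := pselect (disk x); last exact: annular_term_out.
rewrite annular_termE// radial_weight_off ?mulr0//.
by move=> /H.
Qed.

Lemma mass_harmonic_weight (k : plane R -> R) : real_harmonic_on (@disk R) k ->
  (forall x, pball z c0 x -> 0 <= k x) ->
  (\int[@dA R]_(x in @disk R) (k x * w x * intensity x)%:E =
   (mass_const z * k z)%:E *
   \int[@lebesgue_measure R]_(t in `[0%R, c0[)
      (annular_weight s a b t / (1 - t) ^+ 2)%:E)%E.
Proof.
move=> hk k0; apply: mass_radial => //.
- exact: ltW.
- exact: annular_weight_ge0.
- exact: measurable_annular_weight.
- by move=> t t0 t1; exact: annular_weight_eq0.
Qed.

Lemma mass_term_finite (psi : plane R -> R) : measurable_fun setT psi ->
  (forall x, 0 <= psi x) -> (forall x, psi x <= `|phi x|) -> (mass psi < +oo)%E.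
Proof.
move=> mpsi p0 pp; have [rho r1 [pl pb]] := annular_term_local.
have [B B0 hB] := harmonic_bounded hh r1.
apply: (mass_finite (rho := rho) (B := B)) => //.
- by move=> x nx; apply/eqP; rewrite eq_le p0 andbT (le_trans (pp x))// pl// normr0.
- move=> x dx; apply: le_trans (pp x) _.
  rewrite annular_termE// normrM (ger0_norm (annular_weight_ge0 _ _ _ _)).
  have [px|nx] := pselect (pball z c0 x); last by rewrite radial_weight_off// mulr0.
  rewrite -[leRHS]mulr1 ler_pM ?annular_weight_ge0 ?radial_weight_le1//.
  by apply: hB; exact: pb.
Qed.

End FixedCenter.

Section MeanValueProperty.
Variables (h : plane R -> R) (s a b : R) (z : plane R).
Hypothesis hh : real_harmonic_on (@disk R) h.
Hypothesis s0 : 0 <= s.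
Hypothesis b0 : 0 < b.
Hypothesis z1 : sqmod z < 1.
Local Notation phi := (annular_term h s a b z).
Local Notation one := (annular_term (fun=> 1) s a b z).
Local Notation w x := (annular_weight s a b (pdist2 z x)).
Let c0 := 1 - expR (- b).

Lemma annular_massE : mass one = (annular_mass s a b z)%:E.
Proof.
have h1 := @harmonic_cst R 1.
rewrite /annular_mass fineK// ge0_fin_numE; last first.
  apply: integral_ge0 => x dx.
  by rewrite lee_fin annular_termE// mul1r mulr_ge0 ?annular_weight_ge0 ?intensity_ge0.
apply: (mass_term_finite h1 s0 z1 (a := a)).
- exact: measurable_annular_term.
- move=> x; have [dx|dx] := pselect (disk x); last by rewrite annular_term_out.
  by rewrite annular_termE// mul1r annular_weight_ge0.
- by move=> x; exact: ler_norm.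
Qed.

(** Of a harmonic function, a radial weight sees only the value at the center.
    The masses of the two parts are finite, but only their difference has a
    closed form. *)
Lemma annular_mean_value : exists mp mn : R,
  [/\ mass (fun x => ppart (phi x)) = mp%:E,
      mass (fun x => ppart (- phi x)) = mn%:E &
      mp - mn = h z * annular_mass s a b z].
Proof.
have h1 := @harmonic_cst R 1.
have mphi : measurable_fun setT phi by exact: measurable_annular_term.
have mone : measurable_fun setT one by exact: measurable_annular_term.
have mpp : measurable_fun setT (fun x => ppart (phi x)).
  exact: (measurable_maxr mphi (measurable_cst (0:R))).
have mpn : measurable_fun setT (fun x => ppart (- phi x)).
  exact: (measurable_maxr (measurable_funN mphi) (measurable_cst (0:R))).
have fin (psi : plane R -> R) : measurable_fun setT psi ->
    (forall x, 0 <= psi x) -> (forall x, psi x <= `|phi x|) ->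
    mass psi = (fine (mass psi))%:E.
  move=> mpsi psi0 psile; rewrite fineK// ge0_fin_numE; last first.
    by apply: integral_ge0 => x _; rewrite lee_fin mulr_ge0 ?intensity_ge0.
  exact: mass_term_finite psile.
have pple (t : R) : ppart t <= `|t|.
  by rewrite /ppart ge_max ler_norm normr_ge0.
exists (fine (mass (fun x => ppart (phi x)))), (fine (mass (fun x => ppart (- phi x)))).
have Ep := fin _ mpp (fun x => ppart_ge0 _) (fun x => pple _).
have En := fin _ mpn (fun x => ppart_ge0 _)
  (fun x => ltac:(by rewrite -[leRHS]normrN)).
split => //.
have [rho r1 [pl pb]] := annular_term_local h s a b z1.
have [B B0 hB] := harmonic_bounded hh r1.
set A := annular_mass s a b z.
have hBpos x : pball z c0 x -> 0 <= h x + B.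
  by move=> /pb /hB; rewrite ler_norml; lra.
have I1 := mass_harmonic_weight s a b0 z1 h1 (fun x _ => ler01).
have I2 := mass_harmonic_weight s a b0 z1 (harmonic_addc B hh) hBpos.
have A1 : mass one = (\int[@dA R]_(x in @disk R) (1 * w x * intensity x)%:E)%E.
  by apply: eq_integral => x; rewrite inE => dx; rewrite annular_termE.
have I2' : (\int[@dA R]_(x in @disk R) ((h x + B) * w x * intensity x)%:E =
    ((h z + B) * A)%:E)%E.
  move: I1; rewrite -A1 annular_massE -/A mulr1 => I1.
  by rewrite I2 [RHS]EFinM I1 muleA -EFinM mulrC.
(* integrate phi^+ + B w = phi^- + (h + B) w, where every term is nonnegative *)
have H : (mass (fun x => ppart (phi x)) + (B * A)%:E =
    mass (fun x => ppart (- phi x)) + ((h z + B) * A)%:E)%E.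
  have md := @measurable_disk R.
  have mw : measurable_fun (@disk R) (fun x => w x * intensity x).
    apply: measurable_funM; last exact: measurable_intensity.
    by apply: measurable_funTS; exact: measurable_radial_weight.
  have mh := measurable_harmonic hh.
  have mB : measurable_fun (@disk R) (fun x => (B * (w x * intensity x))%:E).
    by apply/measurable_EFinP; apply: measurable_funM.
  have mhB : measurable_fun (@disk R) (fun x => ((h x + B) * w x * intensity x)%:E).
    apply/measurable_EFinP; under eq_fun do rewrite -mulrA.
    by apply: measurable_funM => //; exact: measurable_funD.
  have mint (psi : plane R -> R) : measurable_fun setT psi ->
      measurable_fun (@disk R) (fun x => (psi x * intensity x)%:E).
    move=> mpsi; apply/measurable_EFinP; apply: measurable_funM.
      exact: measurable_funS mpsi.
    exact: measurable_intensity.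
  have wk0 x : 0 <= w x * intensity x.
    by rewrite mulr_ge0 ?annular_weight_ge0 ?intensity_ge0.
  have EB : (\int[@dA R]_(x in @disk R) (B * (w x * intensity x))%:E = (B * A)%:E)%E.
    under eq_integral do rewrite EFinM.
    rewrite ge0_integralZl//; last by move=> x _; rewrite lee_fin.
      rewrite EFinM; congr (_ * _)%E; rewrite -annular_massE A1.
      by apply: eq_integral => x _; rewrite mul1r.
    by apply/measurable_EFinP.
  rewrite -EB -I2'.
  rewrite -[LHS](ge0_integralD _ md _ (mint _ mpp) _ mB); last 2 first.
  - by move=> x _; rewrite lee_fin mulr_ge0 ?ppart_ge0 ?intensity_ge0.
  - by move=> x _; rewrite lee_fin mulr_ge0.
  rewrite -[RHS](ge0_integralD _ md _ (mint _ mpn) _ mhB); last 2 first.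
  - by move=> x _; rewrite lee_fin mulr_ge0 ?ppart_ge0 ?intensity_ge0.
  - move=> x dx; rewrite lee_fin -mulrA.
    have [px|nx] := pselect (pball z c0 x); last first.
      by rewrite radial_weight_off// mul0r mulr0.
    by rewrite mulr_ge0 ?hBpos.
  apply: eq_integral => x; rewrite inE => dx; rewrite -!EFinD; congr EFin.
  rewrite annular_termE//.
  have := ppartB (h x * w x); set p := ppart _; set n := ppart _ => E.
  have -> : p = n + h x * w x by rewrite -E; ring.
  by ring.
move: H; rewrite Ep En -!EFinD => -[]; lra.
Qed.

End MeanValueProperty.
End WeightedStatistic.

(** * Variances of annular sums *)

Section RealStatistic.
Variable R : realType.
Implicit Types (x z : plane R) (h phi : plane R -> R) (X : configuration R).

Local Notation "'mass' phi" := (\int[@dA R]_(x in @disk R) (phi x * intensity x)%:E)%E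
  (at level 10, phi at level 8).

(** For local functions both sums are finite, see [rstatE]. *)
Definition rstat X phi : R :=
  fine (linstat X (fun x => (ppart (phi x))%:E)) -
  fine (linstat X (fun x => (ppart (- phi x))%:E)).

Lemma rstatE rho X phi : rho < 1 -> local rho phi -> rstat X phi = lsum rho X phi.
Proof.
move=> r1 pl; rewrite /rstat !(linstat_lsum r1)/= -?lsum_ppart//.
- by move=> x; exact: ppart_ge0.
- by move=> x nx; rewrite pl// oppr0 /ppart maxxx.
- by move=> x; exact: ppart_ge0.
- by move=> x nx; rewrite pl// /ppart maxxx.
Qed.

Section Variance.
Variable P : probability (Conf R) R.
Hypothesis P_dpp : determinantal_process P (@bergman_kernel R).
Variables (h : plane R -> R) (s a b : R) (z : plane R).
Hypothesis hh : real_harmonic_on (@disk R) h.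
Hypothesis s0 : 0 <= s.
Hypothesis b0 : 0 < b.
Hypothesis z1 : sqmod z < 1.

Lemma variance_annular :
  (\int[P]_X ((rstat X (annular_term h s a b z) - h z * annular_mass s a b z) ^+ 2)%:E
   <= 2%:E * mass (fun x => annular_term h s a b z x ^+ 2)%R)%E.
Proof.
have [mp [mn [Ep En <-]]] := annular_mean_value a hh s0 b0 z1.
have [rho r1 [pl _]] := annular_term_local h s a b z1.
have mphi := measurable_annular_term s a b hh z1.
have := variance_lsum P_dpp r1 mphi pl Ep En.
by under eq_integral do rewrite -(rstatE _ r1 pl).
Qed.

End Variance.

(** The factor by which 1 - |phi_z(x)|^2 can exceed 1 - |x|^2. *)
Definition distortion z : R := 4 / (1 - sqmod z).

Lemma defect_le z x : sqmod z < 1 -> sqmod x < 1 ->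
  defect z x <= distortion z * (1 - sqmod x).
Proof.
move=> z1 x1; rewrite /defect ler_pdivrMr ?moebius_den_gt0//.
have l := moebius_den_lb z1 x1.
have p : 0 <= distortion z * (1 - sqmod x).
  by rewrite mulr_ge0 ?divr_ge0 ?subr_ge0 ?ltW.
apply: le_trans (ler_wpM2l p l); rewrite le_eqVlt; apply/orP; left; apply/eqP.
by rewrite /distortion; field; rewrite subr_eq0 gt_eqF.
Qed.

Lemma expR_poincare_le (al : R) z x : 0 <= al -> sqmod z < 1 -> sqmod x < 1 ->
  expR (- al * pdist (pdist2 z x)) * intensity x <=
  distortion z `^ al * (1 - sqmod x) `^ (al - 2).
Proof.
move=> a0 z1 x1.
have t0 := pdist2_ge0 z1 x1; have t1 := pdist2_lt1 z1 x1.
have /andP[_ h1] := expR_pdist_bounds t0 t1.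
have p0 : 0 < 1 - sqmod x by rewrite subr_gt0.
have d0 : 0 <= distortion z by rewrite divr_ge0// subr_ge0 ltW.
have -> : (1 - sqmod x) `^ (al - 2) = (1 - sqmod x) `^ al * intensity x.
  rewrite powRD; last by rewrite (gt_eqF p0) implybT.
  by rewrite powRN powR_mulrn// ltW.
rewrite mulrA ler_wpM2r ?intensity_ge0// -powRM ?(ltW p0)//.
rewrite mulNr -mulrN mulrC expRM.
apply: ge0_ler_powR; rewrite ?nnegrE ?expR_ge0//.
  exact: mulr_ge0 d0 (ltW p0).
apply: (le_trans h1); apply: le_trans (defect_le z1 x1).
by rewrite pdist2E// subKr.
Qed.

Definition wnorm h (al : R) : \bar R :=
  (\int[@dA R]_(w in @disk R) (h w ^+ 2 * (1 - sqmod w) `^ al)%:E)%E.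

Lemma measurable_wnorm_integrand h al : real_harmonic_on (@disk R) h ->
  measurable_fun (@disk R) (fun w => (h w ^+ 2 * (1 - sqmod w) `^ al)%:E).
Proof.
move=> hh; apply/measurable_EFinP; apply: measurable_funM.
  by apply: measurable_funX; exact: measurable_harmonic.
apply: (measurableT_comp (measurable_powR al)).
apply: measurable_funB => //.
apply: continuous_plane_measurable; first exact: open_disk.
by move=> x _; exact: continuous_sqmod.
Qed.

Lemma wnorm_ge0 h al : (0 <= wnorm h al)%E.
Proof. by apply: integral_ge0 => x _; rewrite lee_fin mulr_ge0 ?sqr_ge0 ?powR_ge0. Qed.

(** The squared weight exp (- 2 s d) is at most a multiple of (1 - |x|^2)^(2 s), and
    the intensity takes away two powers. *)
Lemma mass_sq_annular_le h s a b z : real_harmonic_on (@disk R) h ->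
  0 <= s -> sqmod z < 1 ->
  (mass (fun x => annular_term h s a b z x ^+ 2)%R <=
   (distortion z `^ (2 * s))%:E * wnorm h (2 * s - 2))%E.
Proof.
move=> hh s0 z1.
rewrite -ge0_integralZl//; last 4 first.
- exact: measurable_disk.
- exact: measurable_wnorm_integrand.
- by move=> x _; rewrite lee_fin mulr_ge0 ?sqr_ge0 ?powR_ge0.
- by rewrite lee_fin powR_ge0.
apply: le_integral_nomeas => x dx.
  by rewrite lee_fin mulr_ge0 ?sqr_ge0 ?intensity_ge0.
have /diskE x1 := dx.
rewrite -EFinM lee_fin annular_termE// exprMn -mulrA [leRHS]mulrCA.
rewrite ler_wpM2l ?sqr_ge0//.
have s20 : 0 <= 2 * s by rewrite mulr_ge0.
apply: le_trans (expR_poincare_le s20 z1 x1).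
rewrite ler_wpM2r ?intensity_ge0// /annular_weight; case: ifPn => _.
  by rewrite -expRM_natl mulrA -mulrN.
by rewrite expr0n expR_ge0.
Qed.

(** The annuli are disjoint, and exp (de k) <= exp (de d) on the k-th one. *)
Lemma sum_annular_weight_le (de s t : R) n : 0 <= de ->
  \sum_(k < n) expR (de * k%:R) * annular_weight s k%:R k.+1%:R t ^+ 2 <=
  if pdist t < n%:R then expR (- (2 * s - de) * pdist t) else 0.
Proof.
move=> de0; elim: n => [|n IH].
  by rewrite big_ord0; case: ifPn => // _; exact: expR_ge0.
rewrite big_ord_recr/=; apply: le_trans (lerD IH (lexx _)) _.
rewrite /annular_weight; have [nt|tn] := leP n%:R (pdist t).
  rewrite add0r/=; case: ifPn => _; last by rewrite expr0n mulr0.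
  rewrite -expRM_natl -expRD ler_expR.
  by have := ler_wpM2l de0 nt; lra.
rewrite /= expr0n mulr0 addr0 ifT//.
by rewrite (lt_trans tn)// ltr_nat.
Qed.

Lemma sum_mass_sq_annular_le h s de z n : real_harmonic_on (@disk R) h ->
  0 <= de -> de <= 2 * s -> sqmod z < 1 ->
  (\sum_(k < n) (expR (de * k%:R))%:E *
     mass (fun x => annular_term h s k%:R k.+1%:R z x ^+ 2)%R <=
   (distortion z `^ (2 * s - de))%:E * wnorm h (2 * s - de - 2))%E.
Proof.
move=> hh de0 des z1.
have md := @measurable_disk R.
have mt k : measurable_fun (@disk R)
    (fun x => (annular_term h s k%:R k.+1%:R z x ^+ 2 * intensity x)%:E).
  apply/measurable_EFinP; apply: measurable_funM; last exact: measurable_intensity.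
  by apply: measurable_funX; apply: measurable_funTS; exact: measurable_annular_term.
have t0 k x : disk x -> (0 <= (annular_term h s k%:R k.+1%:R z x ^+ 2 * intensity x)%:E)%E.
  by move=> _; rewrite lee_fin mulr_ge0 ?sqr_ge0 ?intensity_ge0.
have -> : (\sum_(k < n) (expR (de * k%:R))%:E *
     mass (fun x => annular_term h s k%:R k.+1%:R z x ^+ 2)%R =
   \int[@dA R]_(x in @disk R) \sum_(k < n) ((expR (de * k%:R))%:E *
     (annular_term h s k%:R k.+1%:R z x ^+ 2 * intensity x)%:E))%E.
  rewrite ge0_integral_sum//; last 2 first.
  - by move=> k; apply: measurable_funeM.
  - by move=> k x dx; rewrite mule_ge0 ?t0// lee_fin expR_ge0.
  apply: eq_bigr => k _; rewrite ge0_integralZl//; first exact: t0.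
rewrite -ge0_integralZl//; last 3 first.
- exact: measurable_wnorm_integrand.
- by move=> x _; rewrite lee_fin mulr_ge0 ?sqr_ge0 ?powR_ge0.
- by rewrite lee_fin powR_ge0.
apply: le_integral_nomeas => x dx.
  by apply: sume_ge0 => k _; rewrite mule_ge0 ?t0// lee_fin expR_ge0.
have /diskE x1 := dx.
under eq_bigr do rewrite -EFinM.
rewrite sumEFin -EFinM lee_fin.
have al0 : 0 <= 2 * s - de by rewrite subr_ge0.
rewrite [leRHS]mulrCA.
apply: le_trans (ler_wpM2l (sqr_ge0 (h x)) (expR_poincare_le al0 z1 x1)).
rewrite mulrA.
have -> : \sum_(k < n) expR (de * k%:R) *
    (annular_term h s k%:R k.+1%:R z x ^+ 2 * intensity x) =
  h x ^+ 2 * (\sum_(k < n) expR (de * k%:R) *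
     annular_weight s k%:R k.+1%:R (pdist2 z x) ^+ 2) * intensity x.
  rewrite mulr_sumr mulr_suml; apply: eq_bigr => k _.
  by rewrite annular_termE//; ring.
rewrite ler_wpM2r ?intensity_ge0// ler_wpM2l ?sqr_ge0//.
apply: le_trans (sum_annular_weight_le s (pdist2 z x) n de0) _.
by case: ifPn => // _; exact: expR_ge0.
Qed.

End RealStatistic.

(** * The mean of the total sum *)

Section TotalMass.
Variable R : realType.
Implicit Types (x z : plane R).
Local Notation lam := (@lebesgue_measure R).

Section PowerIntegral.
Variable sigma : R.
Hypothesis sigma0 : 0 < sigma.

Let F (t : R) : R := - sigma^-1 * (1 - t) `^ sigma.

Let is_derive_F (t : R) : t < 1 -> is_derive t 1 F ((1 - t) `^ (sigma - 1)).
Proof.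
move=> t1; have p : 0 < 1 - t by rewrite subr_gt0.
have D1 : is_derive t (1 : R) (fun t : R => 1 - t) (0 - 1).
  by apply: is_deriveB.
have D2 := is_derive1_powR sigma p.
have D3 := @is_derive1_comp _ (fun u => u `^ sigma) (fun t : R => 1 - t) t _ _ D2 D1.
have := @is_deriveZ _ _ _ _ (- sigma^-1) t 1 _ D3.
rewrite /F => D4.
have -> : (1 - t) `^ (sigma - 1) =
   - sigma^-1 *: (sigma * (1 - t) `^ (sigma - 1) * (0 - 1)).
  by rewrite /GRing.scale/= sub0r !mulrN1 mulrNN mulrA mulVf ?gt_eqF ?mul1r.
exact: D4.
Qed.

Lemma integral_boundary_power c : 0 < c -> c < 1 ->
  (\int[lam]_(t in `[0%R, c]) ((1 - t) `^ (sigma - 1))%:E =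
   ((1 - (1 - c) `^ sigma) / sigma)%:E)%E.
Proof.
move=> c0 c1.
have cF t : t < 1 -> {for t, continuous F}.
  by move=> t1; apply/differentiable_continuous/derivable1_diffP; case: (is_derive_F t1).
rewrite (@continuous_FTC2 _ _ F)//.
- rewrite -EFinB; congr EFin; rewrite /F subr0 powR1; field.
  by rewrite gt_eqF.
- apply: continuous_in_subspaceT => t; rewrite inE/= in_itv/= => /andP[_ tc].
  have t1 : t < 1 by exact: le_lt_trans c1.
  have p : 0 < 1 - t by rewrite subr_gt0.
  apply: (@continuous_comp _ _ _ (fun t : R => 1 - t) (fun u : R => u `^ (sigma - 1))).
    by apply: cvgB; [exact: cvg_cst|exact: cvg_id].
  apply/differentiable_continuous/derivable1_diffP.
  by case: (is_derive1_powR (sigma - 1) p).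
- split.
  + move=> t; rewrite in_itv/= => /andP[_ tc].
    by case: (is_derive_F (lt_trans tc c1)).
  + by apply: cvg_at_right_filter; exact: cF.
  + by apply: cvg_at_left_filter; exact: cF.
- move=> t; rewrite in_itv/= => /andP[_ tc].
  by rewrite derive1E; case: (is_derive_F (lt_trans tc c1)).
Qed.

End PowerIntegral.

(** The integrand may blow up at 1, hence the exhaustion by closed intervals. *)
Lemma integral_unit_itv_le (f : R -> \bar R) (M : \bar R) : measurable_fun setT f ->
  (forall t, 0 <= f t)%E ->
  (forall c : R, 0 < c -> c < 1 -> (\int[lam]_(t in `[0%R, c]) f t <= M)%E) ->
  (\int[lam]_(t in `[0%R, 1%R[) f t <= M)%E.
Proof.
move=> mf f0 fM.
pose G (n : nat) : set (measurableTypeR R) := `[0%R, 1 - n.+2%:R^-1]%classic.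
have E : (`[0%R, 1%R[%classic : set R) = \bigcup_n G n.
  apply/seteqP; split => [t|t [n _]]; rewrite /G/= !in_itv/=; last first.
    by move=> /andP[-> h]; rewrite (le_lt_trans h)// ltrBlDr ltrDl invr_gt0.
  move=> /andP[t0 t1].
  have p : 0 < 1 - t by rewrite subr_gt0.
  pose n := Num.truncn (1 - t)^-1.
  exists n => //; rewrite /G/= in_itv/= t0/= lerBrDr addrC -lerBrDr.
  rewrite invf_ple ?posrE//.
  by rewrite ltW// (lt_trans (truncnS_gt _))// ltr_nat.
rewrite E.
have H := @ge0_nondecreasing_set_cvg_integral _ _ _ G f lam.
have {}H := H _ _ (fun n => measurable_funS measurableT (@subsetT _ _) mf) (fun i t _ => f0 t).
apply: (cvge_le _ (H _ _)).
- apply: nearW => n; apply: fM; first by rewrite subr_gt0 invf_lt1// ltr1n.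
  by rewrite ltrBlDr ltrDl invr_gt0.
- apply/nondecreasing_seqP => n; rewrite subsetEset/G => t /=; rewrite !in_itv/=.
  move=> /andP[-> h]; rewrite (le_trans h)// lerD2l lerN2 lef_pV2 ?posrE//.
  by rewrite ler_nat.
- by move=> n; rewrite /G; exact: measurable_itv.
Qed.

Definition total_mass (s : R) z : \bar R :=
  (\int[@dA R]_(x in @disk R) (expR (- s * pdist (pdist2 z x)) * intensity x)%:E)%E.

Lemma measurable_expR_pdist (s : R) : measurable_fun setT (fun t => expR (- s * pdist t)).
Proof.
apply: (measurableT_comp (@measurable_expR R)).
by apply: measurable_funM => //; exact: measurable_pdist.
Qed.

Section Center.
Variable z : plane R.
Hypothesis z1 : sqmod z < 1.

Lemma total_mass_radial (s : R) : total_mass s z =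
  ((mass_const z)%:E *
   \int[lam]_(t in `[0%R, 1%R[) (expR (- s * pdist t) / (1 - t) ^+ 2)%:E)%E.
Proof.
have := @mass_radial _ z z1 (fun=> 1) 1 (fun t => expR (- s * pdist t))
  (@harmonic_cst R 1) ltr01 (lexx 1) (fun x _ => ler01) (fun t => expR_ge0 _)
  (measurable_expR_pdist s).
rewrite mulr1 => <-; first by apply: eq_integral => x _; rewrite mul1r.
by move=> t _ t1; rewrite leNgt t1.
Qed.

Lemma total_mass_ge0 s : (0 <= total_mass s z)%E.
Proof.
by apply: integral_ge0 => x _; rewrite lee_fin mulr_ge0 ?expR_ge0 ?intensity_ge0.
Qed.

(** Up to the factor 4^s, exp (- s d) is (1 - t)^s. *)
Lemma profile_bounds (s t : R) : 0 <= s -> 0 <= t -> t < 1 ->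
  4^-1 `^ s * (1 - t) `^ (s - 1 - 1) <= expR (- s * pdist t) / (1 - t) ^+ 2 <=
  (1 - t) `^ (s - 1 - 1).
Proof.
move=> s0 t0 t1; have p : 0 < 1 - t by rewrite subr_gt0.
have /andP[l u] := expR_pdist_bounds t0 t1.
have -> : (1 - t) `^ (s - 1 - 1) = (1 - t) `^ s / (1 - t) ^+ 2.
  have -> : s - 1 - 1 = s - 2 by ring.
  rewrite powRD; last by rewrite (gt_eqF p) implybT.
  by rewrite powRN powR_mulrn// ltW.
have -> : expR (- s * pdist t) = expR (- pdist t) `^ s.
  by rewrite -expRM mulNr -mulrN mulrC.
have q : 0 <= ((1 - t) ^+ 2)^-1 by rewrite invr_ge0 sqr_ge0.
rewrite mulrA -powRM ?(ltW p)// !ler_wpM2r//.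
  by rewrite ge0_ler_powR ?nnegrE ?expR_ge0 ?(ltW p).
rewrite ge0_ler_powR ?nnegrE ?expR_ge0//; last by rewrite mulrC.
by rewrite mulr_ge0// ltW.
Qed.

Lemma measurable_profile s :
  measurable_fun setT (fun t : R => (expR (- s * pdist t) / (1 - t) ^+ 2)%:E).
Proof.
apply/measurable_EFinP; apply: measurable_funM; first exact: measurable_expR_pdist.
apply: (measurableT_comp (@measurable_inv R)); apply: measurable_funX.
exact: measurable_funB.
Qed.

Lemma total_mass_fin s : 1 < s -> (total_mass s z < +oo)%E.
Proof.
move=> s1; have s0 : 0 < s - 1 by rewrite subr_gt0.
have ss : 0 <= s by apply: ltW; exact: lt_trans s1.
rewrite total_mass_radial lte_mul_pinfty//.
  by rewrite lee_fin ltW// mass_const_gt0.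
apply: (@le_lt_trans _ _ ((s - 1)^-1)%:E); last exact: ltry.
apply: integral_unit_itv_le; first exact: measurable_profile.
  by move=> t; rewrite lee_fin divr_ge0 ?expR_ge0// sqr_ge0.
move=> c c0 c1.
apply: (@le_trans _ _ (\int[lam]_(t in `[0%R, c]) ((1 - t) `^ (s - 1 - 1))%:E)%E).
  apply: le_integral_nomeas => t; rewrite /= in_itv/= => /andP[t0 tc].
    by rewrite lee_fin divr_ge0 ?expR_ge0// sqr_ge0.
  by rewrite lee_fin; case/andP: (profile_bounds ss t0 (le_lt_trans tc c1)).
rewrite integral_boundary_power// lee_fin ler_pdivrMr// mulVf ?gt_eqF//.
by rewrite lerBlDr lerDl powR_ge0.
Qed.

(** The integral of (1 - t)^(s - 2) diverges like 1 / (s - 1) as s tends to 1. *)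
Lemma total_mass_lb s S : 1 < s -> s <= S ->
  (((mass_const z * (4^-1 `^ S * (1 - expR (-1)))) / (s - 1))%:E <= total_mass s z)%E.
Proof.
move=> s1 sS; have s0 : 0 < s - 1 by rewrite subr_gt0.
have ss : 0 <= s by apply: ltW; exact: lt_trans s1.
rewrite total_mass_radial -mulrA EFinM.
have mc := mass_const_gt0 z1.
rewrite lee_pmul2l//.
(* chosen so that (1 - c)^(s - 1) = exp (- 1) *)
set c := 1 - expR (- (s - 1)^-1).
have c0 : 0 < c by rewrite subr_gt0 expR_lt1 oppr_lt0 invr_gt0.
have c1 : c < 1 by rewrite ltrBlDr ltrDl expR_gt0.
have q0 : 0 <= (4^-1 : R) `^ s by exact: powR_ge0.
apply: (@le_trans _ _ (\int[lam]_(t in `[0%R, c]) (4^-1 `^ s * (1 - t) `^ (s - 1 - 1))%:E)%E).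
  have -> : (\int[lam]_(t in `[0%R, c]) (4^-1 `^ s * (1 - t) `^ (s - 1 - 1))%:E =
     (4^-1 `^ s)%:E * \int[lam]_(t in `[0%R, c]) ((1 - t) `^ (s - 1 - 1))%:E)%E.
    rewrite -ge0_integralZl//; first last.
    - by move=> t _; rewrite lee_fin powR_ge0.
    - apply/measurable_EFinP; apply: (measurableT_comp (measurable_powR _)).
      by apply: measurable_funB.
  rewrite integral_boundary_power// -EFinM lee_fin mulrA.
  rewrite ler_wpM2r ?invr_ge0 ?(ltW s0)//.
  have -> : (1 - c) `^ (s - 1) = expR (-1).
    rewrite /c subKr -expRM; congr expR.
    by rewrite mulNr mulVf// gt_eqF.
  rewrite ler_wpM2r ?subr_ge0 ?expR_le1 ?oppr_le0//.
  by apply: ger_powR sS; rewrite invr_gt0 invf_le1// ltr0n ler1n.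
apply: (@le_trans _ _ (\int[lam]_(t in `[0%R, c]) (expR (- s * pdist t) / (1 - t) ^+ 2)%:E)%E).
  apply: le_integral_nomeas => t; rewrite /= in_itv/= => /andP[t0 tc].
    by rewrite lee_fin mulr_ge0// powR_ge0.
  by rewrite lee_fin; case/andP: (profile_bounds ss t0 (le_lt_trans tc c1)).
apply: ge0_subset_integral => //.
- exact: measurable_funS (measurable_profile s).
- by move=> t _; rewrite lee_fin divr_ge0 ?expR_ge0// sqr_ge0.
- move=> t; rewrite /= !in_itv/= => /andP[-> tc]; exact: le_lt_trans c1.
Qed.

Lemma total_mass_fine s : 1 < s -> total_mass s z = (fine (total_mass s z))%:E.
Proof. by move=> s1; rewrite fineK// ge0_fin_numE ?total_mass_ge0 ?total_mass_fin. Qed.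

End Center.
End TotalMass.

(** * Exhaustion by annuli *)

Section Limits.
Variable R : realType.
Implicit Types (x z : plane R) (h phi : plane R -> R) (X : configuration R).

Local Notation "'mass' phi" := (\int[@dA R]_(x in @disk R) (phi x * intensity x)%:E)%E
  (at level 10, phi at level 8).

Lemma linstat_rstat rho X phi : rho < 1 -> local rho phi -> (forall x, 0 <= phi x) ->
  linstat X (fun x => (phi x)%:E) = (rstat X phi)%:E.
Proof. by move=> r1 pl p0; rewrite (linstat_lsum r1 X p0 pl) (rstatE X r1 pl). Qed.

Section Center.
Variable z : plane R.
Hypothesis z1 : sqmod z < 1.

Local Notation full s x := (expR (- s * pdist (pdist2 z x))).
Local Notation part s m := (annular_term (fun=> 1) s 0 m z).

Lemma part_ge0 s m x : 0 <= part s m x.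
Proof.
have [dx|dx] := pselect (disk x); last by rewrite annular_term_out.
by rewrite annular_termE// mul1r annular_weight_ge0.
Qed.

Lemma partE s m x : disk x ->
  part s m x = if pdist (pdist2 z x) < m then full s x else 0.
Proof.
move=> dx; rewrite annular_termE// mul1r /annular_weight.
by move/diskE: dx => x1; rewrite pdist_ge0 ?pdist2_ge0 ?pdist2_lt1.
Qed.

Lemma part_le s m n x : m <= n -> part s m x <= part s n x.
Proof.
move=> mn; have [dx|dx] := pselect (disk x); last by rewrite !annular_term_out.
rewrite !partE//; case: ifPn => [h|_]; first by rewrite (lt_le_trans h mn).
by case: ifPn => // _; rewrite expR_ge0.
Qed.

Lemma part_cvg s x : disk x -> part s n%:R x @[n --> \oo] --> full s x.
Proof.
move=> dx; apply: cvg_near_cst.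
exists (Num.truncn (pdist (pdist2 z x))).+1 => // n /= h.
rewrite partE// ifT//.
by apply: lt_le_trans (truncnS_gt _) _; rewrite ler_nat.
Qed.

(** The definition of g has the arguments of the distance in the other order. *)
Lemma gE X s : g X s z = linstat X (fun x => (full s x)%:E).
Proof.
rewrite linstatE; last by move=> x; rewrite lee_fin expR_ge0.
apply: eq_esum => x dx; rewrite EFinM; congr (_ * (expR (_ * _))%:E)%E.
by move/diskE: dx => x1; rewrite poincare_dist_sym// poincare_distE.
Qed.

Lemma measurable_full s : measurable_fun setT (fun x => full s x).
Proof.
exact: (measurableT_comp (measurable_expR_pdist s) (measurable_pdist2 z1)).
Qed.

Lemma expected_gE (P : probability (Conf R) R) s :
  determinantal_process P (@bergman_kernel R) -> expected_g P s z = total_mass s z.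
Proof.
move=> P_dpp; rewrite /expected_g; under eq_integral do rewrite gE.
apply: (mean_linstat P_dpp).
  by apply/measurable_EFinP; exact: measurable_full.
by move=> x; rewrite lee_fin expR_ge0.
Qed.

Lemma annular_mass_cvg s : 1 < s ->
  annular_mass s 0 n%:R z @[n --> \oo] --> fine (total_mass s z).
Proof.
move=> s1; have s0 : 0 <= s by apply: ltW; exact: lt_trans s1.
have mi n : measurable_fun (@disk R) (fun x => (part s n%:R x * intensity x)%:E).
  apply/measurable_EFinP; apply: measurable_funM; last exact: measurable_intensity.
  by apply: measurable_funTS; apply: measurable_annular_term => //; exact: harmonic_cst.
have H := @cvg_monotone_convergence _ _ _ (@dA R) _ (@measurable_disk R)
  (fun n x => (part s n%:R x * intensity x)%:E) mi.
have {}H : (mass (part s n%:R) @[n --> \oo] --> total_mass s z)%E.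
  have -> : total_mass s z =
      (\int[@dA R]_(x in @disk R) limn (fun n => (part s n%:R x * intensity x)%:E))%E.
    apply: eq_integral => x; rewrite inE => dx; apply/esym/cvg_lim => //.
    apply: cvg_EFin; first exact: nearW.
    by apply: cvgMl; exact: part_cvg.
  apply: H => [n x dx|x dx m n mn].
    by rewrite lee_fin mulr_ge0 ?part_ge0 ?intensity_ge0.
  by rewrite lee_fin ler_wpM2r ?intensity_ge0 ?part_le ?ler_nat.
have {}H : (mass (part s n%:R) @[n --> \oo] --> (fine (total_mass s z))%:E)%E.
  by rewrite -total_mass_fine.
by have /fine_cvgP[_] := H.
Qed.

Lemma linstat_part X s b : linstat X (fun x => (part s b x)%:E) = (rstat X (part s b))%:E.
Proof.
have [rho r1 [pl _]] := annular_term_local (fun=> 1) s 0 b z1.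
by apply: (linstat_rstat _ r1 pl) => x; exact: part_ge0.
Qed.

(** A finite partial sum of g involves finitely many particles, all of them in
    some ball about z. *)
Lemma g_cvg X s G : (rstat X (part s n%:R) @[n --> \oo] --> (G : R)) -> g X s z = G%:E.
Proof.
move=> cG; have nd : nondecreasing_seq (fun n : nat => rstat X (part s n%:R)).
  move=> m n mn; rewrite -lee_fin -!linstat_part.
  by apply: le_esum => p _ /=; rewrite lee_fin part_le// ler_nat.
have leG n : rstat X (part s n%:R) <= G.
  by rewrite -(cvg_lim _ cG)//; apply: nondecreasing_cvgn_le => //; apply/cvg_ex; exists G.
apply/eqP; rewrite eq_le gE; apply/andP; split; last first.
  have le n : ((rstat X (part s n%:R))%:E <= linstat X (fun x => (full s x)%:E))%E.
    rewrite -linstat_part; rewrite !linstatE.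
    - apply: le_esum => x dx; rewrite lee_wpmul2l ?lee_fin ?ler0n// partE//.
      by case: ifPn => // _; exact: expR_ge0.
    - by move=> x; rewrite lee_fin expR_ge0.
    - by move=> x; rewrite lee_fin part_ge0.
  have cE : ((rstat X (part s n%:R))%:E @[n --> \oo] --> G%:E)%E.
    by apply: cvg_EFin => //; exact: nearW.
  by apply: (cvge_le _ cE); exact: nearW.
rewrite linstatE; last by move=> x; rewrite lee_fin expR_ge0.
apply: ge_ereal_sup => _ [F [finF Fd] <-].
have sumE (u : plane R -> R) : (\sum_(x \in F) (X x)%:R%:E * (u x)%:E =
    (\sum_(x <- finmap.enum_fset (fset_set F) | x \in F) (X x)%:R * u x)%:E)%E.
  rewrite fsbig_finite//= -sumEFin big_seq_cond [RHS]big_seq_cond; apply: eq_bigl => x.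
  by rewrite andbT in_fset_set// andbb.
have cF : ((\sum_(x \in F) (X x)%:R%:E * (part s n%:R x)%:E)%E @[n --> \oo] -->
    (\sum_(x \in F) (X x)%:R%:E * (full s x)%:E)%E).
  rewrite sumE; under eq_fun do rewrite sumE.
  apply: cvg_EFin; first exact: nearW.
  apply: cvg_big => [|x]; first exact: add_continuous.
  by rewrite inE => /Fd dx; apply: cvgMr; exact: part_cvg.
apply: (cvge_le _ cF); apply: nearW => n.
apply: (@le_trans _ _ (rstat X (part s n%:R))%:E); last by rewrite lee_fin.
rewrite -linstat_part linstatE; last by move=> x; rewrite lee_fin part_ge0.
by apply: ereal_sup_ubound; exists F.
Qed.

End Center.
End Limits.

(** * Null sets of configurations and of centers *)

Section FiniteSections.
Variables (R : realType) (d1 d2 : measure_display).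
Variables (T1 : measurableType d1) (T2 : measurableType d2).
Variables (P : probability T1 R) (mu : {sigma_finite_measure set T2 -> \bar R}).

(** For each z the configurations with Q = +oo form a null set; by Tonelli's
    theorem, for almost every configuration the corresponding z do. *)
Lemma ae_ae_finite (Q : T1 * T2 -> \bar R) : measurable_fun setT Q ->
  (forall p, 0 <= Q p)%E -> (forall z, \int[P]_X Q (X, z) < +oo)%E ->
  {ae P, forall X, {ae mu, forall z, (Q (X, z) < +oo)%E}}.
Proof.
move=> mQ Q0 Qfin.
pose N := [set p | Q p = +oo%E].
have mN : measurable N.
  by rewrite -[N]setTI; exact: (mQ measurableT [set +oo%E] (emeasurable_set1 _)).
pose f p : \bar R := (\1_N p)%:E.
have mf : measurable_fun setT f.
  by apply/measurable_EFinP; exact: measurable_indic.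
have f0 p : (0 <= f p)%E by rewrite lee_fin.
have null z : (\int[P]_X f (X, z) = 0)%E.
  have mQz : measurable_fun setT (fun X => Q (X, z)).
    exact: (measurableT_comp mQ (measurable_pair2 z)).
  have iQ : P.-integrable setT (fun X => Q (X, z)).
    apply/integrableP; split => //.
    by rewrite (eq_integral (fun X => Q (X, z))) => [//|X _]; rewrite gee0_abs.
  have aQ := integrable_ae measurableT iQ.
  have mfz : measurable_fun setT (fun X => f (X, z)).
    exact: (measurableT_comp mf (measurable_pair2 z)).
  rewrite (eq_integral (fun X => `|f (X, z)|)%E) => [|X _]; last by rewrite gee0_abs.
  apply/(ae_eq_integral_abs _ measurableT mfz).
  apply: filterS aQ => X /(_ I) finX _; rewrite /f indicE memNset//.
  by rewrite /N/= => E; rewrite E in finX.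
have H : (\int[P]_X \int[mu]_z f (X, z) = 0)%E.
  rewrite fubini_tonelli//.
  by rewrite (eq_integral (cst 0%E)) => [|z _]; [exact: integral0|exact: null].
have mF : measurable_fun setT (fun X => \int[mu]_z f (X, z))%E.
  exact: measurable_fun_fubini_tonelli_F.
have {}H : (\int[P]_X `|\int[mu]_z f (X, z)| = 0)%E.
  rewrite -[RHS]H; apply: eq_integral => X _; rewrite gee0_abs//.
  exact: integral_ge0.
move/(ae_eq_integral_abs _ measurableT mF) : H.
apply: filterS => X /(_ I) /= HX.
have mfX : measurable_fun setT (fun z => f (X, z)).
  exact: (measurableT_comp mf (measurable_pair1 X)).
have : (\int[mu]_z `|f (X, z)| = 0)%E.
  by rewrite -[RHS]HX; apply: eq_integral => z _; rewrite gee0_abs.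
move/(ae_eq_integral_abs _ measurableT mfX).
apply: filterS => z /(_ I) /= E; rewrite ltey; apply/eqP => Qoo.
move: E; rewrite /f indicE mem_set// => /eqP.
by rewrite eqe oner_eq0.
Qed.

End FiniteSections.

Section JointMeasurability.
Variable R : realType.
Implicit Types (x z : plane R) (h phi : plane R -> R).

Lemma dA_sigma_finite : sigma_finite setT (@dA R).
Proof.
have /sigma_finiteP[F [TF ndF Foo]] := sigma_finiteT (@lebesgue_measure R).
exists (fun n => F n `*` F n).
  rewrite -setXTT {1 2}TF predeqE => -[x y]; split.
    move=> [/= [n _ Fnx] [k _ Gky]]; exists (maxn n k) => //; split.
    - by move: x Fnx; exact/subsetPset/ndF/leq_maxl.
    - by move: y Gky; exact/subsetPset/ndF/leq_maxr.
  by move=> [n _ []/= ? ?]; split; exists n.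
move=> k; have [mF Fk] := Foo k.
split; first exact: measurableX.
rewrite /dA/= /mscale/= lte_mul_pinfty//; first by rewrite lee_fin invr_pi_ge0.
by rewrite -[ltLHS]/((@lebesgue_measure R \x @lebesgue_measure R)%E _) product_measure1E// lte_mul_pinfty// ge0_fin_numE.
Qed.

Definition sigma_finite_dA : {sigma_finite_measure set (plane R) -> \bar R} :=
  HB.pack (Measure.sort (@dA R)) (Measure_isSigmaFinite.Build _ _ _ (@dA R) dA_sigma_finite).
(** [annular_term] as a function of the center and of the point, extended by 0
    so as to be measurable on the whole product. *)
Definition joint_term h s a b (p : plane R * plane R) : R :=
  \1_(@disk R) p.1 * ((h \_ (@disk R)) p.2 * annular_weight s a b (1 - defect p.1 p.2)).

Lemma joint_termE h s a b z : disk z ->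
  (fun x => joint_term h s a b (z, x)) = annular_term h s a b z.
Proof.
move=> dz; apply/funext => x; rewrite /joint_term/= indicE mem_set// mul1r.
have [dx|dx] := pselect (disk x); last first.
  by rewrite annular_term_out// patchE memNset// mul0r.
have /diskE x1 := dx.
by rewrite (annular_termE _ _ _ _ _ dx) (pdist2E _ x1) patchE (mem_set dx).
Qed.

Lemma joint_term_out h s a b z x : ~ disk z -> joint_term h s a b (z, x) = 0.
Proof. by move=> dz; rewrite /joint_term/= indicE memNset// mul0r. Qed.

Lemma measurable_joint_term h s a b : real_harmonic_on (@disk R) h ->
  measurable_fun setT (joint_term h s a b).
Proof.
move=> hh; apply: measurable_funM.
  by apply: measurableT_comp => //; apply: measurable_indic; exact: measurable_disk.
apply: measurable_funM.
  apply: (@measurableT_comp _ _ _ _ _ _ (h \_ (@disk R))) => //.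
  apply/(measurable_restrictT _ (@measurable_disk R)).
  exact: measurable_harmonic.
apply: (measurableT_comp (measurable_annular_weight _ _ _)).
have m11 : measurable_fun setT (fun p : plane R * plane R => p.1.1).
  exact: (measurableT_comp measurable_fst measurable_fst).
have m12 : measurable_fun setT (fun p : plane R * plane R => p.1.2).
  exact: (measurableT_comp measurable_snd measurable_fst).
have m21 : measurable_fun setT (fun p : plane R * plane R => p.2.1).
  exact: (measurableT_comp measurable_fst measurable_snd).
have m22 : measurable_fun setT (fun p : plane R * plane R => p.2.2).
  exact: (measurableT_comp measurable_snd measurable_snd).
apply: measurable_funB => //; rewrite /defect; apply: measurable_funM.
  by apply: measurable_funM; apply: measurable_funB => //;
    apply: measurable_funD; exact: measurable_funX.
apply: (measurableT_comp (@measurable_inv R)).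
rewrite /moebius_den; apply: measurable_funD; apply: measurable_funX.
  by apply: measurable_funB => //; apply: measurable_funD; exact: measurable_funM.
by apply: measurable_funB => //; exact: measurable_funM.
Qed.

(** The sum over an annulus minus its mean, measurable in the configuration and in
    the center jointly. *)
Definition fluct h s a b (X : configuration R) z : R :=
  rstat X (fun x => joint_term h s a b (z, x)) - (h \_ (@disk R)) z *
  fine (\int[@dA R]_(x in @disk R) (joint_term (fun=> 1) s a b (z, x) * intensity x)%:E)%E.

Lemma fluctE h s a b X z : disk z ->
  fluct h s a b X z = rstat X (annular_term h s a b z) - h z * annular_mass s a b z.
Proof.
move=> dz; rewrite /fluct joint_termE// patchE mem_set//; congr (_ - _ * fine _).
by apply: eq_integral => x _; rewrite -joint_termE.
Qed.

Lemma fluct_out h s a b X z : ~ disk z -> fluct h s a b X z = 0.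
Proof.
move=> dz; rewrite /fluct patchE memNset// mul0r subr0.
have -> : (fun x => joint_term h s a b (z, x)) = (fun=> 0).
  by apply/funext => x; rewrite joint_term_out.
by rewrite /rstat oppr0 subrr.
Qed.

Lemma measurable_rstat_joint h s a b : real_harmonic_on (@disk R) h ->
  measurable_fun setT (fun Xz : Conf R * plane R =>
    rstat Xz.1 (fun x => joint_term h s a b (Xz.2, x))).
Proof.
move=> hh; have mj := measurable_joint_term s a b hh.
have loc z : exists2 rho : R, rho < 1 &
    forall x, ~ subdisk rho x -> joint_term h s a b (z, x) = 0.
  have [dz|dz] := pselect (disk z); last first.
    by exists 0 => // x _; exact: joint_term_out.
  have /diskE z1 := dz.
  have [rho r1 [pl _]] := annular_term_local h s a b z1.
  exists rho => // x nx.
  by rewrite -[LHS]/((fun x => joint_term h s a b (z, x)) x) joint_termE// pl.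
apply: measurable_funB; apply: (measurableT_comp (fine_measurable measurableT)).
- apply: (@measurable_linstat R (fun p => (ppart (joint_term h s a b p))%:E)).
  + by apply/measurable_EFinP; exact: (measurable_maxr mj (measurable_cst (0:R))).
  + by move=> p; rewrite lee_fin ppart_ge0.
  + move=> z; have [rho r1 H] := loc z; exists rho => // x nx.
    by rewrite H// /ppart maxxx.
- apply: (@measurable_linstat R (fun p => (ppart (- joint_term h s a b p))%:E)).
  + apply/measurable_EFinP.
    exact: (measurable_maxr (measurable_funN mj) (measurable_cst (0:R))).
  + by move=> p; rewrite lee_fin ppart_ge0.
  + move=> z; have [rho r1 H] := loc z; exists rho => // x nx.
    by rewrite H// oppr0 /ppart maxxx.
Qed.

Lemma measurable_mass_joint s a b : measurable_fun setT (fun z : plane R =>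
  fine (\int[@dA R]_(x in @disk R) (joint_term (fun=> 1) s a b (z, x) * intensity x)%:E)%E).
Proof.
apply: (measurableT_comp (fine_measurable measurableT)).
have mj := measurable_joint_term s a b (@harmonic_cst R 1).
have j0 p : 0 <= joint_term (fun=> 1) s a b p.
  rewrite /joint_term mulr_ge0// mulr_ge0 ?annular_weight_ge0//.
  by rewrite patchE; case: ifPn.
pose f (p : plane R * plane R) :=
  (joint_term (fun=> 1) s a b p * (@intensity R \_ (@disk R)) p.2)%:E.
have mf : measurable_fun setT f.
  apply/measurable_EFinP; apply: measurable_funM => //.
  apply: (@measurableT_comp _ _ _ _ _ _ (@intensity R \_ (@disk R))) => //.
  by apply/(measurable_restrictT _ (@measurable_disk R)); exact: measurable_intensity.
have f0 p : (0 <= f p)%E.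
  rewrite lee_fin mulr_ge0// patchE; case: ifPn => // _; exact: intensity_ge0.
have mF := measurable_fun_fubini_tonelli_F (m2 := sigma_finite_dA) f mf f0.
have -> : (fun z => \int[@dA R]_(x in @disk R)
    (joint_term (fun=> 1) s a b (z, x) * intensity x)%:E)%E = fubini_F sigma_finite_dA f.
  apply/funext => z; rewrite /fubini_F [LHS]integral_mkcond; apply: eq_integral => x _.
  by rewrite /f !patchE /=; case: ifPn => // _; rewrite mulr0.
exact: mF.
Qed.

Lemma measurable_fluct h s a b : real_harmonic_on (@disk R) h ->
  measurable_fun setT (fun Xz : Conf R * plane R => fluct h s a b Xz.1 Xz.2).
Proof.
move=> hh; apply: measurable_funB; first exact: measurable_rstat_joint.
apply: measurable_funM; last first.
  exact: (measurableT_comp (measurable_mass_joint s a b) measurable_snd).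
apply: (@measurableT_comp _ _ _ _ _ _ (h \_ (@disk R))) => //.
apply/(measurable_restrictT _ (@measurable_disk R)).
exact: measurable_harmonic.
Qed.

End JointMeasurability.

(** * Fluctuations of annular sums *)

Section RealSeries.
Variable R : realType.

Lemma cvg_series_fin (u : nat -> R) : (forall n, 0 <= u n) ->
  (\sum_(0 <= n <oo) (u n)%:E < +oo)%E -> cvgn (series u).
Proof.
move=> u0 ufin; apply: nondecreasing_is_cvgn.
  by apply/nondecreasing_seqP => n; rewrite seriesSr lerDl.
exists (fine (\sum_(0 <= n <oo) (u n)%:E)%E) => _ [n _ <-].
rewrite -lee_fin fineK; last first.
  by rewrite ge0_fin_numE// nneseries_ge0// => k _ _; rewrite lee_fin.
rewrite /series/= -sumEFin; apply: nneseries_lim_ge => k _ _.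
by rewrite lee_fin.
Qed.

(** By |y| <= e^-1 + e y^2 with e = exp (de k), the series is dominated by a
    geometric one plus a convergent one. *)
Lemma cvg_series_weighted_sq (y : nat -> R) (de : R) : 0 < de ->
  (\sum_(0 <= k <oo) (expR (de * k%:R) * y k ^+ 2)%:E < +oo)%E ->
  cvgn (series y).
Proof.
move=> de0 yfin; apply: normed_cvg.
have c1 : cvgn (series (fun k => expR (de * k%:R) * y k ^+ 2)).
  by apply: cvg_series_fin => // n; rewrite mulr_ge0 ?expR_ge0 ?sqr_ge0.
have c2 : cvgn (series (geometric 1 (expR (- de)))).
  apply: is_cvg_geometric_series.
  by rewrite ger0_norm ?expR_ge0// expR_lt1 oppr_lt0.
have c12 := is_cvg_seriesD c1 c2.
apply: series_le_cvg c12 => k; first exact: normr_ge0.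
  apply: addr_ge0; first by rewrite mulr_ge0 ?expR_ge0 ?sqr_ge0.
  by rewrite /geometric/= mul1r exprn_ge0// expR_ge0.
rewrite -[leRHS]/(expR (de * k%:R) * y k ^+ 2 + 1 * expR (- de) ^+ k).
rewrite -[leLHS]/(`|y k|) mul1r -expRM_natr mulNr expRN.
set e := expR _; have e0 : 0 < e by exact: expR_gt0.
rewrite -(ler_pM2l e0) mulrDr mulfV ?gt_eqF//.
have -> : e * (e * y k ^+ 2) = (e * `|y k|) ^+ 2.
  by rewrite exprMn real_normK ?num_real//; ring.
have : 0 <= e * `|y k| by rewrite mulr_ge0// ltW.
by move: (e * _) => t t0; nra.
Qed.

Lemma limn_einf_ge0 (u : nat -> \bar R) : (forall n, 0 <= u n)%E -> (0 <= limn_einf u)%E.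
Proof.
move=> u0; rewrite limn_einf_lim; apply: lime_ge; first exact: is_cvg_einfs.
by apply: nearW => n; apply: le_ereal_inf_tmp => _ [k _ <-].
Qed.

Lemma limn_einf_le (u : nat -> \bar R) M : (forall n, u n <= M)%E -> (limn_einf u <= M)%E.
Proof.
move=> uM; rewrite limn_einf_lim; apply: lime_le; first exact: is_cvg_einfs.
apply: nearW => n; apply: le_trans (uM n).
by apply: ereal_inf_lbound; exists n => //=.
Qed.

Lemma measurable_limn_einf d (T : measurableType d) (f : (T -> \bar R)^nat) :
  (forall n, measurable_fun setT (f n)) ->
  measurable_fun setT (fun x => limn_einf (f ^~ x)).
Proof.
move=> mf; have mN n : measurable_fun setT (fun x => - f n x)%E.
  exact: (measurableT_comp (@oppe_measurable _ setT) (mf n)).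
exact: (measurableT_comp (@oppe_measurable _ setT) (measurable_fun_limn_esup mN)).
Qed.

End RealSeries.

Section FluctuationMoments.
Variable R : realType.
Variable P : probability (Conf R) R.
Hypothesis P_dpp : determinantal_process P (@bergman_kernel R).
Implicit Types (x z : plane R).
Variable h : plane R -> R.
Hypothesis hh : real_harmonic_on (@disk R) h.

Local Notation "'mass' phi" := (\int[@dA R]_(x in @disk R) (phi x * intensity x)%:E)%E
  (at level 10, phi at level 8).

Lemma annular_term_add s a b c z : a <= b -> b <= c ->
  annular_term h s a c z =
  fun x => annular_term h s a b z x + annular_term h s b c z x.
Proof.
move=> ab bc; apply/funext => x; have [dx|dx] := pselect (disk x); last first.
  by rewrite !annular_term_out// addr0.
by rewrite !(annular_termE _ _ _ _ _ dx) (annular_weight_add _ _ ab bc) mulrDr.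
Qed.

Lemma local_le rho rho' (phi : plane R -> R) : rho <= rho' -> local rho phi ->
  local rho' phi.
Proof.
move=> rr pl x nx; apply: pl => xr; apply: nx.
by move: xr; rewrite /subdisk/=; move/le_trans; apply.
Qed.

Lemma rstatD rho1 rho2 X (phi psi : plane R -> R) : rho1 < 1 -> rho2 < 1 ->
  local rho1 phi -> local rho2 psi ->
  rstat X (fun x => phi x + psi x) = rstat X phi + rstat X psi.
Proof.
move=> r1 r2 pl ql; set rho := Num.max rho1 rho2.
have r : rho < 1 by rewrite gt_max r1.
have {}pl : local rho phi by apply: local_le pl; rewrite le_max lexx.
have {}ql : local rho psi by apply: local_le ql; rewrite le_max lexx orbT.
have pql : local rho (fun x => phi x + psi x).
  by move=> x nx; rewrite pl// ql// addr0.
by rewrite (rstatE X r pl) (rstatE X r ql) (rstatE X r pql) /lsum big_split.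
Qed.

Section Center.
Variable z : plane R.
Hypothesis z1 : sqmod z < 1.

Lemma rstat_annular_add s a b c X : a <= b -> b <= c ->
  rstat X (annular_term h s a c z) =
  rstat X (annular_term h s a b z) + rstat X (annular_term h s b c z).
Proof.
move=> ab bc; rewrite (annular_term_add _ _ ab bc).
have [r1 r11 [pl _]] := annular_term_local h s a b z1.
have [r2 r21 [ql _]] := annular_term_local h s b c z1.
exact: rstatD r11 r21 pl ql.
Qed.

Lemma fluct_sum s m X : 0 <= s ->
  fluct h s 0 m.+1%:R X z = \sum_(0 <= k < m.+1) fluct h s k%:R k.+1%:R X z.
Proof.
move=> s0; have dz : disk z by apply/diskE.
elim: m => [|m IH]; first by rewrite big_nat1.
rewrite big_nat_recr//= -IH !(fluctE _ _ _ _ _ dz).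
have m0 : (0 : R) <= m.+1%:R by exact: ler0n.
have mm : m.+1%:R <= m.+2%:R :> R by rewrite ler_nat.
rewrite (rstat_annular_add _ _ m0 mm).
suff -> : annular_mass s 0 m.+2%:R z =
    annular_mass s 0 m.+1%:R z + annular_mass s m.+1%:R m.+2%:R z by ring.
apply: EFin_inj; rewrite EFinD.
rewrite -!(annular_massE _ _ s0 z1).
have md := @measurable_disk R.
have mt a b : measurable_fun (@disk R)
    (fun x => (annular_term (fun=> 1) s a b z x * intensity x)%:E).
  apply/measurable_EFinP; apply: measurable_funM; last exact: measurable_intensity.
  exact: measurable_funTS (measurable_annular_term _ _ _ (@harmonic_cst R 1) z1).
have t0 a b x : disk x -> (0 <= (annular_term (fun=> 1) s a b z x * intensity x)%:E)%E.
  by move=> dx; rewrite lee_fin annular_termE// mul1r mulr_ge0 ?annular_weight_ge0 ?intensity_ge0.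
rewrite -(ge0_integralD _ md (t0 _ _) (mt _ _) (t0 _ _) (mt _ _)).
apply: eq_integral => x; rewrite inE => dx.
rewrite -EFinD -mulrDl; congr (_ * _)%:E.
by rewrite !(annular_termE _ _ _ _ _ dx) !mul1r (annular_weight_add _ _ m0 mm).
Qed.

End Center.

Lemma measurable_fluct_sq s a b : measurable_fun setT
  (fun Xz : Conf R * plane R => ((fluct h s a b Xz.1 Xz.2) ^+ 2)%:E).
Proof. by apply/measurable_EFinP; apply: measurable_funX; exact: measurable_fluct. Qed.

Lemma measurable_fluct_sq1 s a b z : measurable_fun setT
  (fun X : Conf R => ((fluct h s a b X z) ^+ 2)%:E).
Proof. exact: (measurableT_comp (measurable_fluct_sq s a b) (measurable_pair2 z)). Qed.

Lemma mean_fluct_sq s a b z : 0 <= s -> 0 < b -> disk z ->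
  (\int[P]_X ((fluct h s a b X z) ^+ 2)%:E <=
   2%:E * mass (fun x => annular_term h s a b z x ^+ 2)%R)%E.
Proof.
move=> s0 b0 dz; have /diskE z1 := dz.
have := variance_annular P_dpp a hh s0 b0 z1.
by apply: le_trans; under eq_integral do rewrite fluctE//.
Qed.

Lemma mean_fluct_out s a b z : ~ disk z ->
  (\int[P]_X ((fluct h s a b X z) ^+ 2)%:E = 0)%E.
Proof.
move=> dz; rewrite (eq_integral (cst 0%E)) ?integral0// => X _.
by rewrite fluct_out// expr0n.
Qed.

End FluctuationMoments.

(** * Almost sure limits for a real harmonic function *)

Section RealCore.
Variable R : realType.
Variable P : probability (Conf R) R.
Hypothesis P_dpp : determinantal_process P (@bergman_kernel R).
Implicit Types (x z : plane R).
Variable h : plane R -> R.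
Hypothesis hh : real_harmonic_on (@disk R) h.
Variable s : nat -> R.
Hypothesis s1 : forall n, 1 < s n.

Let s0 n : 0 <= s n.
Proof. by apply: ltW; exact: lt_trans (s1 n). Qed.

Local Notation "'mass' phi" := (\int[@dA R]_(x in @disk R) (phi x * intensity x)%:E)%E
  (at level 10, phi at level 8).

(** The increasing weights exp ((s n - 1) k) make the finiteness of this sum of
    squares imply the absolute convergence of the sums over annuli. *)
Definition series_energy (n : nat) (Xz : Conf R * plane R) : \bar R :=
  (\sum_(k <oo) (expR ((s n - 1) * k%:R) * fluct h (s n) k%:R k.+1%:R Xz.1 Xz.2 ^+ 2)%:E)%E.

(** The lower limit makes sense before convergence is known, and Fatou's lemma
    bounds its mean. *)
Definition limit_energy (Xz : Conf R * plane R) : \bar R :=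
  (\sum_(n <oo) ((s n - 1) ^+ 2)%:E *
     limn_einf (fun m => (fluct h (s n) 0 m.+1%:R Xz.1 Xz.2 ^+ 2)%:E))%E.

Lemma measurable_series_energy n : measurable_fun setT (series_energy n).
Proof.
apply: (@ge0_emeasurable_sum _ _ _ _ _ xpredT) => [k Xz _ _|k _].
  by rewrite lee_fin mulr_ge0 ?expR_ge0 ?sqr_ge0.
apply/measurable_EFinP; apply: measurable_funM => //.
by apply: measurable_funX; exact: measurable_fluct.
Qed.

Lemma measurable_limit_energy : measurable_fun setT limit_energy.
Proof.
apply: (@ge0_emeasurable_sum _ _ _ _ _ xpredT) => [k Xz _ _|k _].
  rewrite mule_ge0 ?lee_fin ?sqr_ge0//; apply: limn_einf_ge0 => m.
  by rewrite lee_fin sqr_ge0.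
apply: measurable_funeM; apply: (measurable_limn_einf
  (f := fun m (Xz : Conf R * plane R) => (fluct h (s k) 0 m.+1%:R Xz.1 Xz.2 ^+ 2)%:E)) => m.
exact: measurable_fluct_sq.
Qed.

Lemma series_energy_ge0 n Xz : (0 <= series_energy n Xz)%E.
Proof.
by apply: nneseries_ge0 => k _ _; rewrite lee_fin mulr_ge0 ?expR_ge0 ?sqr_ge0.
Qed.

Lemma limit_energy_ge0 Xz : (0 <= limit_energy Xz)%E.
Proof.
apply: nneseries_ge0 => k _ _; rewrite mule_ge0 ?lee_fin ?sqr_ge0//.
by apply: limn_einf_ge0 => m; rewrite lee_fin sqr_ge0.
Qed.

Lemma mean_series_energy n z : (wnorm h (s n - 1) < +oo)%E ->
  (\int[P]_X series_energy n (X, z) < +oo)%E.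
Proof.
move=> wfin; set de := s n - 1.
have de0 : 0 < de by rewrite subr_gt0.
rewrite /series_energy/= integral_nneseries//; last 2 first.
- move=> k; apply/measurable_EFinP; apply: measurable_funM => //.
  by have /measurable_EFinP := measurable_fluct_sq1 hh (s n) k%:R k.+1%:R z.
- by move=> k X _; rewrite lee_fin mulr_ge0 ?expR_ge0 ?sqr_ge0.
have E k : (\int[P]_X (expR (de * k%:R) * fluct h (s n) k%:R k.+1%:R X z ^+ 2)%:E =
   (expR (de * k%:R))%:E * \int[P]_X (fluct h (s n) k%:R k.+1%:R X z ^+ 2)%:E)%E.
  under eq_integral do rewrite EFinM.
  apply: ge0_integralZl; first exact: measurableT.
  - exact: measurable_fluct_sq1.
  - by move=> X _; rewrite lee_fin sqr_ge0.
  - by rewrite lee_fin expR_ge0.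
rewrite (eq_eseriesr (fun k _ => E k)).
have [dz|dz] := pselect (disk z); last first.
  rewrite eseries0// => k _ _.
  by rewrite mean_fluct_out// mule0.
have /diskE z1 := dz.
apply: (@le_lt_trans _ _ (2%:E * ((distortion z `^ (2 * s n - de))%:E *
    wnorm h (2 * s n - de - 2)))%E); last first.
  have -> : 2 * s n - de - 2 = s n - 1 by rewrite /de; ring.
  by rewrite !lte_mul_pinfty// ?lee_fin ?powR_ge0// mule_ge0 ?wnorm_ge0// lee_fin powR_ge0.
apply: lime_le.
  apply: is_cvg_nneseries => k _ _; rewrite mule_ge0 ?lee_fin ?expR_ge0//.
  by apply: integral_ge0 => X _; rewrite lee_fin sqr_ge0.
apply: nearW => m; rewrite big_mkord.
have des : de <= 2 * s n by rewrite /de; have := s1 n; lra.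
have H := sum_mass_sq_annular_le m hh (ltW de0) des z1.
have two0 : (0 <= 2%:E :> \bar R)%E by rewrite lee_fin.
apply: le_trans (lee_wpmul2l two0 H).
rewrite ge0_sume_distrr; last first.
  move=> k _; rewrite mule_ge0 ?lee_fin ?expR_ge0//.
  by apply: integral_ge0 => x _; rewrite lee_fin mulr_ge0 ?sqr_ge0 ?intensity_ge0.
apply: lee_sum => k _; rewrite muleCA lee_wpmul2l ?lee_fin ?expR_ge0//.
by apply: mean_fluct_sq => //; rewrite ltr0n.
Qed.

Lemma mean_limit_energy S z : (forall n, s n <= S) ->
  (\sum_(0 <= n <oo) ((s n - 1) ^+ 2)%:E * wnorm h (2 * s n - 2) < +oo)%E ->
  (\int[P]_X limit_energy (X, z) < +oo)%E.
Proof.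
move=> sS wfin.
have m1 n m : measurable_fun setT (fun X : Conf R => (fluct h (s n) 0 m.+1%:R X z ^+ 2)%:E).
  exact: measurable_fluct_sq1.
have ml n := measurable_limn_einf (m1 n).
have l0 n X : (0 <= limn_einf (fun m => (fluct h (s n) 0 m.+1%:R X z ^+ 2)%:E))%E.
  by apply: limn_einf_ge0 => m; rewrite lee_fin sqr_ge0.
rewrite /limit_energy/= integral_nneseries//; last 2 first.
- by move=> n; apply: measurable_funeM; exact: ml.
- by move=> n X _; rewrite mule_ge0// lee_fin sqr_ge0.
have E n : (\int[P]_X (((s n - 1) ^+ 2)%:E *
      limn_einf (fun m => (fluct h (s n) 0 m.+1%:R X z ^+ 2)%:E)) =
   ((s n - 1) ^+ 2)%:E * \int[P]_X
      limn_einf (fun m => (fluct h (s n) 0 m.+1%:R X z ^+ 2)%:E))%E.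
  apply: ge0_integralZl; first exact: measurableT.
  - exact: ml.
  - by move=> X _; exact: l0.
  - by rewrite lee_fin sqr_ge0.
rewrite (eq_eseriesr (fun k _ => E k)).
have F n : (\int[P]_X limn_einf (fun m => (fluct h (s n) 0 m.+1%:R X z ^+ 2)%:E) <=
    limn_einf (fun m => \int[P]_X (fluct h (s n) 0 m.+1%:R X z ^+ 2)%:E))%E.
  apply: (fatou P measurableT (m1 n)) => m X _.
  by rewrite lee_fin sqr_ge0.
have [dz|dz] := pselect (disk z); last first.
  rewrite eseries0// => n _ _.
  have -> : (\int[P]_X limn_einf (fun m => (fluct h (s n) 0 m.+1%:R X z ^+ 2)%:E) = 0)%E.
    apply/eqP; rewrite eq_le integral_ge0// andbT; apply: le_trans (F n) _.
    by apply: limn_einf_le => m; rewrite mean_fluct_out.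
  by rewrite mule0.
have /diskE z1 := dz.
have d1 : 1 <= distortion z.
  rewrite /distortion ler_pdivlMr ?subr_gt0// mul1r.
  by have := sqmod_ge0 z; lra.
set K := 2 * distortion z `^ (2 * S).
have K0 : 0 <= K by rewrite mulr_ge0// powR_ge0.
apply: (@le_lt_trans _ _ (K%:E * \sum_(0 <= n <oo) ((s n - 1) ^+ 2)%:E * wnorm h (2 * s n - 2))%E).
  rewrite -nneseriesZl; last by move=> n _; rewrite mule_ge0 ?wnorm_ge0// lee_fin sqr_ge0.
  apply: lee_nneseries => [n _ _|n _].
    by rewrite mule_ge0 ?lee_fin ?sqr_ge0// integral_ge0.
  rewrite muleCA lee_wpmul2l ?lee_fin ?sqr_ge0//.
  apply: le_trans (F n) _; apply: limn_einf_le => m.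
  apply: le_trans (mean_fluct_sq P_dpp hh 0 (s0 n) _ dz) _; first by rewrite ltr0n.
  rewrite /K EFinM -muleA lee_wpmul2l//.
  apply: le_trans (mass_sq_annular_le 0 m.+1%:R hh (s0 n) z1) _.
  rewrite lee_wpmul2r ?wnorm_ge0// lee_fin ler_powR//.
  by have := sS n; lra.
by rewrite lte_mul_pinfty.
Qed.

Section Pointwise.
Variables (X : Conf R) (z : plane R).
Hypothesis z1 : sqmod z < 1.
Variable S : R.
Hypothesis sS : forall n, s n <= S.
Hypothesis series_fin : forall n, (series_energy n (X, z) < +oo)%E.
Hypothesis limit_fin : (limit_energy (X, z) < +oo)%E.

Lemma fluct_cvg n : exists Y : R, fluct h (s n) 0 m%:R X z @[m --> \oo] --> Y.
Proof.
have de0 : 0 < s n - 1 by rewrite subr_gt0.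
have /cvg_ex[Y cY] := cvg_series_weighted_sq de0 (series_fin n).
exists Y; rewrite -(cvg_shiftS (fun m => fluct h (s n) 0 m%:R X z)).
rewrite -cvg_shiftS in cY; move: cY; apply: cvg_trans; apply: near_eq_cvg; apply: nearW => m /=.
by rewrite (fluct_sum _ z1).
Qed.

(** The mean e n is at least a multiple of 1 / (s n - 1), and the fluctuation is of
    smaller order. *)
Lemma pointwise_limit : exists G : nat -> R,
  (forall n, rstat X (annular_term h (s n) 0 m%:R z) @[m --> \oo] --> G n) /\
  G n / fine (total_mass (s n) z) @[n --> \oo] --> h z.
Proof.
have dz : disk z by apply/diskE.
have [Y cY] := choice fluct_cvg.
pose e n := fine (total_mass (s n) z).
exists (fun n => Y n + h z * e n); split.
  move=> n; have : fluct h (s n) 0 m%:R X z + h z * annular_mass (s n) 0 m%:R z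
      @[m --> \oo] --> Y n + h z * e n.
    by apply: cvgD (cY n) _; apply: cvgMr; exact: annular_mass_cvg.
  apply: cvg_trans; apply: near_eq_cvg; apply: nearW => m /=.
  by rewrite fluctE// subrK.
pose c := mass_const z * (4^-1 `^ S * (1 - expR (-1))).
have c0 : 0 < c.
  apply: mulr_gt0; first exact: mass_const_gt0.
  apply: mulr_gt0; first by rewrite powR_gt0// invr_gt0.
  by rewrite subr_gt0 expR_lt1 oppr_lt0.
have ec n : c / (s n - 1) <= e n.
  by rewrite -lee_fin -total_mass_fine//; exact: total_mass_lb.
have de0 n : 0 < s n - 1 by rewrite subr_gt0.
have e0 n : 0 < e n by apply: lt_le_trans (ec n); rewrite divr_gt0.
have Ysq n : limn_einf (fun m => (fluct h (s n) 0 m.+1%:R X z ^+ 2)%:E) = (Y n ^+ 2)%:E.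
  have H : (fluct h (s n) 0 m.+1%:R X z ^+ 2)%:E @[m --> \oo] --> (Y n ^+ 2)%:E.
    apply: cvg_EFin; first exact: nearW.
    have cYn := cY n; rewrite -cvg_shiftS in cYn.
    by rewrite expr2; under eq_fun do rewrite expr2; exact: cvgM.
  by have [-> _] := cvg_limn_einf_sup H.
have sY : (s n - 1) * Y n @[n --> \oo] --> (0 : R).
  have H : cvgn (series (fun n => ((s n - 1) * Y n) ^+ 2)).
    apply: cvg_series_fin => [n|]; first exact: sqr_ge0.
    apply: le_lt_trans limit_fin; rewrite le_eqVlt; apply/orP; left; apply/eqP.
    by apply: eq_eseriesr => n _; rewrite Ysq -EFinM exprMn.
  have {}H := cvg_series_cvg_0 H.
  apply: norm_cvg0.
  have -> : (fun n => `|(s n - 1) * Y n|) = (fun n => Num.sqrt (((s n - 1) * Y n) ^+ 2)).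
    by apply/funext => n; rewrite sqrtr_sqr.
  rewrite -[X in _ --> X]sqrtr0.
  exact: (continuous_cvg _ (@sqrt_continuous R 0) H).
have Ye : Y n / e n @[n --> \oo] --> (0 : R).
  have b n : `|Y n / e n| <= c^-1 * `|(s n - 1) * Y n|.
    rewrite normrM normrV ?unitfE ?gt_eqF// (ger0_norm (ltW (e0 n))) normrM.
    rewrite (ger0_norm (ltW (de0 n))) mulrA [leRHS]mulrC ler_wpM2l//.
    by rewrite -[leRHS]invrK lef_pV2 ?posrE ?invr_gt0 ?mulr_gt0 ?invr_gt0// invfM invrK.
  apply: norm_cvg0; apply: (@squeeze_cvgr _ _ _ _ (cst 0) (fun n => c^-1 * `|(s n - 1) * Y n|)).
  - by apply: nearW => n; rewrite normr_ge0 b.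
  - exact: cvg_cst.
  - by rewrite -[X in _ --> X](mulr0 c^-1); apply: cvgMr; rewrite -(normr0 R); exact: cvg_norm.
have : Y n / e n + h z @[n --> \oo] --> 0 + h z.
  by apply: cvgD => //; exact: cvg_cst.
rewrite add0r; apply: cvg_trans; apply: near_eq_cvg; apply: nearW => n /=.
by rewrite mulrDl mulfK// gt_eqF.
Qed.

End Pointwise.

Theorem real_core : s n @[n --> \oo] --> (1 : R) ->
  (forall a : R, 0 < a -> (wnorm h a < +oo)%E) ->
  (\sum_(0 <= n <oo) ((s n - 1) ^+ 2)%:E * wnorm h (2 * s n - 2) < +oo)%E ->
  {ae P, forall X, {ae @dA R, forall z, disk z -> exists G : nat -> R,
    (forall n, rstat X (annular_term h (s n) 0 m%:R z) @[m --> \oo] --> G n) /\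
    G n / fine (total_mass (s n) z) @[n --> \oo] --> h z}}.
Proof.
move=> cs wfin wsum.
have [S sS] : exists S, forall n, s n <= S.
  have /cvg_seq_bounded/bounded_fun_has_ubound[S HS] : cvgn s by apply/cvg_ex; exists 1.
  by exists S => n; apply: HS; exists n.
have A n := ae_ae_finite (@sigma_finite_dA R) (measurable_series_energy n)
  (series_energy_ge0 n) (fun z => mean_series_energy z
     (wfin _ (ltac:(by rewrite subr_gt0; exact: s1) : 0 < s n - 1))).
have B := ae_ae_finite (@sigma_finite_dA R) measurable_limit_energy
  limit_energy_ge0 (fun z => mean_limit_energy z sS wsum).
have {}A := ae_foralln A.
apply: filterS2 A B => X AX BX.
have {}AX := ae_foralln AX.
apply: filterS2 AX BX => z AXz BXz /diskE z1.
exact: pointwise_limit sS AXz BXz.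
Qed.

End RealCore.

(** * Weighted norms *)

Section NullIntegral.
Variables (R : realType) (d : measure_display) (T : measurableType d).
Variable mu : {measure set T -> \bar R}.

(** Where D and f are arbitrary, the integral is still monotone, and f is at most
    +oo times the indicator function of a null set. *)
Lemma integral_ae_zero (D : set T) (f : T -> \bar R) :
  (forall x, D x -> 0 <= f x)%E -> {ae mu, forall x, D x -> f x = 0%E} ->
  (\int[mu]_(x in D) f x = 0)%E.
Proof.
move=> f0 [N [mN N0 DN]].
apply/eqP; rewrite eq_le integral_ge0// andbT.
apply: (@le_trans _ _ (\int[mu]_(x in N) +oo)%E); last first.
  by rewrite integral_cst// N0 mule0.
rewrite [X in (X <= _)%E]integral_mkcond [leRHS]integral_mkcond.
apply: le_integral_nomeas => x _; rewrite !patchE.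
  by case: ifPn => // /set_mem; exact: f0.
case: ifPn => [xD|_]; last by case: ifPn => // _; exact: leey.
have [xN|xN] := boolP (x \in N); first exact: leey.
suff -> : f x = 0%E by [].
apply: contrapT => fx; move/negP: xN; apply; apply/mem_set/DN => /=.
by move=> H; apply: fx; apply: H; exact: set_mem.
Qed.

End NullIntegral.

Section WeightedNorms.
Variable R : realType.
Implicit Types (x z : plane R) (h : plane R -> R).

Lemma wnorm_mono h (a b : R) : a <= b -> (wnorm h b <= wnorm h a)%E.
Proof.
move=> ab; apply: le_integral_nomeas => x /diskE x1.
  by rewrite lee_fin mulr_ge0 ?sqr_ge0 ?powR_ge0.
rewrite lee_fin ler_wpM2l ?sqr_ge0// ger_powR//.
by rewrite subr_gt0 x1/= lerBlDr lerDl sqmod_ge0.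
Qed.

(** If h vanishes almost everywhere, then so does its mean about each center. *)
Lemma wnorm_eq0 h a z : real_harmonic_on (@disk R) h -> wnorm h a = 0%E ->
  disk z -> h z = 0.
Proof.
move=> hh w0 dz; have /diskE z1 := dz.
have ae0 : {ae @dA R, forall x, disk x -> h x = 0}.
  have md := @measurable_disk R.
  have mw := measurable_wnorm_integrand a hh.
  have H : (\int[@dA R]_(w in @disk R) `|(h w ^+ 2 * (1 - sqmod w) `^ a)%:E| = 0)%E.
    rewrite -[RHS]w0; apply: eq_integral => x _.
    by rewrite gee0_abs// lee_fin mulr_ge0 ?sqr_ge0 ?powR_ge0.
  move/(ae_eq_integral_abs _ md mw) : H; apply: filterS => x H dx.
  have E : h x ^+ 2 * (1 - sqmod x) `^ a = 0 by apply: EFin_inj; exact: H.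
  move/diskE: dx => x1; move/eqP: E; rewrite mulf_eq0 sqrf_eq0 powR_eq0.
  have -> : (1 - sqmod x == 0) = false by rewrite gt_eqF// subr_gt0.
  by rewrite orbF => /eqP.
have s1 : (1 : R) < 2 by rewrite ltr1n.
have t0 : 0 < fine (total_mass 2 z).
  rewrite -lte_fin -total_mass_fine//; apply: lt_le_trans (total_mass_lb z1 s1 (lexx _)).
  rewrite lte_fin divr_gt0 ?subr_gt0//; apply: mulr_gt0; first exact: mass_const_gt0.
  apply: mulr_gt0; first by rewrite powR_gt0// invr_gt0.
  by rewrite subr_gt0 expR_lt1 oppr_lt0.
have [m [m0 am]] : exists m : nat, (0 < m)%N /\ 0 < annular_mass 2 0 m%:R z.
  have [M _ HM] := cvgr_gt _ (annular_mass_cvg z1 s1) _ t0.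
  by exists M.+1; split => //; apply: HM => /=.
have b0 : 0 < m%:R :> R by rewrite ltr0n.
have ss0 : 0 <= 2 :> R by [].
have [mp [mn [Ep En E]]] := annular_mean_value 0 hh ss0 b0 z1.
have zero (p : R -> R) : p 0 = 0 -> (forall t, 0 <= p t) ->
   (\int[@dA R]_(x in @disk R) (p (annular_term h 2 0 m%:R z x) * intensity x)%:E = 0)%E.
  move=> p0 pge; apply: integral_ae_zero => [x _|].
    by rewrite lee_fin mulr_ge0 ?intensity_ge0.
  apply: filterS ae0 => x H dx.
  by rewrite annular_termE// H// mul0r p0 mul0r.
move: Ep; rewrite (zero (@ppart R)) ?/ppart ?maxxx//; last first.
  by move=> t; exact: ppart_ge0.
move: En; rewrite (zero (fun t => ppart (- t))) ?/ppart ?oppr0 ?maxxx//; last first.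
  by move=> t; exact: ppart_ge0.
move=> [mn0] [mp0]; move: E; rewrite -mn0 -mp0 subrr => /esym/eqP.
by rewrite mulf_eq0 (gt_eqF am) orbF => /eqP.
Qed.

(** The weight is at most 1. *)
Lemma wnorm1_fin (a : R) : 0 <= a -> (wnorm (fun=> 1%R : R) a < +oo)%E.
Proof.
move=> a0; apply: (@le_lt_trans _ _ (\int[@dA R]_(x in @square R) 1%:E)%E).
  rewrite /wnorm [X in (X <= _)%E]integral_mkcond [leRHS]integral_mkcond.
  apply: le_integral_nomeas => x _; rewrite !patchE.
    by case: ifPn => // _; rewrite lee_fin mulr_ge0 ?sqr_ge0 ?powR_ge0.
  case: ifPn => [|_]; last by case: ifPn.
  rewrite inE => dx; have /diskE x1 := dx.
  have sx : square x.
    by apply: contrapT => /notin_square; rewrite leNgt x1.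
  rewrite mem_set// lee_fin expr1n mul1r.
  have p0 : 0 <= 1 - sqmod x by rewrite subr_ge0 ltW.
  have p1 : 1 - sqmod x <= 1 by rewrite lerBlDr lerDl sqmod_ge0.
  by have := ge0_ler_powR a0 p0 ler01 p1; rewrite powR1.
rewrite integral_cst//=; last exact: square_measurable.
by rewrite mul1e; exact: dA_square_finite.
Qed.

Section ClassT.
Variable f : plane R -> R[i].
Hypothesis f_T : class_T f.

Local Notation u := (fun z => complex.Re (f z)).
Local Notation v := (fun z => complex.Im (f z)).

Lemma modulus_sqr z : modulus z ^+ 2 = sqmod z.
Proof. by rewrite /modulus normc_sqr. Qed.

Lemma weighted_sq_normE a : weighted_sq_norm f a =
  (\int[@dA R]_(w in @disk R) ((u w ^+ 2 + v w ^+ 2) * (1 - sqmod w) `^ a)%:E)%E.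
Proof.
by apply: eq_integral => x _; rewrite normc_sqr modulus_sqr.
Qed.

Lemma wnorm_Re_le a : (wnorm u a <= weighted_sq_norm f a)%E.
Proof.
rewrite weighted_sq_normE; apply: le_integral_nomeas => x _.
  by rewrite lee_fin mulr_ge0 ?sqr_ge0 ?powR_ge0.
by rewrite lee_fin ler_wpM2r ?powR_ge0// lerDl sqr_ge0.
Qed.

Lemma wnorm_Im_le a : (wnorm v a <= weighted_sq_norm f a)%E.
Proof.
rewrite weighted_sq_normE; apply: le_integral_nomeas => x _.
  by rewrite lee_fin mulr_ge0 ?sqr_ge0 ?powR_ge0.
by rewrite lee_fin ler_wpM2r ?powR_ge0// lerDr sqr_ge0.
Qed.

Lemma weighted_sq_norm_mono (a b : R) : a <= b ->
  (weighted_sq_norm f b <= weighted_sq_norm f a)%E.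
Proof.
move=> ab; rewrite !weighted_sq_normE; apply: le_integral_nomeas => x /diskE x1.
  by rewrite lee_fin mulr_ge0 ?addr_ge0 ?sqr_ge0 ?powR_ge0.
rewrite lee_fin ler_wpM2l ?addr_ge0 ?sqr_ge0// ger_powR//.
by rewrite subr_gt0 x1/= lerBlDr lerDl sqmod_ge0.
Qed.

(** Convergence at 0+ makes the norms finite for small exponents, and they decrease
    with the exponent. *)
Lemma weighted_sq_norm_fin a : 0 < a -> (weighted_sq_norm f a < +oo)%E.
Proof.
move=> a0; have [_ cT] := f_T.
have /fine_cvgP[near1 _] := cT.
have near2 : \forall b \near (0 : R)^'+, 0 < b /\ b < a.
  near=> b; split; near: b; [exact: nbhs_right_gt|exact: nbhs_right_lt].
have [b [b1 [b0 ba]]] := filter_ex (filterI near1 near2).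
apply: le_lt_trans (weighted_sq_norm_mono (ltW ba)) _.
rewrite ltey; apply/eqP => E; move: b1; rewrite E gt0_muley// lte_fin exprn_gt0.
Unshelve. all: by end_near. Qed.

End ClassT.
End WeightedNorms.

(** * The complex-valued series *)

Local Open Scope complex_scope.

Section ComplexLimits.
Variable R : realType.

Lemma normc_le_sum (x y : R) : Normc.normc (x +i* y) <= `|x| + `|y|.
Proof.
rewrite -ler_sqr ?nnegrE ?addr_ge0 ?normc_nonneg// normc_sqr /=.
rewrite sqrrD !real_normK ?num_real// lerD2r lerDl.
by rewrite mulrn_wge0// mulr_ge0.
Qed.

Lemma cvg_complex (a b : nat -> R) (A B : R) :
  a n @[n --> \oo] --> A -> b n @[n --> \oo] --> B ->
  (fun n => (a n +i* b n) : R[i]^o) @ \oo --> ((A +i* B) : R[i]^o).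
Proof.
move=> ca cb; apply/cvgrPdist_lt => e; rewrite ltcE => /andP[/eqP eI er].
have r0 : 0 < complex.Re e / 2 by rewrite divr_gt0.
move/cvgrPdist_lt : ca => /(_ _ r0) ca; move/cvgrPdist_lt : cb => /(_ _ r0) cb.
near=> n; rewrite ltcE /= eI eqxx /=.
have na : `|A - a n| < complex.Re e / 2 by near: n.
have nb : `|B - b n| < complex.Re e / 2 by near: n.
apply: le_lt_trans (normc_le_sum (A - a n) (B - b n)) _.
by move: na nb; move: `|_| `|_| => p q; lra.
Unshelve. all: by end_near. Qed.

End ComplexLimits.

Section ComplexSeries.
Variable R : realType.
Implicit Types (x z : plane R).
Variables (f : plane R -> R[i]) (X : configuration R) (s : R) (z : plane R).
Hypothesis z1 : sqmod z < 1.

Local Notation u := (fun z => complex.Re (f z)).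
Local Notation v := (fun z => complex.Im (f z)).
Local Notation stat h a b := (rstat X (annular_term h s a b z)).

Lemma annulusE (k : nat) x : disk x ->
  annulus k z x = (k%:R <= pdist (pdist2 z x) < k.+1%:R) :> Prop.
Proof.
move=> dx; have /diskE x1 := dx.
rewrite /annulus/= poincare_distE//; apply/propext; split => [[]//|H].
by split.
Qed.

Lemma annular_term_annulus h (k : nat) x : annular_term h s k%:R k.+1%:R z x =
  if x \in annulus k z then expR (- s * poincare_dist z x) * h x else 0.
Proof.
have [dx|dx] := pselect (disk x); last first.
  by rewrite annular_term_out// memNset// => -[].
have /diskE x1 := dx.
rewrite annular_termE// /annular_weight poincare_distE//.
have -> : (x \in annulus k z) = (k%:R <= pdist (pdist2 z x) < k.+1%:R).
  by apply/idP/idP; rewrite inE annulusE.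
by case: ifPn => _; rewrite ?mulr0// mulrC.
Qed.

(** Both sides are finite sums over the list of particles in a compact subdisk. *)
Lemma g_annulusE k : g_annulus f X s z k = stat u k%:R k.+1%:R +i* stat v k%:R k.+1%:R.
Proof.
have [rho r1 [pl pb]] := annular_term_local u s k%:R k.+1%:R z1.
have [rho' r1' [pl' _]] := annular_term_local v s k%:R k.+1%:R z1.
have {}pl' : local rho (annular_term v s k%:R k.+1%:R z).
  move=> x nx; rewrite annular_term_annulus; case: ifPn => // /set_mem.
  move=> [dx /andP[_ dk]]; case: nx; apply: pb.
  have /diskE x1 := dx.
  move: dk; rewrite poincare_distE// => /(pdist_lt (pdist2_ge0 z1 x1) (pdist2_lt1 z1 x1)).
  by rewrite pdist2E// /pball/=; lra.
have As : annulus k z `<=` subdisk rho.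
  move=> x [dx /andP[_ dk]]; apply: pb; have /diskE x1 := dx.
  move: dk; rewrite poincare_distE// => /(pdist_lt (pdist2_ge0 z1 x1) (pdist2_lt1 z1 x1)).
  by rewrite pdist2E// /pball/=; lra.
rewrite (rstatE X r1 pl) (rstatE X r1 pl') /lsum.
transitivity (\sum_(x \in annulus k z)
    ((expR (- s * poincare_dist z x))%:C * f x) *+ X x).
  by apply: eq_fsbigr => x _; rewrite -mulrA mulr_natl.
rewrite (lsum_nmod r1 X _ As).
elim: (local_points rho X) => [|x l IH]; first by rewrite !big_nil.
rewrite !big_cons IH !annular_term_annulus; case: ifPn => _; last by rewrite !add0r.
by case: (f x) => p q; apply/eqP; rewrite eq_complex/=; apply/andP; split; apply/eqP; ring.
Qed.

(** The annuli k <= d < k + 1 with k < n fill the ball d < n. *)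
Lemma sum_g_annulusE n :
  \sum_(0 <= k < n) g_annulus f X s z k = stat u 0 n%:R +i* stat v 0 n%:R.
Proof.
have zero h : stat h 0 0 = 0.
  have -> : annular_term h s 0 0 z = fun=> 0.
    apply/funext => x; have [dx|dx] := pselect (disk x); last exact: annular_term_out.
    have /diskE x1 := dx.
    rewrite annular_termE// /annular_weight ifF ?mulr0//.
    by rewrite ltNge andbN.
  by rewrite /rstat oppr0 subrr.
elim: n => [|n IH]; first by rewrite big_nil !zero.
have n0 : (0 : R) <= n%:R by [].
have nn : n%:R <= n.+1%:R :> R by rewrite ler_nat.
by rewrite big_nat_recr//= IH g_annulusE !(rstat_annular_add _ z1 _ _ n0 nn).
Qed.

Lemma g_weightedE (A B : R) : stat u 0 n%:R @[n --> \oo] --> A ->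
  stat v 0 n%:R @[n --> \oo] --> B -> g_weighted f X s z = A +i* B.
Proof.
move=> cA cB; have H := cvg_complex cA cB.
have {}H : (fun n => \sum_(0 <= k < n) g_annulus f X s z k : R[i]^o) @ \oo -->
    ((A +i* B) : R[i]^o).
  apply: cvg_trans H; apply: near_eq_cvg; apply: nearW => n /=.
  by rewrite sum_g_annulusE.
exact: (cvg_lim (@norm_hausdorff _ _) H).
Qed.

End ComplexSeries.

(** * Reconstruction of a harmonic function *)

Local Open Scope complex_scope.

Section Ratios.
Variable R : realType.
Implicit Types (x z : plane R).

Lemma complex_div_real (a b c : R) : (a +i* b) / c%:C = (a / c) +i* (b / c).
Proof.
have -> : (c%:C)^-1 = (c^-1)%:C by rewrite -fmorphV.
by apply/eqP; rewrite eq_complex/=; apply/andP; split; apply/eqP; ring.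
Qed.

Lemma esup_normc_sqr0 (a b : nat -> R) (w : R[i]) :
  a n @[n --> \oo] --> complex.Re w -> b n @[n --> \oo] --> complex.Im w ->
  limn_esup (fun n => (Normc.normc ((a n +i* b n) - w) ^+ 2)%:E) = 0%E.
Proof.
case: w => p q /= ca cb.
have H : ((a n - p) ^+ 2 + (b n - q) ^+ 2)%:E @[n --> \oo] --> (0 : R)%:E.
  apply: cvg_EFin; first exact: nearW.
  have ca0 : a n - p @[n --> \oo] --> (0 : R).
    by rewrite -[X in _ --> X](subrr p); apply: cvgB => //; exact: cvg_cst.
  have cb0 : b n - q @[n --> \oo] --> (0 : R).
    by rewrite -[X in _ --> X](subrr q); apply: cvgB => //; exact: cvg_cst.
  have H : (a n - p) * (a n - p) + (b n - q) * (b n - q) @[n --> \oo] -->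
      (0 : R) * 0 + 0 * 0.
    exact: cvgD (cvgM ca0 ca0) (cvgM cb0 cb0).
  rewrite !mulr0 addr0 in H; apply: cvg_trans H; apply: near_eq_cvg.
  by apply: nearW => n /=; rewrite !expr2.
have [_ E] := cvg_limn_einf_sup H; rewrite -[RHS]E.
by congr limn_esup; apply/funext => n; rewrite sqr_sqrtr// addr_ge0 ?sqr_ge0.
Qed.

Section Pointwise.
Variables (P : probability (Conf R) R).
Hypothesis P_dpp : determinantal_process P (@bergman_kernel R).
Variables (f : plane R -> R[i]) (X : Conf R) (s : nat -> R) (z : plane R).
Hypothesis z1 : sqmod z < 1.

Definition has_ratio_limit (h : plane R -> R) : Prop := exists G : nat -> R,
  (forall n, rstat X (annular_term h (s n) 0 m%:R z) @[m --> \oo] --> G n) /\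
  G n / fine (total_mass (s n) z) @[n --> \oo] --> h z.

Hypothesis limRe : has_ratio_limit (fun z => complex.Re (f z)).
Hypothesis limIm : has_ratio_limit (fun z => complex.Im (f z)).

Lemma esup_ratio_expected :
  limn_esup (fun n => (Normc.normc
     (g_weighted f X (s n) z / (fine (expected_g P (s n) z))%:C - f z) ^+ 2)%:E) = 0%E.
Proof.
have [Gu [cu lu]] := limRe; have [Gv [cv lv]] := limIm.
rewrite -(esup_normc_sqr0 lu lv); congr limn_esup; apply/funext => n.
by rewrite (g_weightedE z1 (cu n) (cv n)) (expected_gE z1 _ P_dpp) complex_div_real.
Qed.

(** Both sums are compared with the mean of g. *)
Lemma ratio_cvg : has_ratio_limit (fun=> 1) ->
  (fun n => g_weighted f X (s n) z / (fine (g X (s n) z))%:C : R[i]^o)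
    @ \oo --> (f z : R[i]^o).
Proof.
move=> [G1 [c1 l1]].
have [Gu [cu lu]] := limRe; have [Gv [cv lv]] := limIm.
have ratio (G : nat -> R) (l : R) :
    G n / fine (total_mass (s n) z) @[n --> \oo] --> l -> G n / G1 n @[n --> \oo] --> l.
  move=> cG.
  have H : (G n / fine (total_mass (s n) z)) * (G1 n / fine (total_mass (s n) z))^-1
      @[n --> \oo] --> l * 1^-1.
    exact: cvgM cG (cvgV (@oner_neq0 R) l1).
  rewrite invr1 mulr1 in H; apply: cvg_trans H; apply: near_eq_cvg.
  have [N _ HN] : \forall n \near \oo, 0 < G1 n / fine (total_mass (s n) z).
    exact: cvgr_gt l1 _ ltr01.
  exists N => // n /= /HN/= pos.
  have e0 : fine (total_mass (s n) z) != 0.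
    by apply/eqP => E; move: pos; rewrite E invr0 mulr0 ltxx.
  by rewrite invf_div mulrA divfK.
have := cvg_complex (ratio _ _ lu) (ratio _ _ lv).
have -> : (complex.Re (f z) +i* complex.Im (f z)) = f z by case: (f z).
apply: cvg_trans; apply: near_eq_cvg; apply: nearW => n /=.
by rewrite (g_weightedE z1 (cu n) (cv n)) (g_cvg z1 (c1 n)) complex_div_real.
Qed.

End Pointwise.

Lemma g_weighted_eq0 (f : plane R -> R[i]) X s z :
  (forall x, disk x -> f x = 0) -> g_weighted f X s z = 0.
Proof.
move=> f0; rewrite /g_weighted.
have -> : (fun n => \sum_(0 <= k < n) g_annulus f X s z k : R[i]^o) = fun=> 0.
  apply/funext => n; rewrite big1// => k _; rewrite /g_annulus.
  by rewrite fsbig1// => x [dx _]; rewrite f0// mulr0.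
exact: (cvg_lim (@norm_hausdorff _ (R[i]^o)) (cvg_cst (0 : R[i]^o))).
Qed.

(** The weighted norms decrease with the exponent, so that those of f are at least
    the one at 2 S - 2 if S bounds the sequence, and that one is positive; hence the squares of
    s n - 1 are summable. *)
Lemma sum_sq_wnorm1 (f : plane R -> R[i]) (s : nat -> R) (w : plane R) :
  class_T f -> (forall n, 1 < s n) -> s n @[n --> \oo] --> (1 : R) ->
  (\sum_(0 <= n <oo) ((s n - 1) ^+ 2)%:E * weighted_sq_norm f (2 * s n - 2) < +oo)%E ->
  disk w -> f w != 0 ->
  (\sum_(0 <= n <oo) ((s n - 1) ^+ 2)%:E * wnorm (fun=> 1%R : R) (2 * s n - 2) < +oo)%E.
Proof.
move=> f_T s1 cs ssum dw fw.
have [[hu hv] _] := f_T.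
have [S sS] : exists S, forall n, s n <= S.
  have /cvg_seq_bounded/bounded_fun_has_ubound[S HS] : cvgn s by apply/cvg_ex; exists 1.
  by exists S => n; apply: HS; exists n.
have S1 : 0 < 2 * S - 2 by have := s1 0%N; have := sS 0%N; lra.
have wfin := weighted_sq_norm_fin f_T S1.
have w0 : (0 <= weighted_sq_norm f (2 * S - 2))%E.
  exact: le_trans (wnorm_ge0 _ _) (wnorm_Re_le _ _).
have [c wfinE] : exists c : R, weighted_sq_norm f (2 * S - 2) = c%:E.
  by exists (fine (weighted_sq_norm f (2 * S - 2))); rewrite fineK// ge0_fin_numE.
have c0 : 0 < c.
  rewrite lt_neqAle -lee_fin -wfinE w0 andbT; apply/eqP => c0.
  have W0 : weighted_sq_norm f (2 * S - 2) = 0%E by rewrite wfinE -c0.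
  have u0 : wnorm (fun z => complex.Re (f z)) (2 * S - 2) = 0%E.
    by apply/eqP; rewrite eq_le wnorm_ge0 andbT -W0 wnorm_Re_le.
  have v0 : wnorm (fun z => complex.Im (f z)) (2 * S - 2) = 0%E.
    by apply/eqP; rewrite eq_le wnorm_ge0 andbT -W0 wnorm_Im_le.
  move/eqP: fw; apply; apply/eqP; rewrite eq_complex.
  by rewrite (wnorm_eq0 hu u0 dw) (wnorm_eq0 hv v0 dw) eqxx.
have fin1 := wnorm1_fin (lexx (0 : R)).
have [M fin1E] : exists M : R, wnorm (fun=> 1%R : R) 0 = M%:E.
  by exists (fine (wnorm (fun=> 1%R : R) 0)); rewrite fineK// ge0_fin_numE ?wnorm_ge0.
have M0 : 0 <= M by rewrite -lee_fin -fin1E wnorm_ge0.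
have Mc0 : (0 <= (M / c)%:E)%E by rewrite lee_fin; exact: divr_ge0 M0 (ltW c0).
have wsn0 a : (0 <= weighted_sq_norm f a)%E.
  exact: le_trans (wnorm_ge0 _ _) (wnorm_Re_le _ _).
have sq0 n : (0 <= ((s n - 1) ^+ 2)%:E)%E by rewrite lee_fin sqr_ge0.
apply: (@le_lt_trans _ _ ((M / c)%:E *
  \sum_(0 <= n <oo) ((s n - 1) ^+ 2)%:E * weighted_sq_norm f (2 * s n - 2))%E); last first.
  exact: lte_mul_pinfty.
rewrite -nneseriesZl; last by move=> n _; exact: mule_ge0 (sq0 n) (wsn0 _).
apply: lee_nneseries => [n _ _|n _]; first exact: mule_ge0 (sq0 n) (wnorm_ge0 _ _).
rewrite muleCA; apply: lee_wpmul2l (sq0 n) _ _ _.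
apply: (@le_trans _ _ M%:E).
  by rewrite -fin1E; apply: wnorm_mono; have := s1 n; lra.
have -> : M%:E = (M / c * c)%:E by rewrite divfK// gt_eqF.
rewrite EFinM; apply: lee_wpmul2l Mc0 _ _ _; rewrite -wfinE.
by apply: weighted_sq_norm_mono; have := sS n; lra.
Qed.

End Ratios.

Theorem theorem1p6 (R : realType) (P : probability (Conf R) R)
    (P_dpp : determinantal_process P (@bergman_kernel R))
    (f : plane R -> R[i]) (f_T : class_T f)
    (s : nat -> R) (s_gt1 : forall n, 1 < s n)
    (s_cvg : s n @[n --> \oo] --> (1 : R))
    (s_sum : (\sum_(0 <= n <oo)
       ((s n - 1) ^+ 2)%:E * weighted_sq_norm f (2 * s n - 2) < +oo)%E) :
  {ae P, forall X : Conf R,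
    (forall D : set (plane R), relatively_compact_in_disk D ->
       (\int[@dA R]_(z in D)
          limn_esup (fun n =>
            (Normc.normc
               (g_weighted f X (s n) z / (fine (expected_g P (s n) z))%:C
                - f z) ^+ 2)%:E)
        = 0)%E)
    /\
    {ae @dA R, forall z, disk z ->
       (fun n => g_weighted f X (s n) z / (fine (g X (s n) z))%:C : R[i]^o)
         @ \oo --> (f z : R[i]^o)}}.
Proof.
have esup_ge0 (X : Conf R) (z : plane R) : (0 <= limn_esup (fun n =>
    (Normc.normc (g_weighted f X (s n) z / (fine (expected_g P (s n) z))%:C
                - f z) ^+ 2)%:E))%E.
  apply: le_trans (limn_einf_sup _); apply: limn_einf_ge0 => n.
  by rewrite lee_fin sqr_ge0.
have [f0|] := pselect (forall x, disk x -> f x = 0).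
  apply: aeW => X; split.
    move=> D [_ Dd]; apply: integral_ae_zero => // .
    apply: aeW => z zD; have dz : disk z by apply: Dd; exact: subset_closure.
    rewrite (_ : (fun n => _) = fun=> 0%E); last first.
      apply/funext => n; rewrite g_weighted_eq0// mul0r f0// subrr.
      by rewrite Normc.normc0 expr0n.
    have [_ ->] := cvg_limn_einf_sup (cvg_cst (0%E : \bar R) : (fun=> 0%E : \bar R) @ \oo --> _).
    by [].
  apply: aeW => z dz; rewrite f0//.
  rewrite (_ : (fun n => _) = fun=> 0); first exact: cvg_cst.
  by apply/funext => n; rewrite g_weighted_eq0// mul0r.
move=> /existsNP[w /not_implyP[dw /eqP fw]].
have [[hu hv] _] := f_T.
have sumle (h : plane R -> R) : (forall a, (wnorm h a <= weighted_sq_norm f a)%E) ->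
    (\sum_(0 <= n <oo) ((s n - 1) ^+ 2)%:E * wnorm h (2 * s n - 2) < +oo)%E.
  move=> hle; apply: le_lt_trans s_sum; apply: lee_nneseries => [n _ _|n _].
    by rewrite mule_ge0 ?wnorm_ge0// lee_fin sqr_ge0.
  by rewrite lee_wpmul2l// lee_fin sqr_ge0.
have coreu := real_core P_dpp hu s_gt1 s_cvg
  (fun a a0 => le_lt_trans (wnorm_Re_le f a) (weighted_sq_norm_fin f_T a0))
  (sumle _ (wnorm_Re_le f)).
have corev := real_core P_dpp hv s_gt1 s_cvg
  (fun a a0 => le_lt_trans (wnorm_Im_le f a) (weighted_sq_norm_fin f_T a0))
  (sumle _ (wnorm_Im_le f)).
have core1 := real_core P_dpp (@harmonic_cst R 1) s_gt1 s_cvg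
  (fun a a0 => wnorm1_fin (ltW a0)) (sum_sq_wnorm1 f_T s_gt1 s_cvg s_sum dw fw).
have FP : Filter (nbhs (almost_everywhere P)) := ae_filter_ringOfSetsType P.
apply: filterS2 (filterI coreu corev) core1 => X [Xu Xv] X1; split.
  move=> D [_ Dd]; apply: integral_ae_zero => //.
  apply: filterS2 Xu Xv => z zu zv zD.
  have dz : disk z by apply: Dd; exact: subset_closure.
  have /diskE z1 := dz.
  apply: (esup_ratio_expected P_dpp z1); [exact: zu dz|exact: zv dz].
apply: filterS2 (filterI Xu Xv) X1 => z [zu zv] zo dz.
have /diskE z1 := dz.
apply: (ratio_cvg z1); [exact: zu dz|exact: zv dz|exact: zo dz].
Qed.
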